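(* Let $\rho_1,\rho_2,\kappa,\alpha,\delta,h,\tau_0,r,\mu>0$, $L>0$ and $d,\xi_1,\xi_2\in\mathbb{R}$ be such that the symmetric matrix $\begin{pmatrix}\tau_0 & d\\ d& r\end{pmatrix}$ is positive definite. Let $(\varphi,\psi,\theta,P)$ be a solution on $(0,L)\times(0,\infty)$ of $$\begin{cases}\rho_{1}\varphi_{tt}-\kappa(\varphi_{x}+\psi)_{x}+\mu\varphi_{t}=0\\ -\rho_{2}\varphi_{ttx}-\alpha\psi_{xx}+\kappa(\varphi_{x}+\psi)-\xi_{1}\theta_{x}-\xi_{2}P_{x}=0\\ \tau_{0}\theta_{t}+dP_{t}-\delta\theta_{xx}-\xi_{1}\psi_{tx}=0\\ d\theta_{t}+rP_{t}-hP_{xx}-\xi_{2}\psi_{tx}=0\end{cases}$$ with the initial conditions $\varphi(\cdot,0)=\varphi_0$, $\varphi_t(\cdot,0)=\varphi_1$, $\varphi_{tt}(\cdot,0)=\varphi_2$, $\varphi_{ttt}(\cdot,0)=\varphi_3$, $\psi(\cdot,0)=\psi_0$, $\theta(\cdot,0)=\theta_0$, $P(\cdot,0)=P_0$ and the boundary conditions $\varphi=\psi=\theta=P=0$ at $x=0,L$, $t>0$. Then there exist positive constants $\lambda_1$ and $\lambda_2$ such that the energy $$\mathcal{E}(t)=\frac12\int_{0}^{L}\Big[\rho_{1}\varphi_{t}^{2}+\alpha\psi_{x}^{2}+\kappa(\varphi_{x}+\psi)^{2}+\frac{\rho_{1}\rho_{2}}{\kappa}\varphi_{tt}^{2}+\rho_{2}\varphi_{tx}^{2}\Big]dx+\frac12\int_{0}^{L}\big[\tau_{0}\theta^{2}+rP^{2}+2d\theta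 P\big]dx$$ satisfies $$\mathcal{E}(t)\leq\lambda_2 e^{-\lambda_1 t}\qquad\text{for all } t\geq0.$$
   Context: Solutions are understood in the class $\varphi,\varphi_t\in L^\infty(\mathbb{R}_+,H^1_0(0,L))$, $\psi\in L^\infty(\mathbb{R}_+,H^1(0,L))$, $\psi_t\in L^\infty(\mathbb{R}_+,L^2_*(0,L))$, $\varphi_{tt},\theta,P\in C(\mathbb{R}_+,L^2(0,L))$, where $L^2_*(0,L)=\{u\in L^2(0,L):\int_0^Lu\,dx=0\}$. *)

(* Defs.v *)
From HB Require Import structures.
From mathcomp Require Import all_boot all_order all_algebra.
From mathcomp Require Import all_classical all_reals all_analysis.

Set Implicit Arguments.
Unset Strict Implicit.
Unset Printing Implicit Defensive.

Import Order.TTheory GRing.Theory Num.Theory.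
Import numFieldNormedType.Exports.

Local Open Scope ring_scope.
Local Open Scope classical_set_scope.

Definition posdefmx (R : realType) (n : nat) (A : 'M[R]_n) : Prop :=
  A^T = A /\ forall v : 'cV[R]_n, v != 0 -> 0 < (v^T *m A *m v) 0 0.

(* The symmetric matrix with rows (a, b) and (b, c). *)
Definition symmx2 (R : realType) (a b c : R) : 'M[R]_(1 + 1) :=
  block_mx a%:M b%:M b%:M c%:M.

(* C^oo functions whose support is contained in a compact subset of the open
   interval I; here I is ]0, L[ or ]0, +oo[. *)
Definition test_function (R : realType) (I : set R) (f : R -> R) : Prop :=
  (forall (n : nat) (x : R), derivable (derive1n n f) x 1) /\
  exists a b : R, `[a, b] `<=` I /\ forall x, ~ `[a, b] x -> f x = 0.

(* Elements of the spaces below are represented by functions R -> R of which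
   only the values on ]0, L[ matter. *)
Section Space.
Context {R : realType} (L : R).
Implicit Types u v g chi : R -> R.

Local Notation mu := (@lebesgue_measure R).

Definition L2 u : Prop :=
  measurable_fun `]0, L[ u /\
  mu.-integrable `]0, L[ (fun x => ((u x) ^+ 2)%:E).

Definition inner u v : R := \int[mu]_(x in `]0, L[) (u x * v x).

Definition sqnormL2 u : R := inner u u.

(* u belongs to H^1(0,L) and its weak derivative is g *)
Definition is_wderiv u g : Prop :=
  [/\ L2 u, L2 g &
      forall chi, test_function `]0, L[ chi ->
        inner u (derive1 chi) = - inner g chi].

Definition H1 u : Prop := exists g, is_wderiv u g.

(* The weak derivative of u, unique up to null sets; the value 0 is only
   taken when u is not in H^1(0,L). *)
Definition dx u : R -> R := xget (fun=> 0) [set g | is_wderiv u g].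

Definition sqnormH1 u : R := sqnormL2 u + sqnormL2 (dx u).

(* H^1_0(0,L): closure of the test functions in H^1(0,L) *)
Definition H10 u : Prop :=
  H1 u /\
  forall e : R, 0 < e -> exists chi, test_function `]0, L[ chi /\
    sqnormL2 (u \- chi) + sqnormL2 (dx u \- derive1 chi) < e.

(* L^2_*(0,L) *)
Definition L2star u : Prop :=
  L2 u /\ \int[mu]_(x in `]0, L[) u x = 0.

End Space.

(* A function of (t, x) is written u : R -> R -> R, with u t := u(., t);
   only the times t >= 0 matter. *)
Section TimeDependent.
Context {R : realType} (L : R).
Implicit Types u ut : R -> R -> R.

Local Notation mu := (@lebesgue_measure R).

(* u in L^oo(R_+, X), where X is a subspace of L^2(0,L) whose squared norm is
   sqnorm. The first condition is weak measurability in L^2(0,L); as the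
   spaces are separable it amounts, by Pettis' theorem, to Bochner
   measurability (also in X = H^1 or H^1_0). *)
Definition Linfty (X : (R -> R) -> Prop) (sqnorm : (R -> R) -> R) u : Prop :=
  (forall v, L2 L v -> measurable_fun (`[0, +oo[ : set R) (fun t : R => inner L (u t) v)) /\
  exists M : R, {ae mu, forall t : R, 0 <= t -> X (u t) /\ sqnorm (u t) <= M}.

(* u in C(R_+, L^2(0,L)) *)
Definition continuousL2 u : Prop :=
  (forall t : R, 0 <= t -> L2 L (u t)) /\
  forall t : R, 0 <= t ->
    sqnormL2 L (u s \- u t) @[s --> within [set s | 0 <= s] (nbhs t)] --> 0.

(* ut is the derivative of u with respect to t, in the distributional sense.
   Here and below, distributions on (0,oo) x (0,L) are tested against the
   products eta(t) v(x), whose span is dense in the test functions. *)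
Definition is_time_deriv u ut : Prop :=
  forall v eta, test_function `]0, L[ v -> test_function `]0, +oo[ eta ->
    \int[mu]_(t in `]0, +oo[) (inner L (u t) v * derive1 eta t) =
    - \int[mu]_(t in `]0, +oo[) (inner L (ut t) v * eta t).

(* The boundary condition u = 0 at x = 0, L for t > 0: u is in
   L^2_loc((0,oo), H^1_0(0,L)). *)
Definition zero_boundary u : Prop :=
  forall a b : R, 0 < a -> a < b ->
    {ae mu, forall t : R, `[a, b] t -> H10 L (u t)} /\
    (\int[mu]_(t in `[a, b]) (sqnormH1 L (u t))%:E < +oo)%E.

(* u(., 0) = u0 *)
Definition initial_value u (u0 : R -> R) : Prop :=
  {ae mu, forall x : R, `]0, L[ x -> u 0 x = u0 x}.

(* u_t(., 0) = w, with w a distribution on (0,L) acting on test functions: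
   the right derivative of u at t = 0 in the sense of distributions. *)
Definition initial_velocity u (w : (R -> R) -> R) : Prop :=
  forall v, test_function `]0, L[ v ->
    (inner L (u t) v - inner L (u 0) v) / t @[t --> 0^'+] --> w v.

End TimeDependent.

Section System.
Context {R : realType}.
Variables (rho1 rho2 kappa alpha delta h tau0 r mu L d xi1 xi2 : R).
Variables (phi phit phitt psi psit theta P : R -> R -> R).

Local Notation leb := (@lebesgue_measure R).
Local Notation "<< u , v >>" := (inner L u v).

(* The functions phi, phit and psi are elements of L^oo with a bounded time
   derivative with values in L^2(0,L); they denote the representatives that
   are continuous in time with values in L^2(0,L), so that they have values at
   every t >= 0. Since they are also bounded in H^1(0,L) for a.e. t, those
   values are in H^1(0,L) for every t >= 0. *)
Record solution_class : Prop := {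
  class_phi   : Linfty L (H10 L) (sqnormH1 L) phi;
  class_phit  : Linfty L (H10 L) (sqnormH1 L) phit;
  class_psi   : Linfty L (H1 L) (sqnormH1 L) psi;
  class_psit  : Linfty L (L2star L) (sqnormL2 L) psit;
  class_phitt : continuousL2 L phitt;
  class_theta : continuousL2 L theta;
  class_P     : continuousL2 L P;
  deriv_phi   : is_time_deriv L phi phit;
  deriv_phit  : is_time_deriv L phit phitt;
  deriv_psi   : is_time_deriv L psi psit;
  repr_phi    : continuousL2 L phi;
  repr_phit   : continuousL2 L phit;
  repr_psi    : continuousL2 L psi
}.

(* The four equations in the sense of distributions on (0,oo) x (0,L): every
   x-derivative is moved onto v, and the t-derivatives of theta and P onto
   eta; e.g. - delta theta_xx gives - delta << theta, v'' >> and
   - xi1 psi_tx gives xi1 << psi_t, v' >>. *)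
Record equations : Prop := {
  equation1 : forall v eta,
    test_function `]0, L[ v -> test_function `]0, +oo[ eta ->
    \int[leb]_(t in `]0, +oo[)
      ((rho1 * << phitt t, v >>
        + kappa * (<< psi t, derive1 v >> - << phi t, derive1n 2 v >>)
        + mu * << phit t, v >>) * eta t) = 0;
  equation2 : forall v eta,
    test_function `]0, L[ v -> test_function `]0, +oo[ eta ->
    \int[leb]_(t in `]0, +oo[)
      ((rho2 * << phitt t, derive1 v >>
        - alpha * << psi t, derive1n 2 v >>
        + kappa * (<< psi t, v >> - << phi t, derive1 v >>)
        + xi1 * << theta t, derive1 v >>
        + xi2 * << P t, derive1 v >>) * eta t) = 0;
  equation3 : forall v eta,
    test_function `]0, L[ v -> test_function `]0, +oo[ eta ->
    \int[leb]_(t in `]0, +oo[)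
      (- (tau0 * << theta t, v >> + d * << P t, v >>) * derive1 eta t
       + (xi1 * << psit t, derive1 v >>
          - delta * << theta t, derive1n 2 v >>) * eta t) = 0;
  equation4 : forall v eta,
    test_function `]0, L[ v -> test_function `]0, +oo[ eta ->
    \int[leb]_(t in `]0, +oo[)
      (- (d * << theta t, v >> + r * << P t, v >>) * derive1 eta t
       + (xi2 * << psit t, derive1 v >>
          - h * << P t, derive1n 2 v >>) * eta t) = 0
}.

Record boundary_conditions : Prop := {
  boundary_phi   : zero_boundary L phi;
  boundary_psi   : zero_boundary L psi;
  boundary_theta : zero_boundary L theta;
  boundary_P     : zero_boundary L P
}.

(* In the class above phi_ttt has no value in L^2(0,L), so that phi3 is a
   distribution. *)
Record initial_conditions (phi0 phi1 phi2 : R -> R) (phi3 : (R -> R) -> R)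
    (psi0 theta0 P0 : R -> R) : Prop := {
  initial_phi    : initial_value L phi phi0;
  initial_phit   : initial_value L phit phi1;
  initial_phitt  : initial_value L phitt phi2;
  initial_phittt : initial_velocity L phitt phi3;
  initial_psi    : initial_value L psi psi0;
  initial_theta  : initial_value L theta theta0;
  initial_P      : initial_value L P P0
}.

Definition energy (t : R) : R :=
  2^-1 * \int[leb]_(x in `]0, L[)
    (rho1 * phit t x ^+ 2 + alpha * dx L (psi t) x ^+ 2
     + kappa * (dx L (phi t) x + psi t x) ^+ 2
     + rho1 * rho2 / kappa * phitt t x ^+ 2
     + rho2 * dx L (phit t) x ^+ 2)
  + 2^-1 * \int[leb]_(x in `]0, L[)
    (tau0 * theta t x ^+ 2 + r * P t x ^+ 2 + 2 * d * theta t x * P t x).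

End System.

(* Main.v *)
(* The energy identity cannot be tested directly, as the solution has too little
   time regularity, so the solution is mollified in time with kernels supported
   in t > 0: u^eta(t) = \int eta(s - t) u(s) ds. The system has constant
   coefficients, hence the mollified functions solve it too; they are smooth in
   time with values in H^1_0, and their pairings with test functions of x
   determine them (u^eta is a Riesz representative).
   For them E' = - mu |phi_t|^2 - (mu rho2 / kappa) |phi_tt|^2
     - delta |theta_x|^2 - h |P_x|^2.
   Testing the first equation against phi and the second against psi bounds
   alpha |psi_x|^2 + kappa |phi_x + psi|^2 by this dissipation at each time, and
   the derivative of F = rho1 <phi_tt, phi_t> - kappa <psi_x, phi_t> supplies
   the missing - kappa |phi_tx|^2. So N E + F, for N large, is equivalent to E
   and decays exponentially, with constants that do not depend on eta. As eta
   is positive with integral 1, the initial energies are uniformly bounded, and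
   shrinking the support of eta to 0+ transfers the bound to the pairings of
   the solution with test functions, hence to its L2 norms. *)

Require Import Defs.
From HB Require Import structures.
From mathcomp Require Import all_boot all_order all_algebra.
From mathcomp Require Import all_classical all_reals all_analysis.
From mathcomp Require Import measurable_realfun ring lra.

Set Implicit Arguments.
Unset Strict Implicit.
Unset Printing Implicit Defensive.

Import Order.TTheory GRing.Theory Num.Theory.
Import numFieldNormedType.Exports.

Local Open Scope ring_scope.
Local Open Scope classical_set_scope.

(** * Semi-inner products and square-integrable functions *)

(** The energy contains the term in [phi_tt] because the second equation has [rho2 phi_ttx] and no
    [psi_tt]. Tested with [psi_t] it leaves [rho2 <phi_tt, psi_tx>], and this is cancelled by the
    time derivative of the first equation tested with [(rho2 / kappa) phi_tt]. For the same reason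
    [psi] has no kinetic energy, so its norm must be recovered at each fixed instant. Two obstacles
    shape the mollification. It is never formed as a vector-valued integral, only prescribed by its
    pairings. Riesz in H^1_0 represents the pairings with [chi - chi''], and those with [chi] itself
    follow by approximately solving [w - w'' = chi]. Moreover nothing says that the H^1 norm of the
    solution is measurable in time, so its integral may only be used through monotonicity. Kernels
    look forward in time and have support away from 0, so the mollified functions also make sense at
    slightly negative times and are differentiable at [t = 0]. The bound obtained is not a multiple
    of the initial energy: it comes from bounds on the solution on a short interval after 0. *)

Lemma scale_subr (R : pzRingType) (V : lmodType R) (c : R) (x y z w : V) :
  c *: x + y - (c *: z + w) = c *: (x - z) + (y - w).
Proof. by rewrite scalerBr opprD addrACA. Qed.

(** Null vectors are allowed, so functions need not be identified up to null sets. The domain is a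
    predicate, so that the same lemmas serve [L2] and the incomplete space of test functions, with
    either the L2 or the H^1 product. *)
Record semi_inner (R : realType) (V : lmodType R) (W : V -> Prop)
    (a : V -> V -> R) : Prop := SemiInner {
  semi_inner0 : W 0;
  semi_innerP : forall c u v, W u -> W v -> W (c *: u + v);
  semi_inner_sym : forall u v, W u -> W v -> a u v = a v u;
  semi_inner_lin : forall c u v w, W u -> W v -> W w ->
    a (c *: u + v) w = c * a u w + a v w;
  semi_inner_ge0 : forall u, W u -> 0 <= a u u }.

Section SemiInner.
Variables (R : realType) (V : lmodType R) (W : V -> Prop) (a : V -> V -> R).
Hypothesis aW : semi_inner W a.
Implicit Types u v w : V.

Let W0 := semi_inner0 aW.
Let asym := semi_inner_sym aW.
Let a_ge0 := semi_inner_ge0 aW.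

Lemma siD u v : W u -> W v -> W (u + v).
Proof. by move=> Wu Wv; rewrite -[u]scale1r; exact: (semi_innerP aW). Qed.

Lemma siZ c u : W u -> W (c *: u).
Proof. by move=> Wu; rewrite -[_ *: _]addr0; exact: (semi_innerP aW). Qed.

Lemma siN u : W u -> W (- u).
Proof. by move=> Wu; rewrite -scaleN1r; exact: siZ. Qed.

Lemma siB u v : W u -> W v -> W (u - v).
Proof. by move=> Wu Wv; apply: siD => //; exact: siN. Qed.

Lemma aDl u v w : W u -> W v -> W w -> a (u + v) w = a u w + a v w.
Proof.
by move=> Wu Wv Ww; have := semi_inner_lin aW 1 Wu Wv Ww; rewrite scale1r mul1r.
Qed.

Lemma a0l w : W w -> a 0 w = 0.
Proof. by move=> Ww; have := aDl W0 W0 Ww; rewrite addr0; lra. Qed.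

Lemma aZl c u w : W u -> W w -> a (c *: u) w = c * a u w.
Proof.
by move=> Wu Ww; have := semi_inner_lin aW c Wu W0 Ww; rewrite !addr0 a0l// addr0.
Qed.

Lemma aNl u w : W u -> W w -> a (- u) w = - a u w.
Proof. by move=> Wu Ww; rewrite -scaleN1r aZl// mulN1r. Qed.

Lemma aBl u v w : W u -> W v -> W w -> a (u - v) w = a u w - a v w.
Proof. by move=> Wu Wv Ww; rewrite aDl ?aNl//; exact: siN. Qed.

Lemma aDr u v w : W u -> W v -> W w -> a w (u + v) = a w u + a w v.
Proof. by move=> Wu Wv Ww; rewrite ![a w _]asym ?aDl//; exact: siD. Qed.

Lemma aZr c u w : W u -> W w -> a w (c *: u) = c * a w u.
Proof. by move=> Wu Ww; rewrite ![a w _]asym ?aZl//; exact: siZ. Qed.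

Lemma aBr u v w : W u -> W v -> W w -> a w (u - v) = a w u - a w v.
Proof. by move=> Wu Wv Ww; rewrite ![a w _]asym ?aBl//; exact: siB. Qed.

Lemma sqD u v c : W u -> W v ->
  a (u + c *: v) (u + c *: v) = a u u + 2 * c * a u v + c ^+ 2 * a v v.
Proof.
move=> Wu Wv; have Wcv := siZ c Wv.
rewrite aDl ?aDr ?aZl ?aZr//; try exact: siD.
by rewrite (asym Wv Wu); ring.
Qed.

(* The discriminant of a quadratic polynomial that is bounded below. *)
Lemma quad_discr (e b c : R) : 0 <= c ->
  (forall t, 0 <= e + 2 * t * b + t ^+ 2 * c) -> b ^+ 2 <= e * c.
Proof.
rewrite le_eqVlt => /predU1P[<- |c0] h.
  rewrite mulr0; have [->|b0] := eqVneq b 0; first by rewrite expr0n.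
  have := h (- (e + 1) / (2 * b)).
  have -> : e + 2 * (- (e + 1) / (2 * b)) * b +
    (- (e + 1) / (2 * b)) ^+ 2 * 0 = -1 by field.
  lra.
have := h (- b / c).
have -> : e + 2 * (- b / c) * b + (- b / c) ^+ 2 * c = (e * c - b ^+ 2) / c.
  by field; exact: lt0r_neq0.
by rewrite pmulr_lge0 ?invr_gt0// subr_ge0.
Qed.

Lemma cauchy_schwarz u v : W u -> W v -> a u v ^+ 2 <= a u u * a v v.
Proof.
move=> Wu Wv; apply: quad_discr => [|t]; first exact: a_ge0.
by rewrite -sqD//; apply/a_ge0/siD => //; exact: siZ.
Qed.

Lemma sq_le_sqD u v : W u -> W v -> a (u + v) (u + v) <= 2 * (a u u + a v v).
Proof.
move=> Wu Wv; have := a_ge0 (siB Wu Wv).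
have := sqD 1 Wu Wv; have := sqD (-1) Wu Wv.
by rewrite scale1r scaleN1r; lra.
Qed.

(* Approximate minimizers of [w |-> a w w - 2 f w] almost represent [f]. *)
Lemma approx_riesz (f : V -> R) (M : R) :
  (forall c u v, W u -> W v -> f (c *: u + v) = c * f u + f v) ->
  (forall u, W u -> f u ^+ 2 <= M * a u u) ->
  forall e, 0 < e -> exists2 w, W w &
    forall v, W v -> (a w v - f v) ^+ 2 <= e * a v v.
Proof.
move=> flin fM e e0.
have f0 : f 0 = 0 by have := flin 1 _ _ W0 W0; rewrite scale1r addr0; lra.
pose J w := a w w - 2 * f w.
have M0 : 0 <= Num.max M 1 by rewrite le_max ler01 orbT.
have Jlb : lbound [set J w | w in W] (- Num.max M 1).
  move=> _ [w Ww <-]; rewrite /J.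
  have : f w ^+ 2 <= Num.max M 1 * a w w.
    by apply: (le_trans (fM _ Ww)); apply: ler_wpM2r; rewrite ?a_ge0// le_max lexx.
  have := a_ge0 Ww; have : 1 <= Num.max M 1 by rewrite le_max lexx orbT.
  move: (Num.max M 1) (f w) (a w w) => m x y m1 y0 xy.
  have h : (2 * x) ^+ 2 <= (m + y) ^+ 2 by have := sqr_ge0 (m - y); nra.
  have : 2 * x <= m + y by rewrite leNgt; apply/negP => k; nra.
  lra.
have Jinf : has_inf [set J w | w in W] by split; [exists (J 0), 0|exists (- Num.max M 1)].
have [_ [w Ww <-] Jw] := inf_adherent e0 Jinf.
(* The polynomial in [t] is [J (w + t *: v) - J w + e]. It is nonnegative because [J w] exceeds the
   infimum by less than [e]. *)
exists w => // v Wv; apply: quad_discr => [|t]; first exact: a_ge0.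
have Wtv := siZ t Wv; have Wwtv := siD Ww Wtv.
have : inf [set J w | w in W] <= J (w + t *: v).
  by apply: (ge_inf Jinf.2); exists (w + t *: v).
have fwtv : f (w + t *: v) = t * f v + f w by rewrite addrC flin.
rewrite /J sqD// fwtv.
have := Jw; rewrite /J; set i := inf _; nra.
Qed.

End SemiInner.

Section SquareIntegrable.
Variables (disp : measure_display) (T : measurableType disp) (R : realType).
Variables (mu : {measure set T -> \bar R}) (D : set T).
Hypothesis mD : measurable D.
Implicit Types u v w : T -> R.

Definition sqint u := measurable_fun D u /\
  mu.-integrable D (fun x => ((u x) ^+ 2)%:E).

Definition ip u v : R := \int[mu]_(x in D) (u x * v x).

Lemma sqint_mul u v : sqint u -> sqint v ->
  mu.-integrable D (EFin \o (fun x => u x * v x)).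
Proof.
move=> [mu_ iu] [mv iv].
refine (le_integrable mD _ _ (integrableD mD iu iv)).
  by apply/measurable_EFinP; exact: measurable_funM.
move=> x Dx /=; rewrite lee_fin [leRHS]ger0_norm ?addr_ge0 ?sqr_ge0//.
by rewrite ler_norml; have := sqr_ge0 (u x - v x); have := sqr_ge0 (u x + v x); nra.
Qed.

Lemma sqint_semi_inner : semi_inner sqint ip.
Proof.
split.
- split; first exact: measurable_cst.
  rewrite (_ : (fun _ => _) = cst 0%E); first exact: integrable0.
  by apply/funext => x /=; rewrite expr0n.
- move=> c u v [mu_ iu] [mv iv]; split.
    by apply: measurable_funD => //; exact: measurable_funM.
  refine (le_integrable mD _ _ (integrableD mD
    (integrableZl mD (2 * c ^+ 2) iu) (integrableZl mD 2 iv))).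
    apply/measurable_EFinP/measurable_funX/measurable_funD => //.
    exact: measurable_funM.
  move=> x Dx /=; rewrite lee_fin !ger0_norm ?sqr_ge0//.
    rewrite -[(c *: u + v) x]/(c * u x + v x).
    have := sqr_ge0 (c * u x - v x); nra.
  by rewrite addr_ge0// mulr_ge0 ?sqr_ge0// mulr_ge0 ?sqr_ge0.
- by move=> u v _ _; apply: eq_Rintegral => x _; rewrite mulrC.
- move=> c u v w Wu Wv Ww.
  have iuw := sqint_mul Wu Ww; have ivw := sqint_mul Wv Ww.
  rewrite /ip -RintegralZl// -RintegralD//; last first.
    exact: (integrableZl mD c iuw).
  by apply: eq_Rintegral => x _; rewrite mulrDl mulrA.
- by move=> u _; apply: Rintegral_ge0 => x _; exact: sqr_ge0.
Qed.

Lemma ipE u : sqint u -> (ip u u)%:E = (\int[mu]_(x in D) ((u x) ^+ 2)%:E)%E.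
Proof.
move=> [_ iu]; rewrite fineK//.
exact: integrable_fin_num.
Qed.

Lemma limn_einf_le (a : (\bar R)^nat) (c : \bar R) n :
  (forall m, (n <= m)%N -> (a m <= c)%E) -> (limn_einf a <= c)%E.
Proof.
move=> ac; rewrite limn_einf_lim; apply: lime_le; first exact: is_cvg_einfs.
near=> k; apply: ereal_inf_le; exists (a (maxn n k)); last exact/ac/leq_maxl.
by exists (maxn n k) => //=; exact: leq_maxr.
Unshelve. all: end_near.
Qed.

(** Riesz-Fischer. The geometric rate makes the sequence itself converge almost everywhere, without
    passing to a subsequence. *)
Lemma sqint_complete (u : nat -> T -> R) : (forall n, sqint (u n)) ->
  (forall n m, (n <= m)%N -> ip (u n - u m) (u n - u m) <= 4^-1 ^+ n) ->
  exists2 v, sqint v & forall n, ip (u n - v) (u n - v) <= 4^-1 ^+ n.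
Proof.
move=> su cu.
have sB f g : sqint f -> sqint g -> sqint (f - g) by exact: (siB sqint_semi_inner).
(* The weight [2 ^+ n] is small enough for the integrals, at most [2^-n], to be summable, and large
   enough for the finiteness of the sum [S x] to force convergence at [x]. *)
pose g n x := (2 ^+ n * (u n.+1 x - u n x) ^+ 2)%:E : \bar R.
have g0 n x : (0 <= g n x)%E by rewrite lee_fin mulr_ge0 ?sqr_ge0// exprn_ge0.
have msq n m : measurable_fun D (fun x => ((u n x - u m x) ^+ 2)%:E).
  by apply/measurable_EFinP/measurable_funX; exact: (sB _ _ (su n) (su m)).1.
have mg n : measurable_fun D (g n).
  rewrite (_ : g n = (fun x => (2 ^+ n)%:E * ((u n.+1 x - u n x) ^+ 2)%:E)%E)//.
  exact/measurable_funeM.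
have intsq n m : (n <= m)%N ->
    (\int[mu]_(x in D) ((u n x - u m x) ^+ 2)%:E <= (4^-1 ^+ n)%:E)%E.
  move=> nm; have := cu n m nm; rewrite -lee_fin ipE; last exact: sB.
  by [].
pose S x := (\sum_(0 <= n <oo) g n x)%E.
have mS : measurable_fun D S by exact: ge0_emeasurable_sum.
have S0 x : (0 <= S x)%E by apply: nneseries_ge0.
have intg n : (\int[mu]_(x in D) g n x <= (2 / (2 ^ (n + 1))%:R)%:E)%E.
  rewrite /g; under eq_integral do rewrite EFinM.
  rewrite ge0_integralZl_EFin//; last first.
    by move=> x _; rewrite lee_fin sqr_ge0.
  apply: (@le_trans _ _ ((2 ^+ n)%:E * (4^-1 ^+ n)%:E)%E).
    rewrite lee_pmul2l// ?lte_fin ?exprn_gt0//.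
    have := intsq _ _ (leqnSn n).
    by under eq_integral do rewrite -sqrrN opprB.
  rewrite -EFinM lee_fin addn1 expnS natrM invfM mulrA divff// mul1r natrX.
  have h : 2 * 4^-1 = 2^-1 :> R by field.
  by rewrite -exprMn -exprVn h.
have intS : (\int[mu]_(x in D) S x < +oo)%E.
  rewrite integral_nneseries//.
  apply: (@le_lt_trans _ _ (\sum_(0 <= n <oo) (2 / (2 ^ (n + 1))%:R)%:E)%E).
    by apply: lee_nneseries => [k _ _|k _]; [exact: integral_ge0|exact: intg].
  by have /cvg_lim -> // := @cvg_geometric_eseries_half R 2 0; rewrite ltry.
have iS : mu.-integrable D S.
  apply/integrableP; split => //.
  by under eq_integral do rewrite gee0_abs//.
pose A := D `&` [set x | (S x < +oo)%E].
have mA : measurable A by exact: emeasurable_fun_infty_o.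
have cvgA x : A x -> cvgn (u ^~ x).
  move=> [Dx /= Sx].
  have Sfin : S x \is a fin_num by rewrite ge0_fin_numE.
  pose w n := u n.+1 x - u n x.
  suff : cvgn (series w).
    have -> : series w = (fun n => u n x - u 0%N x).
      by rewrite (_ : w = telescope (u ^~ x))// telescopeK.
    move=> cv; rewrite (_ : u ^~ x = (fun n => (u n x - u 0%N x) + u 0%N x)).
      by apply: is_cvgD => //; exact: is_cvg_cst.
    by apply/funext => n; rewrite subrK.
  apply: normed_cvg.
  (* Absolute convergence from the arithmetic-geometric bound [|w n| <= 2^-n + 2^n (w n)^2]. *)
  apply: (@series_le_cvg _ _ (fun n => geometric 1 2^-1 n + 2 ^+ n * w n ^+ 2)).
  - by move=> n; exact: normr_ge0.
  - move=> n; apply: addr_ge0; first by rewrite geometric_ge0.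
    by rewrite mulr_ge0 ?sqr_ge0 ?exprn_ge0.
  - move=> n; rewrite /= /geometric/= mul1r exprVn.
    have e0 : 0 < 2 ^+ n :> R by exact: exprn_gt0.
    rewrite -(real_normK (num_real (w n))); move: `|w n| (normr_ge0 (w n)) => y y0.
    rewrite -(ler_pM2l e0) mulrDr divff ?gt_eqF//.
    have := sqr_ge0 (2 ^+ n * y - 1).
    by rewrite expr2; move: (2 ^+ n : R) e0 => z z0; nra.
  rewrite seriesD; apply: is_cvgD.
    by apply: is_cvg_geometric_series; rewrite ger0_norm// invf_lt1// ltr1n.
  apply: nondecreasing_is_cvgn.
    by apply/nondecreasing_series => n _ _; rewrite mulr_ge0 ?sqr_ge0 ?exprn_ge0.
  exists (fine (S x)) => _ [n _ <-]; rewrite -lee_fin fineK// /series/= -sumEFin.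
  by apply: (@nneseries_lim_ge _ (g ^~ x) xpredT 0%N n) => k _ _; exact: g0.
(* Multiplying by the indicator of [A] makes the limit exist at every point, which gives the
   measurability of [v]. *)
pose v x := limn (fun n => u n x * \1_A x).
have cv x : D x -> (u n x * \1_A x) @[n --> \oo] --> v x.
  move=> Dx; rewrite /v; have [Ax|Ax] := pselect (A x).
    rewrite indicE mem_set// mulr1n; under eq_fun do rewrite mulr1.
    exact: cvgA.
  rewrite indicE memNset// mulr0n.
  rewrite (_ : (fun n : nat => _) = (fun n => 0)); last first.
    by apply/funext => n; rewrite mulr0.
  exact: is_cvg_cst.
have vA x : A x -> u n x @[n --> \oo] --> v x.
  move=> Ax; have := cv x Ax.1; rewrite indicE mem_set//.
  by under eq_fun do rewrite mulr1.
have mv : measurable_fun D v.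
  apply: (measurable_fun_cvg _ cv) => n.
  apply: measurable_funM; first exact: (su n).1.
  exact: measurable_indic.
(* Fatou in [m] with [n] fixed keeps the rate for the limit. *)
have intv n : (\int[mu]_(x in D) ((u n x - v x) ^+ 2)%:E <= (4^-1 ^+ n)%:E)%E.
  pose f m x := ((u n x - u m x) ^+ 2)%:E : \bar R.
  apply: (@le_trans _ _ (\int[mu]_(x in D) limn_einf (f ^~ x))%E); last first.
    apply: (le_trans (fatou mu mD (fun m => msq n m) _)).
      by move=> m x _; rewrite lee_fin sqr_ge0.
    by apply: (@limn_einf_le _ _ n) => m; exact: intsq.
  apply: ae_ge0_le_integral => //.
  - by move=> x _; rewrite lee_fin sqr_ge0.
  - apply/measurable_EFinP/measurable_funX/measurable_funB => //.
    exact: (su n).1.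
  - move=> x _; rewrite limn_einf_lim; apply: lime_ge; first exact: is_cvg_einfs.
    apply: nearW => k; apply: le_ereal_inf_tmp => _ [m _ <-].
    by rewrite lee_fin sqr_ge0.
  - have -> : (fun x => limn_einf (f ^~ x)) =
              (fun x => - limn_esup ((fun m => \- (f m)) ^~ x))%E.
      by apply/funext => x; rewrite -limn_einfN; congr limn_einf;
         apply/funext => m; rewrite /comp oppeK.
    apply: measurableT_comp => //; apply: measurable_fun_limn_esup => m.
    by apply: measurableT_comp => //; exact: msq.
  have := integrable_ae mD iS; apply: filterS => x + Dx => /(_ Dx) Sx.
  have Ax : A x by split => //=; rewrite -ge0_fin_numE.
  have fx : f m x @[m --> \oo] --> ((u n x - v x) ^+ 2)%:E.
    apply: cvg_EFin; first by apply: nearW.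
    rewrite (_ : fine \o _ = (fun m => (u n x - u m x) * (u n x - u m x)))//.
    by rewrite expr2; apply: cvgM; apply: cvgB;
       [exact: cvg_cst|exact: vA|exact: cvg_cst|exact: vA].
  by rewrite is_cvg_limn_einfE; [rewrite (cvg_lim _ fx)|apply/cvg_ex; eexists; exact: fx].
have sv n : sqint (u n - v).
  have m_ : measurable_fun D (u n - v) by apply: measurable_funB => //; exact: (su n).1.
  split => //; apply/integrableP; split.
    exact/measurable_EFinP/measurable_funX.
  under eq_integral do rewrite gee0_abs ?lee_fin ?sqr_ge0//.
  by apply: (le_lt_trans (intv n)); rewrite ltry.
exists v.
  have -> : v = u 0%N - (u 0%N - v) by rewrite subKr.
  exact: (sB _ _ (su 0%N) (sv 0%N)).
by move=> n; rewrite -lee_fin ipE; [exact: intv|exact: sv].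
Qed.

End SquareIntegrable.

Section SemiInnerLimits.
Variables (R : realType) (V : lmodType R) (W : V -> Prop) (a : V -> V -> R).
Hypothesis aW : semi_inner W a.
Implicit Types u v w : V.

Let WB u v : W u -> W v -> W (u - v). Proof. exact: (siB aW). Qed.

Lemma cvg_sqr0 (s : nat -> R) : s n ^+ 2 @[n --> \oo] --> 0 -> s n @[n --> \oo] --> 0.
Proof.
move=> /cvgrPdist_lt h; apply/cvgrPdist_lt => e e0.
have e2 : 0 < e ^+ 2 by rewrite exprn_gt0.
have := h _ e2; apply: filterS => n; rewrite !sub0r !normrN normrX ltr_sqr//.
by rewrite nnegrE ltW.
Qed.

Lemma cvg_geometric4 : (4^-1 ^+ n : R) @[n --> \oo] --> 0.
Proof. by apply: cvg_expr; rewrite ger0_norm// invf_lt1// ltr1n. Qed.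

Lemma cvg_semi_inner v (u_ : nat -> V) u : W v -> (forall n, W (u_ n)) -> W u ->
  a (u_ n - u) (u_ n - u) @[n --> \oo] --> 0 -> a v (u_ n) @[n --> \oo] --> a v u.
Proof.
move=> Wv Wu_ Wu cu; apply/subr_cvg0; apply: cvg_sqr0.
apply: (@squeeze_cvgr _ _ _ _ (cst 0) (fun n => a v v * a (u_ n - u) (u_ n - u))).
- apply: nearW => n; rewrite sqr_ge0/= -(aBr aW)//.
  by apply: (cauchy_schwarz aW) => //; exact: WB.
- exact: cvg_cst.
- by rewrite -[X in _ --> X](mulr0 (a v v)); apply: cvgM => //; exact: cvg_cst.
Qed.

Lemma cvg_sq_semi_inner (u_ : nat -> V) u : (forall n, W (u_ n)) -> W u ->
  a (u_ n - u) (u_ n - u) @[n --> \oo] --> 0 ->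
  a (u_ n) (u_ n) @[n --> \oo] --> a u u.
Proof.
move=> Wu_ Wu cu; have c2 := cvg_semi_inner Wu Wu_ Wu cu.
have -> : (fun n => a (u_ n) (u_ n)) =
    (fun n => a (u_ n - u) (u_ n - u) + (a u (u_ n) + a u (u_ n) - a u u)).
  apply/funext => n; have Wn := Wu_ n.
  rewrite (aBl aW) ?(aBr aW)//; last exact: WB.
  by rewrite (semi_inner_sym aW Wn Wu); ring.
rewrite -[X in _ --> X]add0r; apply: cvgD => //.
rewrite -[X in _ --> X](addrK (a u u)); apply: cvgB; last exact: cvg_cst.
exact: cvgD.
Qed.

(** The space need not be complete, so Riesz's theorem yields only a Cauchy sequence that represents
    [f] in the limit. Its rate is the one that [sqint_complete] asks for. *)
Lemma riesz_seq (f : V -> R) (M : R) :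
  (forall c u v, W u -> W v -> f (c *: u + v) = c * f u + f v) ->
  (forall u, W u -> f u ^+ 2 <= M * a u u) ->
  exists w : nat -> V, [/\ forall n, W (w n),
    forall v, W v -> a (w n) v @[n --> \oo] --> f v &
    forall n m, (n <= m)%N -> a (w n - w m) (w n - w m) <= 4^-1 ^+ n].
Proof.
(* The extra factor 1/4 in [e n] pays for the factor 4 lost when the errors of [w n] and [w m] are
   added. *)
move=> flin fM; pose e n : R := 4^-1 ^+ n.+1.
have e0 n : 0 < e n by rewrite exprn_gt0.
pose P n w := W w /\ forall v, W v -> (a w v - f v) ^+ 2 <= e n * a v v.
have /choice[w hw] n : exists w, P n w.
  by have [w Ww hw] := approx_riesz aW flin fM (e0 n); exists w.
have Ww n : W (w n) := (hw n).1.
exists w; split => // [v Wv|n m nm].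
  apply/subr_cvg0; apply: cvg_sqr0.
  apply: (@squeeze_cvgr _ _ _ _ (cst 0) (fun n => 4^-1 ^+ n * a v v)).
  - apply: nearW => n; rewrite sqr_ge0/=; apply: le_trans ((hw n).2 v Wv) _.
    apply: ler_wpM2r; first exact: (semi_inner_ge0 aW).
    by rewrite /e exprS ler_piMl ?exprn_ge0// invf_le1// ler1n.
  - exact: cvg_cst.
  - rewrite -[X in _ --> X](mul0r (a v v)); apply: cvgM; last exact: cvg_cst.
    exact: cvg_geometric4.
have Wd := WB (Ww n) (Ww m).
have hn := (hw n).2 _ Wd; have hm := (hw m).2 _ Wd.
have emn : e m <= e n by rewrite /e ler_wiXn2l// invf_le1// ler1n.
have -> : 4^-1 ^+ n = 4 * e n by rewrite /e exprS mulVKf.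
have s0 := semi_inner_ge0 aW Wd.
have := aBl aW (Ww n) (Ww m) Wd.
move: s0 hn hm; move: (a (_ - _) _) (a (w n) _) (a (w m) _) (f _) (e n) (e m) (e0 n) emn.
move=> s p q g en em en0 emn s0 hn hm sE.
have h : s ^+ 2 <= 4 * en * s.
  have : em * s <= en * s by rewrite ler_wpM2r.
  have := sqr_ge0 ((p - g) + (q - g)); rewrite sE; nra.
have [->|sn0] := eqVneq s 0; first by rewrite mulr_ge0// ltW.
by rewrite -(@ler_pM2r _ s) ?lt_neqAle 1?eq_sym ?sn0// -expr2.
Qed.

End SemiInnerLimits.

(** * Test functions *)

Section SmoothFunctions.
Variable R : realType.
Implicit Types (f g : R -> R) (x y t : R).

(** Every derivative that is not obtained by the usual rules has a quadratic remainder: [expNV] at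
    0, and inner products of mollified functions. *)
Lemma is_derive_quad f t l C r : 0 < r ->
  (forall h, `|h| < r -> `|f (t + h) - f t - h * l| <= C * h ^+ 2) ->
  is_derive t 1 f l.
Proof.
move=> r0 fC; suff : h^-1 *: ((f \o shift t) (h *: 1) - f t) @[h --> 0^'] --> l.
  move=> cvl; apply: DeriveDef; first by apply/cvg_ex; exists l.
  exact: cvg_lim cvl.
have C0 : 0 <= C.
  have r2 : `|r / 2| < r by rewrite ger0_norm; lra.
  have := le_trans (normr_ge0 _) (fC _ r2).
  by rewrite pmulr_lge0// exprn_gt0// divr_gt0.
have C1 : 0 < C + 1 by lra.
apply/cvgrPdist_le => e e0; near=> h.
have h0 : h != 0 by near: h; exact: nbhs_dnbhs_neq.
have hr : `|h| < r by near: h; exact: dnbhs0_lt.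
have hC : `|h| <= e / (C + 1) by near: h; apply: dnbhs0_le; rewrite divr_gt0.
rewrite /= -[h *: 1]/(h * 1) mulr1 [h + t]addrC -[_ *: _]/(_ * _).
have -> : l - h^-1 * (f (t + h) - f t) = - (f (t + h) - f t - h * l) / h.
  by rewrite mulrC; field.
rewrite normrM normrN normfV ler_pdivrMr ?normr_gt0//.
apply: (le_trans (fC _ hr)); rewrite -(real_normK (num_real h)) expr2 mulrA.
apply: ler_wpM2r => //; rewrite ler_pdivlMr// in hC.
by apply: le_trans hC; rewrite mulrC ler_wpM2l// lerDl.
Unshelve. all: end_near. Qed.

Definition smooth f := forall (n : nat) (x : R), derivable (derive1n n f) x 1.

Lemma smooth_derivable f x : smooth f -> derivable f x 1.
Proof. by move=> sf; have := sf 0%N x; rewrite derive1n0. Qed.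

Lemma smooth_is_derive f x : smooth f -> is_derive x 1 f (derive1 f x).
Proof.
move=> sf; apply: DeriveDef; first exact: (@smooth_derivable f x sf).
by rewrite derive1E.
Qed.

Lemma smooth_derive1 f : smooth f -> smooth (derive1 f).
Proof. by move=> sf n x; rewrite -derive1Sn. Qed.

Lemma smooth_continuous f : smooth f -> continuous f.
Proof.
move=> sf x; apply/differentiable_continuous/derivable1_diffP.
exact: smooth_derivable.
Qed.

Lemma is_derive_derive1 f df : (forall x : R, is_derive x 1 f (df x)) -> derive1 f = df.
Proof. by move=> fdf; apply/funext => x; rewrite derive1E derive_val. Qed.

(** Smoothness by coinduction: exhibiting a class stable under differentiation replaces formulas for
    the n-th derivative of products, affine substitutions and [expNV]. *)
Lemma smooth_coind (C : (R -> R) -> Prop) f :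
  (forall g, C g -> exists2 dg, C dg & forall x : R, is_derive x 1 g (dg x)) ->
  C f -> smooth f.
Proof.
move=> CC Cf n; elim: n f Cf => [|n IH] f Cf x.
  by rewrite derive1n0; have [df _ /(_ x)[]] := CC f Cf.
rewrite derive1Sn; have [df Cdf /is_derive_derive1 ->] := CC f Cf.
exact: IH.
Qed.

Lemma smoothP c f g : smooth f -> smooth g -> smooth (c *: f + g).
Proof.
move=> sf sg; apply: (@smooth_coind (fun k => exists2 f, smooth f &
    exists2 g, smooth g & k = c *: f + g)); last by exists f => //; exists g.
move=> _ [{}f {}sf [{}g {}sg ->]].
exists (c *: derive1 f + derive1 g).
  exists (derive1 f); first exact: (smooth_derive1 sf).
  by exists (derive1 g); first exact: (smooth_derive1 sg).
move=> x; have := smooth_is_derive x sf; have := smooth_is_derive x sg => ? ?.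
exact: is_deriveD.
Qed.

Lemma derive1P c f g : smooth f -> smooth g ->
  derive1 (c *: f + g) = c *: derive1 f + derive1 g.
Proof.
move=> sf sg; apply: is_derive_derive1 => x.
have := smooth_is_derive x sf; have := smooth_is_derive x sg => ? ?.
exact: is_deriveD.
Qed.

(** The derivative of a product is a sum of two products; closing under sums makes the class stable
    under differentiation. *)
Inductive sum_of_products : (R -> R) -> Prop :=
| SumProd1 f g : smooth f -> smooth g -> sum_of_products (f * g)
| SumProdD h k : sum_of_products h -> sum_of_products k -> sum_of_products (h + k).

Lemma is_derive_mul f g x : smooth f -> smooth g ->
  is_derive x 1 (f * g) ((f * derive1 g + g * derive1 f) x).
Proof.
move=> /(smooth_is_derive x) ? /(smooth_is_derive x) ?.
exact: is_deriveM.
Qed.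

Lemma smoothM f g : smooth f -> smooth g -> smooth (f * g).
Proof.
move=> sf sg; apply: (@smooth_coind sum_of_products); last exact: SumProd1.
move=> k0; elim=> [{}f {}g {}sf {}sg|h k _ [dh Ch hdh] _ [dk Ck kdk]].
  exists (f * derive1 g + g * derive1 f).
    apply: SumProdD; first exact: (SumProd1 sf (smooth_derive1 sg)).
    exact: (SumProd1 sg (smooth_derive1 sf)).
  by move=> x; exact: is_derive_mul.
exists (dh + dk); first exact: SumProdD.
move=> x; have := hdh x; have := kdk x => ? ?; exact: is_deriveD.
Qed.

Lemma derive1_mul f g : smooth f -> smooth g ->
  derive1 (f * g) = f * derive1 g + g * derive1 f.
Proof. by move=> sf sg; apply: is_derive_derive1 => x; exact: is_derive_mul. Qed.

Lemma is_derive_affine f a b x : smooth f ->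
  is_derive x 1 (fun y => f (a * y + b)) (a * derive1 f (a * x + b)).
Proof.
move=> sf; have := smooth_is_derive (a * x + b) sf => ?.
have -> : (fun y => f (a * y + b)) = f \o (fun y => a * y + b) by [].
rewrite mulrC; apply: is_derive1_comp.
by apply: is_derive_eq; rewrite scaler1 addr0.
Qed.

Lemma derive1_affine f a b : smooth f ->
  derive1 (fun y => f (a * y + b)) = (fun y => a * derive1 f (a * y + b)).
Proof. by move=> sf; apply: is_derive_derive1 => x; exact: is_derive_affine. Qed.

Lemma smooth_affine f a b : smooth f -> smooth (fun y => f (a * y + b)).
Proof.
move=> sf; apply: (@smooth_coind (fun k => exists c, exists2 f, smooth f &
   k = fun y => c * f (a * y + b))); last first.
  by exists 1, f => //; apply/funext => y; rewrite mul1r.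
move=> _ [c [{}f {}sf ->]]; exists (fun y => c * a * derive1 f (a * y + b)).
  by exists (c * a), (derive1 f); first exact: (smooth_derive1 sf).
move=> x; have := is_derive_affine a b x sf => ?.
by rewrite -mulrA; exact: is_deriveZ.
Qed.

(** The standard flat function exp(-1/y) is the case [p = 1]. Its derivatives are polynomials in 1/y
    times itself, so with arbitrary [p] the family is stable under differentiation. *)
Definition expNV (p : {poly R}) (y : R) : R :=
  if 0 < y then p.[y^-1] * expR (- y^-1) else 0.

(** With [y = 1/h] and [k = 2] this bounds [expNV p h] by a multiple of [h^2], hence the derivative
    at 0 exists and is 0. *)
Lemma poly_exp_bounded (p : {poly R}) k :
  exists C, forall y, 0 < y -> `|p.[y]| * y ^+ k * expR (- y) <= C.
Proof.
have pow j (y : R) : 0 < y -> y ^+ j * expR (- y) <= j`!%:R.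
  move=> y0; rewrite expRN ler_pdivrMr ?expR_gt0//.
  case: j => [|j]; first by rewrite expr0 fact0 mul1r; have := expR_ge1Dx y; lra.
  have fj0 : 0 < (j.+1)`!%:R :> R by rewrite ltr0n fact_gt0.
  by rewrite mulrC -ler_pdivrMr//; have := expR_ge1Dxn j (ltW y0); lra.
elim/poly_ind: p k => [|p c IH] k.
  by exists 0 => y _; rewrite horner0 normr0 !mul0r.
have [C hC] := IH k.+1; exists (C + `|c| * k`!%:R) => y y0.
rewrite hornerMXaddC; apply: (@le_trans _ _ ((`|p.[y] * y| + `|c|) * y ^+ k * expR (- y))).
  apply: ler_wpM2r; first exact: expR_ge0.
  apply: ler_wpM2r; first by rewrite exprn_ge0// ltW.
  exact: ler_normD.
rewrite !mulrDl lerD//.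
  have := hC y y0; rewrite normrM (gtr0_norm y0) exprS.
  by move: (expR _) => E; rewrite -!mulrA.
by rewrite -mulrA ler_wpM2l// pow.
Qed.

Lemma is_derive_expNV p x :
  is_derive x 1 (expNV p) (expNV (('X ^+ 2) * (p - deriv p)) x).
Proof.
have [x0|x0|->] := ltgtP x 0.
- rewrite /expNV ltNge (ltW x0)/=.
  apply: (@near_eq_is_derive _ _ _ (cst 0)).
  by near=> y; rewrite ltNge ltW//; near: y; exact: lt_nbhsl.
- apply: (@near_eq_is_derive _ _ _ (fun y => p.[y^-1] * expR (- y^-1))).
    by near=> y; rewrite /expNV ifT//; near: y; exact: lt_nbhsr.
  rewrite /expNV x0.
  have dV : is_derive x 1 (fun y : R => y^-1) (- x ^- 2 *: 1).
    by apply: (@is_deriveV _ id); rewrite gt_eqF.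
  have dN : is_derive x 1 (fun y : R => - y^-1) (x ^- 2).
    by apply: is_derive_eq; rewrite scaleNr opprK scaler1.
  have dp : is_derive x 1 (fun y : R => p.[y^-1]) (p^`().[x^-1] * (- x ^- 2 *: 1)).
    exact: (@is_derive1_comp _ (horner p) (fun y : R => y^-1)).
  have dE : is_derive x 1 (fun y : R => expR (- y^-1)) (expR (- x^-1) * x ^- 2).
    exact: (@is_derive1_comp _ expR (fun y : R => - y^-1)).
  apply: is_derive_eq; rewrite !hornerE.
  rewrite -!exprVn -[RHS]mulr1 /GRing.scale/=; ring.
- have [C hC] := poly_exp_bounded p 2.
  apply: (@is_derive_quad _ _ _ C 1) => // h _.
  rewrite /expNV ltxx !(add0r, mulr0, subr0); case: ifPn => [h0|_]; last first.
    rewrite normr0 mulr_ge0 ?sqr_ge0//.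
    by apply: le_trans (hC 1 ltr01); rewrite !mulr_ge0 ?expR_ge0.
  have hV : 0 < h^-1 by rewrite invr_gt0.
  have := hC _ hV; rewrite normrM (gtr0_norm (expR_gt0 _)).
  rewrite -ler_pdivrMr ?exprn_gt0// exprVn.
  by move: (expR _) => E; rewrite mulrAC.
Unshelve. all: end_near. Qed.

Lemma smooth_expNV p : smooth (expNV p).
Proof.
apply: (@smooth_coind (fun f => exists p, f = expNV p)); last by exists p.
move=> _ [{}p ->]; exists (expNV (('X ^+ 2) * (p - deriv p))); first by eexists.
by move=> x; exact: is_derive_expNV.
Qed.

End SmoothFunctions.

Section TestFunctions.
Variables (R : realType) (I : set R).
Hypotheses (I_itv : is_interval I) (I_neq0 : I !=set0).
Implicit Types f g : R -> R.
Local Notation test := (test_function I).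

Lemma test_smooth f : test f -> smooth f. Proof. by case. Qed.

(** The interval in [test_function] may be empty. Then [f = 0], and a single point of [I] serves as
    the support. *)
Lemma test_support f : test f -> exists a b, [/\ a <= b, I a, I b &
  forall x : R, x \notin `[a, b]%R -> f x = 0].
Proof.
move=> [_ [a [b [abI f0]]]]; have [ab|ba] := leP a b.
  exists a, b; split => //; try by apply: abI; rewrite /= in_itv/= lexx ab.
  by move=> x xab; apply: f0 => /= xab'; exact: (negP xab).
have [c Ic] := I_neq0; exists c, c; split => // x _; apply: f0.
by rewrite /= in_itv/= => /andP[/le_trans h /h]; rewrite leNgt ba.
Qed.

Lemma testI f a b : I a -> I b -> smooth f ->
  (forall x : R, x \notin `[a, b]%R -> f x = 0) -> test f.
Proof.
move=> Ia Ib sf f0; split => //; exists a, b; split.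
  by move=> x /=; rewrite in_itv/= => xab; exact: (I_itv Ia Ib).
by move=> x xab; apply: f0; apply/negP.
Qed.

Lemma test0 : test (0 : R -> R).
Proof.
have [c Ic] := I_neq0; apply: (@testI _ c c) => //.
apply: (@smooth_coind _ (fun f => f = 0)) => // _ ->; exists 0 => // x.
exact: is_derive_cst.
Qed.

Lemma testP c f g : test f -> test g -> test (c *: f + g).
Proof.
move=> tf tg; have [a [b [ab Ia Ib f0]]] := test_support tf.
have [a' [b' [ab' Ia' Ib' g0]]] := test_support tg.
apply: (@testI _ (Num.min a a') (Num.max b b')).
- by rewrite /Num.min; case: ifP.
- by rewrite /Num.max; case: ifP.
- exact: (@smoothP _ c _ _ (test_smooth tf) (test_smooth tg)).
- move=> x; rewrite in_itv/= negb_and -!ltNge lt_min gt_max => xab.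
  rewrite -[(c *: f + g) x]/(c * f x + g x) f0 ?g0 ?mulr0 ?addr0//.
    by rewrite in_itv/= negb_and -!ltNge; case/orP: xab => /andP[h h']; rewrite ?h ?h' ?orbT.
  by rewrite in_itv/= negb_and -!ltNge; case/orP: xab => /andP[h h']; rewrite ?h ?h' ?orbT.
Qed.

Lemma testZ c f : test f -> test (c *: f).
Proof. by move=> tf; rewrite -[_ *: _]addr0; apply: testP => //; exact: test0. Qed.

Lemma test_derive1 f : test f -> test (derive1 f).
Proof.
move=> tf; have [a [b [ab Ia Ib f0]]] := test_support tf.
apply: (@testI _ a b Ia Ib); first exact: (smooth_derive1 (test_smooth tf)).
move=> x xab; rewrite derive1E.
have -> : 'D_1 f x = 'D_1 (cst 0) x.
  apply: near_eq_derive; move: xab; rewrite in_itv/= negb_and -!ltNge.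
  move=> /orP[xa|bx]; near=> y; apply: f0; rewrite in_itv/= negb_and -!ltNge;
    apply/orP; [left|right]; near: y; [exact: lt_nbhsl|exact: lt_nbhsr].
exact: derive_cst.
Unshelve. all: end_near. Qed.

Lemma test_mul f g : test f -> smooth g -> test (f * g).
Proof.
move=> tf sg; have [a [b [ab Ia Ib f0]]] := test_support tf.
apply: (@testI _ a b Ia Ib); first exact: (smoothM (test_smooth tf) sg).
by move=> x xab; rewrite -[(f * g) x]/(f x * g x) f0 ?mul0r.
Qed.

Lemma test_continuous f : test f -> continuous f.
Proof. by move=> /test_smooth; exact: smooth_continuous. Qed.

Lemma test_bounded f : test f -> exists2 M, 0 <= M & forall x, `|f x| <= M.
Proof.
move=> tf; have [a [b [ab Ia Ib f0]]] := test_support tf.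
have cf : {within `[a, b], continuous (fun x => `|f x|)}.
  apply: continuous_subspaceT => x; apply: continuous_comp.
    exact: test_continuous.
  exact: norm_continuous.
have [c _ hc] := EVT_max ab cf.
exists `|f c| => // x; have [xab|xab] := boolP (x \in `[a, b]%R); first exact: hc.
by rewrite f0// normr0.
Qed.

End TestFunctions.

(** * Integration by parts and the Poincaré inequality for test functions *)

Section L2Interval.
Variables (R : realType) (L : R).
Hypothesis L0 : 0 < L.
Local Notation mu := (@lebesgue_measure R).
Local Notation I := `]0, L[%classic.
Local Notation test := (test_function I).
Local Notation inner := (inner L).
Local Notation L2 := (L2 L).
Implicit Types u v w g chi : R -> R.

Lemma measurable_I : measurable (I : set (measurableTypeR R)).
Proof. exact: measurable_itv. Qed.
Local Notation mI := measurable_I.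

Lemma inner_integrable u v : L2 u -> L2 v ->
  mu.-integrable I (EFin \o (fun x => u x * v x)).
Proof. exact: (sqint_mul (mu := mu) mI). Qed.

Lemma L2_semi_inner : semi_inner L2 inner.
Proof. by apply: (@sqint_semi_inner _ _ _ mu); exact: measurable_itv. Qed.

Lemma I_itv : is_interval I. Proof. exact: interval_is_interval. Qed.

Lemma I_neq0 : I !=set0.
Proof.
have h : 0 < L / 2 /\ L / 2 < L by move: L0 => L0'; split; lra.
by exists (L / 2); rewrite /= in_itv/= h.1 h.2.
Qed.

Lemma continuous_integrable_cc (f : R -> R) : continuous f ->
  mu.-integrable `[0, L] (EFin \o f).
Proof.
move=> cf; apply: continuous_compact_integrable; first exact: segment_compact.
exact: continuous_subspaceT.
Qed.

Lemma continuous_integrable (f : R -> R) : continuous f ->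
  mu.-integrable I (EFin \o f).
Proof.
move=> cf; apply: (integrableS _ _ _ (continuous_integrable_cc cf));
    [exact: measurable_itv|exact: measurable_itv|].
exact: subset_itv_oo_cc.
Qed.

Lemma continuous_L2 (f : R -> R) : continuous f -> L2 f.
Proof.
move=> cf; split.
  by apply: measurable_funTS; exact: continuous_measurable_fun.
apply: (@continuous_integrable (fun x => f x * f x)) => x.
by apply: cvgM; exact: cf.
Qed.

Lemma test_L2 chi : test chi -> L2 chi.
Proof. by move=> /test_continuous; exact: continuous_L2. Qed.

Lemma int_derive_test chi : test chi -> \int[mu]_(x in I) derive1 chi x = 0.
Proof.
move=> tc; have [a [b [ab Ia Ib chi0]]] := test_support I_neq0 tc.
have c0 : chi 0 = 0.
  by apply: chi0; move: Ia; rewrite /= !in_itv/= negb_and -!ltNge => /andP[-> _].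
have cL : chi L = 0.
  apply: chi0; move: Ib; rewrite /= !in_itv/= negb_and -!ltNge => /andP[_ ->].
  by rewrite orbT.
have cc := test_continuous tc.
have cc' := test_continuous (test_derive1 I_itv I_neq0 tc).
rewrite Rintegral_itv_obnd_cbnd ?Rintegral_itv_bndo_bndc.
- rewrite /Rintegral (@continuous_FTC2 _ _ chi)//.
  + by rewrite -EFinB c0 cL subrr.
  + exact: continuous_subspaceT.
  + split; [move=> x _; exact: (@smooth_derivable _ chi x (test_smooth tc))
      |apply: cvg_at_right_filter; exact: cc|apply: cvg_at_left_filter; exact: cc].
- apply: (integrableS _ _ _ (continuous_integrable_cc cc')).
  + exact: measurable_itv.
  + exact: measurable_itv.
  + exact: subset_itv_co_cc.
- exact: continuous_integrable.
Qed.

Lemma inner_derive1 chi w : test chi -> test w ->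
  inner (derive1 chi) w = - inner chi (derive1 w).
Proof.
move=> tc tw; apply/eqP; rewrite -addr_eq0; apply/eqP.
have tc' := test_derive1 I_itv I_neq0 tc.
have tw' := test_derive1 I_itv I_neq0 tw.
have tcw := test_mul I_itv I_neq0 tc (test_smooth tw).
rewrite -(int_derive_test tcw) (derive1_mul (test_smooth tc) (test_smooth tw)).
rewrite -(RintegralD mI (inner_integrable (test_L2 tc') (test_L2 tw))
  (inner_integrable (test_L2 tc) (test_L2 tw'))).
apply: eq_Rintegral => x _.
by rewrite -[RHS]/(chi x * derive1 w x + w x * derive1 chi x) addrC [w x * _]mulrC.
Qed.

(* Integrate [(x chi^2)' = chi^2 + 2 x chi chi']. *)
Lemma poincare_test chi : test chi ->
  sqnormL2 L chi <= 4 * L ^+ 2 * sqnormL2 L (derive1 chi).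
Proof.
move=> tc; have tc' := test_derive1 I_itv I_neq0 tc.
have sid : smooth (id : R -> R).
  apply: (@smooth_coind _ (fun f => exists c, f = id \/ f = cst c)); last by exists 0; left.
  move=> _ [c [->|->]].
    by exists (cst 1) => [|x]; [exists 1; right|exact: is_derive_id].
  by exists (cst 0) => [|x]; [exists 0; right|exact: is_derive_cst].
have did : derive1 (id : R -> R) = cst 1 by apply/funext => x; rewrite derive1_id.
have sc := test_smooth tc.
have txc := test_mul I_itv I_neq0 tc sid.
have txcc := test_mul I_itv I_neq0 tc (test_smooth txc).
have txc' : test (derive1 chi * id) by exact: (test_mul I_itv I_neq0 tc' sid).
have eqs : sqnormL2 L chi = - 2 * inner chi (derive1 chi * id).
  apply/eqP; rewrite -subr_eq0 mulNr opprK; apply/eqP.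
  rewrite -(int_derive_test txcc) (derive1_mul sc (test_smooth txc)) (derive1_mul sc sid) did.
  have i1 := inner_integrable (test_L2 tc) (test_L2 tc).
  have i2 := inner_integrable (test_L2 tc) (test_L2 txc').
  rewrite -(RintegralZl 2 mI i2) -(RintegralD mI i1 (integrableZl mI 2 i2)).
  apply: eq_Rintegral => x _.
  rewrite -[RHS]/(chi x * (chi x * 1 + x * derive1 chi x) + chi x * x * derive1 chi x).
  rewrite -[(derive1 chi * id) x]/(derive1 chi x * x); ring.
have xle : sqnormL2 L (derive1 chi * id) <= L ^+ 2 * sqnormL2 L (derive1 chi).
  have i1 := inner_integrable (test_L2 tc') (test_L2 tc').
  have i2 := inner_integrable (test_L2 txc') (test_L2 txc').
  rewrite -(RintegralZl (L ^+ 2) mI i1).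
  apply: (le_Rintegral mI i2 (integrableZl mI (L ^+ 2) i1)).
  move=> x; rewrite /= in_itv/= => /andP[x0 xL].
  rewrite -[(derive1 chi * id) x]/(derive1 chi x * x).
  have : x ^+ 2 <= L ^+ 2 by rewrite ler_sqr ?nnegrE ltW// ltW.
  rewrite -subr_ge0 => /(mulr_ge0 (sqr_ge0 (derive1 chi x))).
  move: (derive1 chi x) => y; lra.
have := cauchy_schwarz L2_semi_inner (test_L2 tc) (test_L2 txc').
rewrite -/(sqnormL2 L chi) -/(sqnormL2 L _).
have s0 := semi_inner_ge0 L2_semi_inner (test_L2 tc).
have s'0 := semi_inner_ge0 L2_semi_inner (test_L2 tc').
rewrite -/(sqnormL2 L _) in s0; rewrite -/(sqnormL2 L _) in s'0.
move: eqs xle s0 s'0.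
move: (sqnormL2 L chi) (sqnormL2 L (derive1 chi)) (inner _ _) (sqnormL2 L (derive1 chi * id)).
move=> s s' p q sE qs s0 s'0 pq.
have [->|sn0] := eqVneq s 0; first by rewrite mulr_ge0// mulr_ge0// sqr_ge0.
have sgt0 : 0 < s by rewrite lt_neqAle eq_sym sn0.
rewrite -(ler_pM2l sgt0); have : s * q <= s * (L ^+ 2 * s') by rewrite ler_wpM2l.
have : s * s = 4 * p ^+ 2 by rewrite sE; ring.
lra.
Qed.

End L2Interval.

(** * Smooth cut-offs, and L2 functions orthogonal to all test functions *)

Section Density.
Variables (R : realType) (L : R).
Hypothesis L0 : 0 < L.
Local Notation mu := (@lebesgue_measure R).
Local Notation I := `]0, L[%classic.
Local Notation test := (test_function I).
Local Notation inner := (inner L).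
Local Notation L2 := (L2 L).
Implicit Types u v w g chi : R -> R.

Local Notation e := (@expNV R 1).

Lemma exp_step_eq0 (y : R) : y <= 0 -> e y = 0.
Proof. by move=> y0; rewrite /expNV ltNge y0. Qed.

Lemma exp_step_ge0 (y : R) : 0 <= e y.
Proof. by rewrite /expNV; case: ifP => // _; rewrite hornerE mul1r expR_ge0. Qed.

Lemma exp_step_le1 (y : R) : e y <= 1.
Proof.
rewrite /expNV; case: ifP => // y0; rewrite hornerE mul1r -expR0 ler_expR.
by rewrite oppr_le0 invr_ge0 ltW.
Qed.

Lemma exp_step_gt0 (y : R) : 0 < y -> 0 < e y.
Proof. by rewrite /expNV => ->; rewrite hornerE mul1r expR_gt0. Qed.

Lemma exp_step_ge (d y : R) : 0 < d -> d^-1 <= y -> 1 - d <= e y.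
Proof.
move=> d0 dy; have y0 : 0 < y by apply: lt_le_trans dy; rewrite invr_gt0.
rewrite /expNV y0 hornerE mul1r; apply: le_trans (expR_ge1Dx _).
by rewrite lerD2l lerN2 -[leRHS]invrK lef_pV2// posrE ?invr_gt0.
Qed.

(** The factors are exp(-1/y) at [y = c (x - a)] and [y = c (b - x)], extended by 0. The product
    lives on [[a, b]] and, since exp(-1/y) is at least [1 - 1/y], tends to the indicator of []a, b[]
    as [c] grows. *)
Definition bump (c a b x : R) := e (c * x + - (c * a)) * e (- c * x + c * b).

Lemma smooth_bump c a b : smooth (bump c a b).
Proof.
exact: (smoothM (@smooth_affine _ e c _ (@smooth_expNV R 1))
  (@smooth_affine _ e (- c) _ (@smooth_expNV R 1))).
Qed.

Lemma bump_out c a b x : 0 <= c -> ~ `[a, b] x -> bump c a b x = 0.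
Proof.
move=> c0 /negP; rewrite /= in_itv/= negb_and -!ltNge /bump => /orP[xa|bx].
  rewrite exp_step_eq0 ?mul0r// -mulrN -mulrDr mulr_ge0_le0//; lra.
rewrite (@exp_step_eq0 (_ + c * b)) ?mulr0// mulNr -mulrN -mulrDr mulr_ge0_le0//; lra.
Qed.

Lemma bump_ge0 c a b x : 0 <= bump c a b x.
Proof. by rewrite mulr_ge0 ?exp_step_ge0. Qed.

Lemma bump_le1 c a b x : bump c a b x <= 1.
Proof.
by rewrite -[leRHS]mulr1; apply: ler_pM; rewrite ?exp_step_ge0 ?exp_step_le1.
Qed.

Lemma test_bump (J : set R) c a b : 0 <= c -> `[a, b] `<=` J ->
  test_function J (bump c a b).
Proof.
move=> c0 abJ; split; first exact: smooth_bump.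
by exists a, b; split => // x; exact: bump_out.
Qed.

(** The left end [1/(n+1)] stays positive, so the supports are compact in []0, L[] when [b < L].
    Slope times left end is 1, so the first factor is the step at [(n+1) x - 1]. *)
Lemma bump_cvg b x : 0 < x -> x != b ->
  bump n.+1%:R n.+1%:R^-1 b x @[n --> \oo] --> (\1_`]0, b[ x : R).
Proof.
move=> x0 xb; rewrite indicE; have [xb'|bx] := boolP (x < b); last first.
  rewrite memNset/=; last by rewrite in_itv/= x0 (negPf bx).
  rewrite (_ : (fun n => _) = cst 0); first exact: cvg_cst.
  apply/funext => n /=; apply: bump_out => //=.
  rewrite in_itv/= => /andP[_]; rewrite le_eqVlt (negPf xb) (negPf bx)//.
rewrite mem_set/=; last by rewrite in_itv/= x0 xb'.
apply/cvgrPdist_le => d d0; near=> n.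
rewrite ger0_norm ?subr_ge0 ?bump_le1// /bump.
set p := e _; set q := e _.
have hp : 1 - d / 2 <= p.
  apply: exp_step_ge; first by rewrite divr_gt0.
  rewrite divff// lerBrDr -ler_pdivrMr//.
  by apply: (@le_trans _ _ n%:R); [near: n; exact: nbhs_infty_ger|rewrite ler_nat].
have hq : 1 - d / 2 <= q.
  apply: exp_step_ge; first by rewrite divr_gt0.
  rewrite mulNr -mulrN -mulrDr -ler_pdivrMr; last by lra.
  by apply: (@le_trans _ _ n%:R); [near: n; exact: nbhs_infty_ger|rewrite ler_nat].
have p1 : p <= 1 := exp_step_le1 _; have q1 : q <= 1 := exp_step_le1 _.
have : 0 <= (1 - p) * (1 - q) by rewrite mulr_ge0// subr_ge0.
lra.
Unshelve. all: end_near. Qed.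

(** Dominated convergence along the bumps, which tend to the indicator of []0, b[] off the null set
    [{b}], with dominating function [|v|]. *)
Lemma orth_test_int v (b : R) : L2 v -> (forall chi, test chi -> inner v chi = 0) ->
  0 < b -> b < L -> \int[mu]_(x in `]0, b[) v x = 0.
Proof.
move=> Lv v0 b0 bL.
have L1 : L2 (cst 1) by apply: continuous_L2 => // x; exact: cvg_cst.
have iv : mu.-integrable I (EFin \o v).
  have := inner_integrable Lv L1.
  by rewrite (_ : (fun x => _) = v)//; apply/funext => x; rewrite mulr1.
have mv := measurable_int mu iv.
pose chi n := bump n.+1%:R n.+1%:R^-1 b.
have tchi n : test (chi n).
  apply: test_bump => // x; rewrite /= !in_itv/= => /andP[x1 x2].
  by rewrite (lt_le_trans _ x1) ?invr_gt0// (le_lt_trans x2).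
have h1 n : measurable_fun I (fun x => (v x * chi n x)%:E).
  by apply/measurable_EFinP/measurable_funM; [exact: Lv.1|exact: (test_L2 (tchi n)).1].
have h2 : measurable_fun I (fun x => (v x * \1_`]0, b[ x)%:E).
  apply/measurable_EFinP/measurable_funM; first exact: Lv.1.
  by apply: measurable_indic; exact: measurable_itv.
have h3 : {ae mu, forall x, I x ->
    (v x * chi n x)%:E @[n --> \oo] --> (v x * \1_`]0, b[ x)%:E}.
  exists [set b]; split; [exact: measurable_set1|exact: lebesgue_measure_set1|].
  move=> x /= /not_implyP[Ix hx]; apply: contrapT => xb; apply: hx.
  apply: cvg_EFin; first by apply: nearW.
  apply: cvgM; first exact: cvg_cst.
  apply: bump_cvg; last exact/eqP.
  by move: Ix; rewrite /= in_itv/= => /andP[].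
have h5 : {ae mu, forall x, forall n, I x -> (`|(v x * chi n x)%:E| <= `|v x|%:E)%E}.
  apply: aeW => x n _; rewrite lee_fin normrM (ger0_norm (bump_ge0 _ _ _ _)).
  by rewrite ler_piMr ?bump_le1.
have [_ _] := dominated_convergence (measurable_I L) h1 h2 h3 (integrable_abse iv) h5.
have -> : (fun n => (\int[mu]_(x in I) (v x * chi n x)%:E)%E) = cst 0%E.
  apply/funext => n; have := v0 _ (tchi n); rewrite /inner/Rintegral => h.
  have := integrable_fin_num (measurable_I L) (inner_integrable Lv (test_L2 (tchi n))).
  by move=> /fineK <-; rewrite h.
move=> /(cvg_unique _ (cvg_cst _)) => /(_ (@ereal_hausdorff _)) hE.
suff h : (\int[mu]_(x in `]0%R, b[) (v x)%:E)%E = 0%E by rewrite /Rintegral h.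
rewrite [RHS]hE [LHS]integral_mkcond [RHS]integral_mkcond.
apply: eq_integral => x _; rewrite !patchE.
case: ifPn => xb.
  rewrite mem_set; last first.
    move: xb; rewrite inE /= !in_itv/= => /andP[-> /lt_trans]; exact.
  by rewrite indicE xb mulr1.
case: ifP => // _.
by rewrite indicE (negPf xb) mulr0.
Qed.

(** The primitive of [v] vanishes on []0, L[] by [orth_test_int], so Lebesgue differentiation gives
    [v = 0] almost everywhere. *)
Lemma orth_test_ae0 v : L2 v -> (forall chi, test chi -> inner v chi = 0) ->
  sqnormL2 L v = 0.
Proof.
move=> Lv v0.
have L1 : L2 (cst 1) by apply: continuous_L2 => // x; exact: cvg_cst.
have iv : mu.-integrable I (EFin \o v).
  have := inner_integrable Lv L1.
  by rewrite (_ : (fun x => _) = v)//; apply/funext => x; rewrite mulr1.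
pose f : R -> R := v \_ I.
have lf : locally_integrable [set: R] f.
  exact: (integrable_locally_restrict (measurable_I L) iv).
have if_ : mu.-integrable setT (EFin \o f).
  by have := (@integrable_mkcond _ _ _ mu I (EFin \o v) (measurable_I L)).1 iv;
    rewrite restrict_EFin.
have ify y : mu.-integrable [set` Interval (BRight 0) (BRight y)] (EFin \o f).
  by apply: (integrableS _ _ _ if_) => //; exact: measurable_itv.
have F0 x : 0 < x -> x < L ->
    \int[mu]_(t in [set` Interval (BRight 0) (BRight x)]) f t = 0.
  move=> x0 xL; rewrite -Rintegral_itv_bndo_bndc; last first.
    by apply: (integrableS _ _ _ if_) => //; exact: measurable_itv.
  rewrite -[RHS](orth_test_int Lv v0 x0 xL); apply: eq_Rintegral => t.
  rewrite inE /= in_itv/= => /andP[t0 tx]; rewrite /f patchE mem_set//=.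
  by rewrite in_itv/= t0 (lt_trans tx).
have v_ae : {ae mu, forall x, I x -> v x = 0}.
  apply: (@filterS _ _ (ae_filter_ringOfSetsType mu) _ _ _ (FTC1 ify lf)) => x hx Ix.
  have [x0 xL] : 0 < x /\ x < L by move: Ix; rewrite /= in_itv/= => /andP[].
  have h0 : (BRight 0 < BRight x)%O by rewrite bnd_simp.
  have [_] := hx h0.
  rewrite {2}/f patchE mem_set// => <-; rewrite derive1E.
  rewrite -[RHS](@derive_cst _ _ R 0 x 1); apply: near_eq_derive.
  near=> y; apply: F0; near: y; [exact: lt_nbhsr|exact: lt_nbhsl].
rewrite /sqnormL2/inner/Rintegral (_ : (\int[mu]_(x in _) _ = 0)%E)//.
rewrite -(@integral0 _ _ _ mu I); apply: ae_eq_integral.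
- exact: measurable_I.
- exact: (measurable_int mu (inner_integrable Lv Lv)).
- exact: measurable_cst.
- by apply: (@filterS _ _ (ae_filter_ringOfSetsType mu) _ _ _ v_ae) => x h /h ->; rewrite mulr0.
Unshelve. all: end_near. Qed.

End Density.

(** * The closure of the test functions in H^1 *)

Section GraphClosure.
Variables (R : realType) (L : R).
Hypothesis L0 : 0 < L.
Local Notation mu := (@lebesgue_measure R).
Local Notation I := `]0, L[%classic.
Local Notation test := (test_function I).
Local Notation inner := (inner L).
Local Notation sq := (sqnormL2 L).
Local Notation L2 := (L2 L).
Local Notation siL := (L2_semi_inner L).
Implicit Types u v w g chi : R -> R.

Let testD1 := test_derive1 (@I_itv R L) (I_neq0 L0).

(** No mollification in [x]: Riesz on the test functions gives a Cauchy sequence that represents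
    pairing with [u]. Its L2 limit differs from [u] by a function orthogonal to all test functions,
    hence null. *)
Lemma test_dense u : L2 u -> exists chi : nat -> R -> R,
  (forall n, test (chi n)) /\ sq (chi n - u) @[n --> \oo] --> 0.
Proof.
move=> Lu.
have si : semi_inner test inner.
  split; [exact: (test0 (@I_itv R L) (I_neq0 L0))|exact: (testP (@I_itv R L) (I_neq0 L0))| | |].
  - by move=> f g /test_L2 Lf /test_L2 Lg; exact: (semi_inner_sym siL).
  - by move=> c f g w /test_L2 Lf /test_L2 Lg /test_L2 Lw; exact: (semi_inner_lin siL).
  - by move=> f /test_L2 Lf; exact: (semi_inner_ge0 siL).
have [] := @riesz_seq _ _ _ _ si (inner u) (sq u).
- by move=> c f g /test_L2 Lf /test_L2 Lg; rewrite (aDr siL) ?(aZr siL)//; exact: (siZ siL).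
- by move=> f /test_L2 Lf; exact: (cauchy_schwarz siL).
move=> w [tw cw dw]; exists w; split => //.
have Lw n := test_L2 (tw n).
have [g Lg hg] := sqint_complete (mu := mu) (measurable_I L) Lw dw.
have cg : sq (w n - g) @[n --> \oo] --> 0.
  apply: (@squeeze_cvgr _ _ _ _ (cst 0) (fun n => 4^-1 ^+ n)).
  - apply: nearW => n; apply/andP; split; last exact: hg.
    exact: (semi_inner_ge0 siL (siB siL (Lw n) Lg)).
  - exact: cvg_cst.
  - exact: cvg_geometric4.
have gu0 : sq (g - u) = 0.
  apply: (orth_test_ae0 (siB siL Lg Lu)) => chi tchi; have Lchi := test_L2 tchi.
  rewrite (aBl siL)//; apply/eqP; rewrite subr_eq0; apply/eqP.
  have := cvg_semi_inner siL Lchi Lw Lg cg.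
  rewrite (semi_inner_sym siL Lchi Lg).
  under eq_fun do rewrite (semi_inner_sym siL Lchi (Lw _)).
  by move=> /cvg_unique/(_ (cw chi tchi)) h; apply: h; exact: norm_hausdorff.
apply: (@squeeze_cvgr _ _ _ _ (cst 0) (fun n => 2 * (sq (w n - g) + 0))).
- apply: nearW => n; apply/andP; split.
    exact: (semi_inner_ge0 siL (siB siL (Lw n) Lu)).
  have := sq_le_sqD siL (siB siL (Lw n) Lg) (siB siL Lg Lu).
  by rewrite addrA subrK -/(sq _) -/(sq (g - u)) gu0.
- exact: cvg_cst.
- have h : 2 * (0 + 0) = 0 :> R by ring.
  rewrite -[X in _ --> X]h.
  exact: (cvgM (cvg_cst (2 : R)) (cvgD cg (cvg_cst (0 : R)))).
Qed.

(** The L2 norm by duality: along test functions tending to [u] the hypothesis becomes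
    [(sq u)^2 <= M * sq u]. This is how bounds on pairings return to norms. *)
Lemma sqnorm_le_test u M : 0 <= M -> L2 u ->
  (forall chi, test chi -> inner u chi ^+ 2 <= M * sq chi) -> sq u <= M.
Proof.
move=> M0 Lu hM; have [chi [tchi cchi]] := test_dense Lu.
have Lchi n := test_L2 (tchi n).
have c1 := cvg_semi_inner siL Lu Lchi Lu cchi.
have c2 := cvg_sq_semi_inner siL Lchi Lu cchi.
have u0 : 0 <= sq u := semi_inner_ge0 siL Lu.
have h : sq u ^+ 2 <= M * sq u.
  apply: (ler_cvg_to (cvgM c1 c1) (cvgM (cvg_cst M) c2)).
  by apply: nearW => n; exact: hM.
have [->//|un0] := eqVneq (sq u) 0.
by rewrite -(@ler_pM2r _ (sq u)) ?lt_neqAle 1?eq_sym ?un0// -expr2.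
Qed.

(** The closure in L2 x L2 of the graph of d/dx on test functions, that is, H^1_0 with the
    derivative carried along. Unlike the chosen [dx], the second component is exactly linear. *)
Definition H0pair u g := [/\ L2 u, L2 g & exists chi : nat -> R -> R,
  [/\ forall n, test (chi n), sq (chi n - u) @[n --> \oo] --> 0 &
     sq (derive1 (chi n) - g) @[n --> \oo] --> 0]].

Lemma test_H0pair chi : test chi -> H0pair chi (derive1 chi).
Proof.
move=> tc; split; [exact: test_L2|exact: test_L2 (testD1 tc)|].
have sq00 : sq 0 = 0 by exact: (a0l siL (semi_inner0 siL)).
exists (fun=> chi); split => //; rewrite subrr sq00; exact: cvg_cst.
Qed.

Lemma H0pairP c u g v k : H0pair u g -> H0pair v k ->
  H0pair (c *: u + v) (c *: g + k).
Proof.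
move=> [Lu Lg [chi [tchi cu cg]]] [Lv Lk [w [tw cv ck]]].
split; [exact: (semi_innerP siL)|exact: (semi_innerP siL)|].
have key (p q : nat -> R -> R) x y : (forall n, L2 (p n)) -> (forall n, L2 (q n)) ->
    L2 x -> L2 y -> sq (p n - x) @[n --> \oo] --> 0 -> sq (q n - y) @[n --> \oo] --> 0 ->
    sq (c *: p n + q n - (c *: x + y)) @[n --> \oo] --> 0.
  move=> Lp Lq Lx Ly cp cq.
  apply: (@squeeze_cvgr _ _ _ _ (cst 0)
    (fun n => 2 * (c ^+ 2 * sq (p n - x) + sq (q n - y)))).
  - apply: nearW => n; have Lpx := siB siL (Lp n) Lx; have Lqy := siB siL (Lq n) Ly.
    rewrite scale_subr.
    apply/andP; split; first exact: (semi_inner_ge0 siL (semi_innerP siL c Lpx Lqy)).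
    have := sq_le_sqD siL (siZ siL c Lpx) Lqy.
    by rewrite (aZl siL) ?(aZr siL) ?mulrA -?expr2//; exact: (siZ siL).
  - exact: cvg_cst.
  - have h : 2 * (c ^+ 2 * 0 + 0) = 0 :> R by ring.
    rewrite -[X in _ --> X]h.
    exact: (cvgM (cvg_cst (2 : R)) (cvgD (cvgM (cvg_cst (c ^+ 2)) cp) cq)).
exists (fun n => c *: chi n + w n); split.
- move=> n; exact: (testP (@I_itv R L) (I_neq0 L0) c (tchi n) (tw n)).
- by apply: key => // n; exact: test_L2.
- have -> : (fun n => sq (derive1 (c *: chi n + w n) - (c *: g + k))) =
    (fun n => sq (c *: derive1 (chi n) + derive1 (w n) - (c *: g + k))).
    apply/funext => n; congr (sq (_ - _)).
    exact: (derive1P c (test_smooth (tchi n)) (test_smooth (tw n))).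
  by apply: key => // n; exact: test_L2 (testD1 _).
Qed.

(** Both sides are continuous for graph convergence, so estimates and weak equations pass from test
    functions to elements of H^1_0. *)
Lemma H0pair_bound x y C : L2 x -> L2 y ->
  (forall chi, test chi ->
    (inner x chi + inner y (derive1 chi)) ^+ 2 <= C * (sq chi + sq (derive1 chi))) ->
  forall u g, H0pair u g -> (inner x u + inner y g) ^+ 2 <= C * (sq u + sq g).
Proof.
move=> Lx Ly hC u g [Lu Lg [chi [tchi cu cg]]].
have Lchi n := test_L2 (tchi n); have Lchi' n := test_L2 (testD1 (tchi n)).
have c1 := cvgD (cvg_semi_inner siL Lx Lchi Lu cu) (cvg_semi_inner siL Ly Lchi' Lg cg).
have c2 := cvgD (cvg_sq_semi_inner siL Lchi Lu cu) (cvg_sq_semi_inner siL Lchi' Lg cg).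
pose p n := inner x (chi n) + inner y (derive1 (chi n)).
have c3 : p n @[n --> \oo] --> inner x u + inner y g by exact: c1.
have d1 : p n * p n @[n --> \oo] --> (inner x u + inner y g) ^+ 2.
  by rewrite expr2; exact: (cvgM c3 c3).
pose q n := sq (chi n) + sq (derive1 (chi n)).
have c4 : q n @[n --> \oo] --> sq u + sq g by exact: c2.
have d2 : C * q n @[n --> \oo] --> C * (sq u + sq g).
  by apply: cvgM c4; exact: cvg_cst.
by apply: (ler_cvg_to d1 d2); apply: nearW => n; exact: hC.
Qed.

Lemma H0pair_eq x y : L2 x -> L2 y ->
  (forall chi, test chi -> inner x chi + inner y (derive1 chi) = 0) ->
  forall u g, H0pair u g -> inner x u + inner y g = 0.
Proof.
move=> Lx Ly h0 u g hug; apply/eqP; rewrite -sqrf_eq0 eq_le sqr_ge0 andbT.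
rewrite -(mul0r (sq u + sq g)); apply: H0pair_bound => // chi /h0 ->.
by rewrite mul0r expr0n.
Qed.

(** Integration by parts in H^1_0, by closing up in one argument at a time. *)
Lemma H0pair_skew u g v k : H0pair u g -> H0pair v k -> inner u k = - inner g v.
Proof.
move=> hu hv; have [Lu Lg _] := hu; have [Lv Lk _] := hv.
apply/eqP; rewrite -addr_eq0 addrC; apply/eqP; apply: (H0pair_eq Lg Lu _ hv).
move=> w tw; have Lw := test_L2 tw; have Lw' := test_L2 (testD1 tw).
rewrite (semi_inner_sym siL Lg Lw) (semi_inner_sym siL Lu Lw') addrC.
apply: (H0pair_eq Lw' Lw _ hu) => chi tchi.
by rewrite (inner_derive1 L0 tw tchi) addNr.
Qed.

Lemma H0pair_poincare u g : H0pair u g -> sq u <= 4 * L ^+ 2 * sq g.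
Proof.
move=> [Lu Lg [chi [tchi cu cg]]].
have Lchi n := test_L2 (tchi n); have Lchi' n := test_L2 (testD1 (tchi n)).
have c1 := cvg_sq_semi_inner siL Lchi Lu cu.
have c2 : 4 * L ^+ 2 * sq (derive1 (chi n)) @[n --> \oo] --> 4 * L ^+ 2 * sq g.
  by apply: cvgM (cvg_sq_semi_inner siL Lchi' Lg cg); exact: cvg_cst.
apply: (ler_cvg_to c1 c2); apply: nearW => n; exact: poincare_test.
Qed.

Lemma H10_H0pair u : H10 L u -> H0pair u (dx L u).
Proof.
move=> [[g0 hg0] happ].
have [Lu Ldu _] : is_wderiv L u (dx L u) by rewrite /dx; apply: xgetPex; exists g0.
split => //.
have /choice[chi hchi] n : exists chi, test chi /\
    sq (u - chi) + sq (dx L u - derive1 chi) < 4^-1 ^+ n.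
  by apply: happ; rewrite exprn_gt0.
have tchi n := (hchi n).1; have Lchi n := test_L2 (tchi n).
have Lchi' n := test_L2 (testD1 (tchi n)).
have symB f g : L2 f -> L2 g -> sq (f - g) = sq (g - f).
  move=> Lf Lg; have Lgf := siB siL Lg Lf; rewrite -opprB -scaleN1r /sqnormL2.
  by rewrite (aZl siL) ?(aZr siL)//; [ring|exact: (siZ siL)].
have ge0 f g : L2 f -> L2 g -> 0 <= sq (f - g).
  by move=> Lf Lg; exact: (semi_inner_ge0 siL (siB siL Lf Lg)).
exists chi; split => //;
  (apply: (@squeeze_cvgr _ _ _ _ (cst 0) (fun n => 4^-1 ^+ n));
    [apply: nearW => n|exact: cvg_cst|exact: cvg_geometric4]).
- rewrite (ge0 _ _ (Lchi n) Lu)/= (symB _ _ (Lchi n) Lu).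
  apply: ltW; apply: le_lt_trans (hchi n).2.
  by rewrite lerDl ge0.
- rewrite (ge0 _ _ (Lchi' n) Ldu)/= (symB _ _ (Lchi' n) Ldu).
  apply: ltW; apply: le_lt_trans (hchi n).2.
  by rewrite lerDr ge0.
Qed.

End GraphClosure.

(** * Mollification in time *)

(** The integral of a nonnegative function is a supremum over simple functions below it, so it is
    monotone without measurability. This is needed for [t |-> sqnormH1 L (u t)], whose measurability
    is not assumed. *)
Lemma ge0_le_lower_integral (disp : measure_display) (T : measurableType disp)
    (R : realType) (mu : {measure set T -> \bar R}) (D : set T) (f g : T -> \bar R) :
  (forall x, D x -> 0 <= f x)%E -> (forall x, D x -> f x <= g x)%E ->
  (\int[mu]_(x in D) f x <= \int[mu]_(x in D) g x)%E.
Proof.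
move=> f0 fg; rewrite !ge0_integralE//; last first.
  by move=> x Dx; apply: le_trans (fg x Dx); exact: f0.
apply: le_ereal_sup => _ [h hf <-]; exists h => // x.
apply: le_trans (hf x) _; rewrite !patchE; case: ifPn => //.
by rewrite inE; exact: fg.
Qed.

Section TimeIntegrals.
Variables (R : realType).
Local Notation mu := (@lebesgue_measure R).
Local Notation J := (`]0, +oo[%classic : set R).
Local Notation kernel := (test_function J).
Implicit Types (f k : R -> R).

Definition continuous_J f := forall t : R, 0 < t -> f s @[s --> t] --> f t.

Lemma J_itv : is_interval J. Proof. exact: interval_is_interval. Qed.

Lemma J_neq0 : J !=set0.
Proof. by exists 1; rewrite /= in_itv/= ltr01. Qed.

Lemma measurable_J : measurable (J : set (measurableTypeR R)).
Proof. exact: measurable_itv. Qed.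

Lemma continuous_J_measurable f : continuous_J f -> measurable_fun J f.
Proof.
move=> cf; apply: open_continuous_measurable_fun; first exact: interval_open.
by move=> t; rewrite inE /= in_itv/= andbT; exact: cf.
Qed.

Lemma subset_cc_J (a b : R) : 0 < a -> `[a, b] `<=` J.
Proof.
by move=> a0 t; rewrite /= !in_itv/= andbT => /andP[/(lt_le_trans a0)].
Qed.

Lemma continuous_J_within f (a b : R) : 0 < a -> continuous_J f ->
  {within `[a, b], continuous f}.
Proof.
move=> a0 cf; apply: continuous_in_subspaceT => t; rewrite inE /= in_itv/=.
by move=> /andP[/(lt_le_trans a0) t0 _]; exact: cf.
Qed.

Lemma continuous_J_mul f k : continuous_J f -> continuous_J k ->
  continuous_J (fun t => f t * k t).
Proof. by move=> cf ck t t0; apply: cvgM; [exact: cf|exact: ck]. Qed.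

Lemma patch_supp f (a b : R) : 0 < a ->
  (forall t, t \notin `[a, b]%R -> f t = 0) -> f \_ J = f \_ `[a, b].
Proof.
move=> a0 f0; apply/funext => t; rewrite !patchE.
have [tab|tab] := boolP (t \in `[a, b]%R); last by rewrite f0//; do 2 case: ifP.
have tab' : t \in (`[a, b] : set R) by rewrite inE.
have tJ : t \in J by rewrite inE; apply: (subset_cc_J a0 (b := b)).
by rewrite tab' tJ.
Qed.

Lemma Rintegral_supp f (a b : R) : 0 < a ->
  (forall t, t \notin `[a, b]%R -> f t = 0) ->
  \int[mu]_(t in J) f t = \int[mu]_(t in `[a, b]) f t.
Proof.
move=> a0 f0; rewrite Rintegral_mkcond [RHS]Rintegral_mkcond.
by rewrite (patch_supp a0 f0).
Qed.

Lemma integrable_supp f (a b : R) : 0 < a ->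
  (forall t, t \notin `[a, b]%R -> f t = 0) ->
  mu.-integrable `[a, b] (EFin \o f) -> mu.-integrable J (EFin \o f).
Proof.
move=> a0 f0 /(@integrable_mkcond _ _ _ mu _ _ (measurable_itv _)).1 h.
apply/(@integrable_mkcond _ _ _ mu _ _ measurable_J).2.
rewrite restrict_EFin (patch_supp a0 f0).
by rewrite restrict_EFin in h.
Qed.

Lemma kernel_support k : kernel k -> exists a b, [/\ 0 < a, a < b &
  forall t, t \notin `[a, b]%R -> k t = 0].
Proof.
(* [b + 1] makes the interval nondegenerate, as [zero_boundary] requires. *)
move=> /(test_support J_neq0)[a [b [ab Ia Ib k0]]]; exists a, (b + 1); split.
- by move: Ia; rewrite /= in_itv/= andbT.
- by rewrite ltr_pwDr.
- move=> t; rewrite in_itv/= negb_and -!ltNge => h; apply: k0.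
  rewrite in_itv/= negb_and -!ltNge; case/orP: h => [->//|h].
  by rewrite (lt_trans _ h) ?orbT// ltrDl.
Qed.

Lemma kernel_continuous_J k : kernel k -> continuous_J k.
Proof. by move=> kk t _; exact: (test_continuous kk). Qed.

Lemma integrable_kernel f k : continuous_J f -> kernel k ->
  mu.-integrable J (EFin \o (fun t => f t * k t)).
Proof.
move=> cf kk; have [a [b [a0 ab k0]]] := kernel_support kk.
apply: (integrable_supp a0) => [t /k0 ->|]; first by rewrite mulr0.
apply: continuous_compact_integrable; first exact: segment_compact.
exact: (@continuous_J_within _ a b a0 (continuous_J_mul cf (kernel_continuous_J kk))).
Qed.

Lemma sqint_cc f (a b : R) : 0 < a -> continuous_J f -> sqint mu `[a, b] f.
Proof.
move=> a0 cf; split.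
  apply: measurable_funS (continuous_J_measurable cf); first exact: measurable_J.
  exact: subset_cc_J.
apply: (@continuous_compact_integrable _ (fun t => f t * f t)).
  exact: segment_compact.
exact: (@continuous_J_within _ a b a0 (continuous_J_mul cf cf)).
Qed.

Lemma sq_kernel_int f k (a b C m : R) : 0 < a -> a <= b -> continuous_J f ->
  kernel k -> (forall t, t \notin `[a, b]%R -> k t = 0) ->
  (forall t, `|k t| <= m) -> \int[mu]_(t in `[a, b]) (f t * f t) <= C ->
  (\int[mu]_(t in J) (f t * k t)) ^+ 2 <= C * ((b - a) * m ^+ 2).
Proof.
move=> a0 ab cf kk k0 km fC.
have mab : measurable (`[a, b] : set (measurableTypeR R)) by exact: measurable_itv.
have sf := sqint_cc b a0 cf; have sk := sqint_cc b a0 (kernel_continuous_J kk).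
have si := sqint_semi_inner mu mab.
rewrite (@Rintegral_supp _ a b a0) => [|t /k0 ->]; last by rewrite mulr0.
apply: le_trans (cauchy_schwarz si sf sk) _.
have m0 : 0 <= m := le_trans (normr_ge0 _) (km 0).
apply: ler_pM => //; [exact: (semi_inner_ge0 si)|exact: (semi_inner_ge0 si)|].
have icst : mu.-integrable `[a, b] (EFin \o cst (m ^+ 2)).
  by apply: continuous_compact_integrable; [exact: segment_compact|exact: cst_continuous].
apply: le_trans (le_Rintegral mab (sqint_mul mab sk sk) icst _) _.
  by move=> t _; rewrite -expr2 -(real_normK (num_real (k t))) ler_sqr// nnegrE.
rewrite (Rintegral_cst mu mab (m ^+ 2)) [X in fine X](lebesgue_measure_itv `[a, b]%R)/= lte_fin.
case: ltgtP ab => // [ab _|-> _]; first by rewrite -EFinB mulrC.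
by rewrite subrr !mulr0 mul0r.
Qed.

End TimeIntegrals.

Section Mollification.
Variables (R : realType) (L : R).
Hypothesis L0 : 0 < L.
Local Notation mu := (@lebesgue_measure R).
Local Notation I := `]0, L[%classic.
Local Notation J := (`]0, +oo[%classic : set R).
Local Notation test := (test_function I).
Local Notation kernel := (test_function J).
Local Notation inner := (inner L).
Local Notation sq := (sqnormL2 L).
Local Notation L2 := (L2 L).
Local Notation siL := (L2_semi_inner L).
Local Notation H0pair := (H0pair L).
Local Notation testD1 := (test_derive1 (@I_itv R L) (I_neq0 L0)).
Implicit Types (v w g chi k : R -> R) (u : R -> R -> R).

Lemma sq_ge0 v : 0 <= sq v.
Proof. by apply: Rintegral_ge0 => x _; exact: sqr_ge0. Qed.

Lemma graph_cauchy_schwarz v v' w w' : L2 v -> L2 v' -> L2 w -> L2 w' ->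
  (inner v w + inner v' w') ^+ 2 <= (sq v + sq v') * (sq w + sq w').
Proof.
move=> Lv Lv' Lw Lw'.
have := cauchy_schwarz siL Lv Lw; have := cauchy_schwarz siL Lv' Lw'.
have := sq_ge0 v; have := sq_ge0 v'; have := sq_ge0 w; have := sq_ge0 w'.
rewrite -!/(sq _).
move: (inner v w) (inner v' w') (sq v) (sq v') (sq w) (sq w') => p q A B a b.
move=> b0 a0 B0 A0 hq hp.
have h : (2 * (p * q)) ^+ 2 <= (A * b + B * a) ^+ 2.
  have : p ^+ 2 * q ^+ 2 <= (A * a) * (B * b) by apply: ler_pM; rewrite ?sqr_ge0.
  have := sqr_ge0 (A * b - B * a); lra.
have h2 : 2 * (p * q) <= A * b + B * a.
  have : 0 <= A * b + B * a by rewrite addr_ge0// mulr_ge0.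
  by move: (2 * (p * q)) (A * b + B * a) h => x y h y0; rewrite leNgt; apply/negP; nra.
lra.
Qed.

Section OneFunction.
Variable u : R -> R -> R.
Hypothesis cu : continuousL2 L u.

Lemma pairing_continuous v : L2 v -> continuous_J (fun t => inner (u t) v).
Proof.
move=> Lv t t0; apply/cvgrPdist_le => e e0.
have := cu.2 t (ltW t0) => /cvgrPdist_lt.
have d0 : 0 < e ^+ 2 / (sq v + 1).
  by rewrite divr_gt0 ?exprn_gt0// ltr_wpDl// sq_ge0.
move=> /(_ _ d0); rewrite /prop_near1/= /within/=.
have pos : \forall s \near t, 0 < s by exact: lt_nbhsr.
move=> h; near=> s.
have s0 : 0 < s by near: s.
have hs : sq (u s - u t) < e ^+ 2 / (sq v + 1).
  have : 0 <= s -> `|0 - sq (u s - u t)| < e ^+ 2 / (sq v + 1) by near: s.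
  by rewrite sub0r normrN ger0_norm ?sq_ge0//; apply; exact: ltW.
have Ls := cu.1 s (ltW s0); have Lt := cu.1 t (ltW t0).
rewrite distrC -(aBl siL)// -ler_sqr ?nnegrE ?(ltW e0)// real_normK ?num_real//.
apply: le_trans (cauchy_schwarz siL (siB siL Ls Lt) Lv) _.
rewrite -!/(sq _); move: hs; rewrite ltr_pdivlMr ?ltr_wpDl ?sq_ge0//.
have := sq_ge0 v; have := sq_ge0 (u s - u t).
move: (sq v) (sq _) => p q; nra.
Unshelve. all: end_near. Qed.

(** The pairing with [v] of the time average of [u] with weight [k]; the average itself is not
    defined as an integral. *)
Definition time_pairing k v := \int[mu]_(t in J) (inner (u t) v * k t).

Lemma integrable_pairing k v : kernel k -> L2 v ->
  mu.-integrable J (EFin \o (fun t => inner (u t) v * k t)).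
Proof.
by move=> kk Lv; exact: (integrable_kernel (pairing_continuous Lv) kk).
Qed.

Lemma time_pairing_lin k c v w : kernel k -> L2 v -> L2 w ->
  time_pairing k (c *: v + w) = c * time_pairing k v + time_pairing k w.
Proof.
move=> kk Lv Lw; have i1 := integrable_pairing kk Lv; have i2 := integrable_pairing kk Lw.
have mJ := @measurable_J R.
rewrite /time_pairing -(RintegralZl c mJ i1) -(RintegralD mJ (integrableZl mJ c i1) i2).
apply: eq_Rintegral => t; rewrite inE/= in_itv/= andbT => /ltW t0.
have Lt := cu.1 t t0.
rewrite (aDr siL) ?(aZr siL)//; last exact: (siZ siL).
by ring.
Qed.

Lemma time_pairingB k v w : kernel k -> L2 v -> L2 w ->
  time_pairing k (v - w) = time_pairing k v - time_pairing k w.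
Proof.
move=> kk Lv Lw; rewrite addrC -scaleN1r time_pairing_lin//.
by rewrite mulN1r addrC.
Qed.

Lemma time_pairing_klin k k' c v : kernel k -> kernel k' -> L2 v ->
  time_pairing (c *: k + k') v = c * time_pairing k v + time_pairing k' v.
Proof.
move=> kk kk' Lv; have i1 := integrable_pairing kk Lv; have i2 := integrable_pairing kk' Lv.
have mJ := @measurable_J R.
rewrite /time_pairing -(RintegralZl c mJ i1) -(RintegralD mJ (integrableZl mJ c i1) i2).
apply: eq_Rintegral => t _.
by rewrite -[(c *: k + k') t]/(c * k t + k' t); ring.
Qed.

Hypothesis zu : zero_boundary L u.

(** The H^1_0 bound, integrated in time, against a [w] whose squared norm as a functional on H^1_0
    is at most [G]. The constant depends on [u] and the time interval, not on [w]. *)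
Lemma pairing_sq_bound (a b : R) : 0 < a -> a < b -> exists2 C, 0 <= C &
  forall w G, L2 w -> 0 <= G ->
  (forall t, 0 <= t -> H10 L (u t) -> inner (u t) w ^+ 2 <= sqnormH1 L (u t) * G) ->
  \int[mu]_(t in `[a, b]) (inner (u t) w * inner (u t) w) <= C * G.
Proof.
move=> a0 ab; have [[N [mN N0 hN]] fin] := zu a0 ab.
have n0 t : 0 <= sqnormH1 L (u t) by rewrite addr_ge0// sq_ge0.
pose IN := (\int[mu]_(t in `[a, b]) (sqnormH1 L (u t))%:E)%E.
have IN0 : (0 <= IN)%E by apply: integral_ge0 => t _; rewrite lee_fin.
exists (fine IN); first exact: fine_ge0.
move=> w G Lw G0 hw; apply/ler_addgt0Pr => e e0.
(* [G] is not pulled out of the integral of the possibly nonmeasurable [sqnormH1]; the measurable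
   side is divided instead, and [d] keeps the divisor [G + d] positive when [G = 0]. *)
pose d := e / (fine IN + 1).
have fI1 : 0 < fine IN + 1 by rewrite ltr_wpDl// fine_ge0.
have d0 : 0 < d by rewrite divr_gt0.
suff : \int[mu]_(t in `[a, b]) (inner (u t) w * inner (u t) w) <= fine IN * (G + d).
  move/le_trans; apply; rewrite mulrDr lerD2l /d mulrA ler_pdivrMr//.
  by rewrite [leRHS]mulrDr mulr1 mulrC lerDl ltW.
have Gd : 0 < G + d by rewrite ltr_wpDl.
pose f t := inner (u t) w.
have mab : measurable (`[a, b] : set (measurableTypeR R)) by exact: measurable_itv.
have sf : sqint mu `[a, b] f := sqint_cc b a0 (pairing_continuous Lw).
have iff := sqint_mul mab sf sf.
rewrite -ler_pdivrMr// mulrC -(RintegralZl (G + d)^-1 mab iff).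
have iffG := integrableZl mab (G + d)^-1 iff.
rewrite -lee_fin /Rintegral (fineK (integrable_fin_num mab iffG)) fineK ?ge0_fin_numE//.
(* Cutting out the null set [N] makes the comparison hold at every point of [[a, b]], as the
   monotonicity of the lower integral demands. *)
pose f1 t := ((G + d)^-1 * (f t * f t) * \1_(~` N) t)%:E.
have mNC : measurable (~` N : set (measurableTypeR R)) by exact: measurableC.
have -> : (\int[mu]_(t in `[a, b]) ((G + d)^-1 * (f t * f t))%:E =
    \int[mu]_(t in `[a, b]) f1 t)%E.
  apply: ae_eq_integral => //.
  - exact: (measurable_int mu iffG).
  - apply/measurable_EFinP/measurable_funM.
      by apply/measurable_EFinP; exact: (measurable_int mu iffG).
    exact: measurable_indic.
  - exists N; split => // t /= ht; apply: contrapT => Nt; apply: ht => _.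
    by rewrite /f1 indicE mem_set// mulr1.
apply: ge0_le_lower_integral => t tab.
  rewrite lee_fin mulr_ge0 ?indicE// mulr_ge0// ?invr_ge0 ?(ltW Gd)// -expr2.
  exact: sqr_ge0.
rewrite lee_fin indicE; have [Nt|Nt] := boolP (t \in ~` N); last by rewrite mulr0.
have t0 : 0 <= t.
  by move: tab; rewrite /= in_itv/= => /andP[h _]; exact: le_trans (ltW a0) h.
have Ht : H10 L (u t).
  apply: contrapT => h; move: Nt; rewrite inE; apply; apply: hN => /= h'.
  exact/h/h'.
rewrite mulr1 mulrC ler_pdivrMr// -expr2; apply: le_trans (hw t t0 Ht) _.
by rewrite ler_wpM2l// lerDl ltW.
Qed.

End OneFunction.
End Mollification.

(** * Existence and bounds of the mollification in H^1_0 *)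

Section MollificationInSpace.
Variables (R : realType) (L : R).
Hypothesis L0 : 0 < L.
Local Notation mu := (@lebesgue_measure R).
Local Notation I := `]0, L[%classic.
Local Notation J := (`]0, +oo[%classic : set R).
Local Notation test := (test_function I).
Local Notation kernel := (test_function J).
Local Notation inner := (inner L).
Local Notation sq := (sqnormL2 L).
Local Notation L2 := (L2 L).
Local Notation siL := (L2_semi_inner L).
Local Notation H0pair := (H0pair L).
Let testD1 := test_derive1 (@I_itv R L) (I_neq0 L0).
Implicit Types (v w g chi k : R -> R) (u : R -> R -> R).

Definition graph_inner v w := inner v w + inner (derive1 v) (derive1 w).

Lemma graph_semi_inner : semi_inner test graph_inner.
Proof.
have P1 c f g : test f -> test g -> derive1 (c *: f + g) = c *: derive1 f + derive1 g.
  by move=> tf tg; exact: (derive1P c (test_smooth tf) (test_smooth tg)).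
split.
- exact: (test0 (@I_itv R L) (I_neq0 L0)).
- exact: (testP (@I_itv R L) (I_neq0 L0)).
- move=> f g tf tg; rewrite /graph_inner.
  rewrite (semi_inner_sym siL (test_L2 tf) (test_L2 tg)).
  by rewrite (semi_inner_sym siL (test_L2 (testD1 tf)) (test_L2 (testD1 tg))).
- move=> c f g w tf tg tw; rewrite /graph_inner P1//.
  have tf' := testD1 tf; have tg' := testD1 tg; have tw' := testD1 tw.
  rewrite (semi_inner_lin siL c (test_L2 tf) (test_L2 tg) (test_L2 tw)).
  rewrite (semi_inner_lin siL c (test_L2 tf') (test_L2 tg') (test_L2 tw')).
  by rewrite mulrDr addrACA.
- by move=> f _; apply: addr_ge0; exact: sq_ge0.
Qed.

Lemma derive1_testB v w : test v -> test w -> derive1 (v - w) = derive1 v - derive1 w.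
Proof.
move=> tv tw; rewrite addrC -scaleN1r (derive1P (-1) (test_smooth tw) (test_smooth tv)).
by rewrite scaleN1r addrC.
Qed.

Variable u : R -> R -> R.
Hypotheses (cu : continuousL2 L u) (zu : zero_boundary L u).
Local Notation P := (time_pairing L u).

(** [v] is a representative of the time average of [u] with weight [k], and [g] is its derivative in
    [x]. *)
Definition mollified k v g := H0pair v g /\
  forall chi, test chi -> inner v chi = P k chi.

Let D2 chi := derive1 (derive1 chi).
Let tD2 chi : test chi -> test (D2 chi). Proof. by move=> /testD1/testD1. Qed.
Let L2D2 chi : test chi -> L2 (chi - D2 chi).
Proof. by move=> tc; exact: (siB siL (test_L2 tc) (test_L2 (tD2 tc))). Qed.

Lemma graph_pairing v g chi : H0pair v g -> test chi ->
  inner v (chi - D2 chi) = inner v chi + inner g (derive1 chi).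
Proof.
move=> hv tc; have [Lv Lg _] := hv.
rewrite (aBr siL (test_L2 tc) (test_L2 (tD2 tc)) Lv).
by rewrite (H0pair_skew L0 hv (test_H0pair L0 (testD1 tc))) opprK.
Qed.

Lemma mollified_graph k v g chi : kernel k -> mollified k v g -> test chi ->
  inner v chi + inner g (derive1 chi) = P k (chi - D2 chi).
Proof.
move=> kk [hv vP] tc; rewrite -(graph_pairing hv tc); have [Lv Lg _] := hv.
rewrite (aBr siL (test_L2 tc) (test_L2 (tD2 tc)) Lv) !vP//; last exact: tD2.
by rewrite (time_pairingB cu kk (test_L2 tc) (test_L2 (tD2 tc))).
Qed.

(** Cauchy-Schwarz in time on top of [pairing_sq_bound]. The constant depends on the kernel only
    through its support interval; the size [m] enters explicitly. *)
Lemma pairing_bound (a b : R) : 0 < a -> a < b -> exists2 C, 0 <= C &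
  forall k m w G, kernel k -> (forall t, t \notin `[a, b]%R -> k t = 0) ->
  (forall t, `|k t| <= m) -> L2 w -> 0 <= G ->
  (forall v g, H0pair v g -> inner v w ^+ 2 <= (sq v + sq g) * G) ->
  P k w ^+ 2 <= C * m ^+ 2 * G.
Proof.
move=> a0 ab; have [C C0 hC] := pairing_sq_bound cu zu a0 ab.
exists (C * (b - a)); first by rewrite mulr_ge0// subr_ge0 ltW.
move=> k m w G kk k0 km Lw G0 hw.
have := hC w G Lw G0 (fun t _ Ht => hw _ _ (H10_H0pair L0 Ht)).
move=> /(sq_kernel_int a0 (ltW ab) (pairing_continuous cu Lw) kk k0 km).
move/le_trans; apply; rewrite le_eqVlt; apply/orP; left; apply/eqP; ring.
Qed.

Lemma graph_pairing_le v g chi : H0pair v g -> test chi ->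
  inner v (chi - D2 chi) ^+ 2 <= (sq v + sq g) * (sq chi + sq (derive1 chi)).
Proof.
move=> hv tc; have [Lv Lg _] := hv; rewrite (graph_pairing hv tc).
exact: (graph_cauchy_schwarz Lv Lg (test_L2 tc) (test_L2 (testD1 tc))).
Qed.

Lemma le_of_sq_le (s C : R) : 0 <= s -> 0 <= C -> s ^+ 2 <= C * s -> s <= C.
Proof.
move=> s0 C0 h; have [->//|sn0] := eqVneq s 0.
by rewrite -(@ler_pM2r _ s) ?lt_neqAle 1?eq_sym ?sn0// -expr2.
Qed.

(** The H^1 norm of the mollification is controlled by the supremum of the kernel. Applied to Taylor
    remainders of kernels, this gives differentiability in time. *)
Lemma mollified_bound (a b : R) : 0 < a -> a < b -> exists2 C, 0 <= C &
  forall k m v g, kernel k -> (forall t, t \notin `[a, b]%R -> k t = 0) ->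
  (forall t, `|k t| <= m) -> mollified k v g -> sq v + sq g <= C * m ^+ 2.
Proof.
move=> a0 ab; have [C C0 hC] := pairing_bound a0 ab; exists C => //.
move=> k m v g kk k0 km mv; have [hv _] := mv; have [Lv Lg _] := hv.
have Cm0 : 0 <= C * m ^+ 2 by rewrite mulr_ge0 ?sqr_ge0.
apply: le_of_sq_le => //; first by rewrite addr_ge0 ?sq_ge0.
apply: (H0pair_bound L0 Lv Lg) => // chi tc.
rewrite (mollified_graph kk mv tc); apply: (hC k) => //; first exact: L2D2.
  by rewrite addr_ge0 ?sq_ge0.
by move=> v' g' h'; exact: graph_pairing_le.
Qed.

Lemma mollifiedP k k' c v g v' g' : kernel k -> kernel k' ->
  mollified k v g -> mollified k' v' g' ->
  mollified (c *: k + k') (c *: v + v') (c *: g + g').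
Proof.
move=> kk kk' [hv vP] [hv' vP']; have [Lv _ _] := hv; have [Lv' _ _] := hv'.
split; first exact: H0pairP.
move=> chi tc; have Lc := test_L2 tc.
by rewrite (semi_inner_lin siL c Lv Lv' Lc) vP// vP'// (time_pairing_klin cu).
Qed.

(** Riesz in H^1_0: the mollification must have H^1 product [P k (chi - chi'')] with [chi], and this
    functional is bounded in the H^1 norm. The Cauchy sequence and its derivatives are completed
    separately in L2. *)
Lemma mollified_graph_exists k : kernel k -> exists v g, H0pair v g /\
  forall chi, test chi -> inner v chi + inner g (derive1 chi) = P k (chi - D2 chi).
Proof.
move=> kk; have [a [b [a0 ab k0]]] := kernel_support kk.
have [m m0 km] := test_bounded (@J_neq0 R) kk.
have [C C0 hC] := pairing_bound a0 ab.
have [] := @riesz_seq _ _ _ _ graph_semi_inner (fun chi => P k (chi - D2 chi)) (C * m ^+ 2).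
- move=> c f g tf tg.
  have -> : c *: f + g - D2 (c *: f + g) = c *: (f - D2 f) + (g - D2 g).
    rewrite /D2 (derive1P c (test_smooth tf) (test_smooth tg)).
    rewrite (derive1P c (test_smooth (testD1 tf)) (test_smooth (testD1 tg))).
    exact: scale_subr.
  exact: (time_pairing_lin cu c kk (L2D2 tf) (L2D2 tg)).
- move=> f tf; apply: (hC k m) => //; first exact: L2D2.
    by rewrite addr_ge0 ?sq_ge0.
  by move=> v g hv; exact: graph_pairing_le.
move=> w [tw cw dw].
have Lw n := test_L2 (tw n); have Lw' n := test_L2 (testD1 (tw n)).
have dw1 n m' : (n <= m')%N -> sq (w n - w m') <= 4^-1 ^+ n.
  by move=> /dw; apply: le_trans; rewrite lerDl; exact: sq_ge0.
have dw2 n m' : (n <= m')%N -> sq (derive1 (w n) - derive1 (w m')) <= 4^-1 ^+ n.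
  move=> /dw; apply: le_trans; rewrite /graph_inner derive1_testB// lerDr.
  exact: sq_ge0.
have [v Lv hv] := sqint_complete (mu := mu) (measurable_I L) Lw dw1.
have [g Lg hg] := sqint_complete (mu := mu) (measurable_I L) Lw' dw2.
have c0 (q : nat -> R -> R) x : (forall n, sq (q n - x) <= 4^-1 ^+ n) ->
    sq (q n - x) @[n --> \oo] --> 0.
  move=> h; apply: (@squeeze_cvgr _ _ _ _ (cst 0) (fun n => 4^-1 ^+ n)).
  - by apply: nearW => n; apply/andP; split; [exact: sq_ge0|exact: h].
  - exact: cvg_cst.
  - exact: cvg_geometric4.
have cv := c0 _ _ hv; have cg := c0 _ _ hg.
exists v, g; split; first by split => //; exists w.
move=> chi tc; have Lc := test_L2 tc; have Lc' := test_L2 (testD1 tc).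
have h1 := cvg_semi_inner siL Lc Lw Lv cv.
have h2 := cvg_semi_inner siL Lc' Lw' Lg cg.
have h3 : graph_inner (w n) chi @[n --> \oo] --> inner v chi + inner g (derive1 chi).
  rewrite (semi_inner_sym siL Lv Lc) (semi_inner_sym siL Lg Lc').
  have -> : (fun n => graph_inner (w n) chi) =
    (fun n => inner chi (w n) + inner (derive1 chi) (derive1 (w n))).
    apply/funext => n; rewrite /graph_inner (semi_inner_sym siL Lc (Lw n)).
    by rewrite (semi_inner_sym siL Lc' (Lw' n)).
  exact: cvgD.
by apply: (cvg_unique _ h3 (cw chi tc)); exact: norm_hausdorff.
Qed.

(* The graph representative is tested against resolvents [w - w'' = chi]. *)
Lemma mollified_exists k : kernel k -> exists v g, mollified k v g.
Proof.
move=> kk; have [v [g [hv vE]]] := mollified_graph_exists kk.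
have [Lv Lg _] := hv; exists v, g; split => // chi tc; have Lc := test_L2 tc.
have [a [b [a0 ab k0]]] := kernel_support kk.
have [m m0 km] := test_bounded (@J_neq0 R) kk.
have [C C0 hC] := pairing_bound a0 ab.
pose S := 2 * (sq v + sq g) + 2 * (C * m ^+ 2).
have S0 : 0 <= S.
  by rewrite addr_ge0// mulr_ge0// ?addr_ge0 ?sq_ge0// mulr_ge0 ?sqr_ge0.
suff h e : 0 < e -> (inner v chi - P k chi) ^+ 2 <= S * e.
  apply/eqP; rewrite -subr_eq0 -sqrf_eq0 eq_le sqr_ge0 andbT.
  apply/ler_addgt0Pl => e e0; rewrite addr0.
  have S1 : 0 < S + 1 by rewrite ltr_wpDl.
  apply: le_trans (h (e / (S + 1)) _) _; first by rewrite divr_gt0.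
  by rewrite mulrA ler_pdivrMr// mulrC ler_pM2l// lerDl.
move=> e0.
have lin c f f' : test f -> test f' -> inner chi (c *: f + f') = c * inner chi f + inner chi f'.
  move=> /test_L2 Lf /test_L2 Lf'.
  by rewrite (aDr siL) ?(aZr siL)//; exact: (siZ siL).
have bnd f : test f -> inner chi f ^+ 2 <= sq chi * graph_inner f f.
  move=> tf; apply: le_trans (cauchy_schwarz siL Lc (test_L2 tf)) _.
  by apply: ler_wpM2l; rewrite ?sq_ge0// lerDl; exact: sq_ge0.
(* [w] nearly solves [w - w'' = chi]: the squared norm of the residual as a functional on H^1_0 is
   at most [e]. Pairing with [v] and [P k] agree on [w - w''] and are both bounded in this dual
   norm, so on [chi] their squared difference is at most [S * e]. *)
have [w tw hw] := approx_riesz graph_semi_inner lin bnd e0.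
have tw' := testD1 tw; have Lw := test_L2 tw; have Lw' := test_L2 tw'.
have Lwc := siB siL Lw Lc.
have hwg f g' : H0pair f g' ->
    (inner (w - chi) f + inner (derive1 w) g') ^+ 2 <= e * (sq f + sq g').
  apply: (H0pair_bound L0 Lwc Lw') => f0 tf0; have Lf0 := test_L2 tf0.
  have := hw f0 tf0; rewrite (aBl siL Lw Lc Lf0) /graph_inner addrAC.
  exact.
have h1 := hwg _ _ hv.
have Lz : L2 (w - D2 w - chi) by exact: (siB siL (L2D2 tw) Lc).
have h2 : P k (w - D2 w - chi) ^+ 2 <= C * m ^+ 2 * e.
  apply: (hC k m) => //; first exact: ltW.
  move=> f g' hf; have [Lf Lg' _] := hf.
  have -> : inner f (w - D2 w - chi) = inner (w - chi) f + inner (derive1 w) g'.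
    rewrite (aBr siL (L2D2 tw) Lc Lf) (graph_pairing hf tw) (aBl siL Lw Lc Lf).
    rewrite (semi_inner_sym siL Lf Lw) (semi_inner_sym siL Lg' Lw').
    by rewrite (semi_inner_sym siL Lf Lc) addrAC.
  by rewrite mulrC hwg.
have -> : inner v chi - P k chi =
    - (inner (w - chi) v + inner (derive1 w) g) + P k (w - D2 w - chi).
  rewrite (time_pairingB cu kk (L2D2 tw) Lc) -vE// (aBl siL Lw Lc Lv).
  rewrite (semi_inner_sym siL Lw Lv) (semi_inner_sym siL Lw' Lg).
  by rewrite (semi_inner_sym siL Lc Lv); ring.
rewrite /S; move: h1 h2; move: (_ + _ : R) (P k _) => p q h1 h2.
have := sqr_ge0 (p + q); nra.
Qed.

End MollificationInSpace.

(** * Differentiation of the mollification in time *)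

Section TimeDerivative.
Variables (R : realType) (L : R).
Hypothesis L0 : 0 < L.
Local Notation J := (`]0, +oo[%classic : set R).
Local Notation kernel := (test_function J).
Local Notation inner := (inner L).
Local Notation sq := (sqnormL2 L).
Local Notation L2 := (L2 L).
Local Notation siL := (L2_semi_inner L).
Implicit Types (v w g chi k dX dY : R -> R) (u X Y : R -> R -> R).

(** Differentiability in L2 with an error of order [h^2]; the norm is squared, whence [h^4]. This
    form makes products satisfy [is_derive_quad]. *)
Definition L2_derivative X t dX := exists C r, [/\ 0 < r, L2 dX &
  forall h, `|h| < r -> L2 (X (t + h)) /\
    sq (X (t + h) - X t - h *: dX) <= C * (h ^+ 2) ^+ 2].

(** Cauchy-Schwarz with [sqrt (C * sq w) <= C + sq w], which avoids square roots. *)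
Lemma inner_small v w C e : L2 v -> L2 w -> 0 <= C -> 0 <= e ->
  sq v <= C * e ^+ 2 -> `|inner v w| <= e * (C + sq w).
Proof.
move=> Lv Lw C0 e0 hv; have w0 := sq_ge0 L w; have v0 := sq_ge0 L v.
rewrite -ler_sqr ?nnegrE ?mulr_ge0 ?addr_ge0// real_normK ?num_real//.
apply: le_trans (cauchy_schwarz siL Lv Lw) _; rewrite -!/(sq _).
apply: (@le_trans _ _ (C * e ^+ 2 * sq w)); first by rewrite ler_wpM2r.
rewrite exprMn mulrAC [leRHS]mulrC ler_wpM2r ?sqr_ge0//.
by move: (sq w) w0 => s s0; nra.
Qed.

Lemma is_derive_inner X dX Y dY (t : R) :
  L2_derivative X t dX -> L2_derivative Y t dY ->
  is_derive t 1 (fun s => inner (X s) (Y s)) (inner dX (Y t) + inner (X t) dY).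
Proof.
move=> [C [r [r0 LdX hX]]] [C' [r' [r'0 LdY hY]]].
have LXt : L2 (X t) by rewrite -[t]addr0; apply: (hX 0 _).1; rewrite normr0.
have LYt : L2 (Y t) by rewrite -[t]addr0; apply: (hY 0 _).1; rewrite normr0.
pose D := Num.max C 0; pose D' := Num.max C' 0.
have D0 : 0 <= D by rewrite le_max lexx orbT.
have D'0 : 0 <= D' by rewrite le_max lexx orbT.
(* One summand for each of the six terms of the expansion [E] below, in the same order, after
   division by [h^2]. *)
pose M := (D + sq (Y t)) + (D + sq dY) + (D + D') + `|inner dX dY| +
  (D' + sq dX) + (D' + sq (X t)).
apply: (@is_derive_quad _ _ _ _ M (Num.min 1 (Num.min r r'))).
  by rewrite !lt_min ltr01 r0.
move=> h; rewrite !lt_min => /andP[h1 /andP[/hX[LXh hXh] /hY[LYh hYh]]].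
pose A := X (t + h) - X t - h *: dX; pose B := Y (t + h) - Y t - h *: dY.
have LA : L2 A by apply: (siB siL) (siZ siL _ LdX); exact: (siB siL).
have LB : L2 B by apply: (siB siL) (siZ siL _ LdY); exact: (siB siL).
have h20 := sqr_ge0 h.
have h2le : h ^+ 2 <= 1 by rewrite -(real_normK (num_real h)) expr_le1// ltW.
have sA : sq A <= D * (h ^+ 2) ^+ 2.
  by apply: le_trans hXh _; rewrite ler_wpM2r ?sqr_ge0// le_max lexx.
have sB : sq B <= D' * (h ^+ 2) ^+ 2.
  by apply: le_trans hYh _; rewrite ler_wpM2r ?sqr_ge0// le_max lexx.
have E3 (V : zmodType) (x y z : V) : x = z + y + (x - y - z).
  by rewrite addrC -[x - y - z]addrA -opprD [z + y]addrC subrK.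
have XE : X (t + h) = h *: dX + X t + A := E3 _ _ _ _.
have YE : Y (t + h) = h *: dY + Y t + B := E3 _ _ _ _.
have LhY : L2 (h *: dY + Y t) by exact: (semi_innerP siL).
have LhX : L2 (h *: dX + X t) by exact: (semi_innerP siL).
have dec f : L2 f -> inner f (Y (t + h)) = h * inner f dY + inner f (Y t) + inner f B.
  move=> Lf; rewrite YE (aDr siL LhY LB Lf) (aDr siL (siZ siL h LdY) LYt Lf).
  by rewrite (aZr siL h LdY Lf).
have E : inner (X (t + h)) (Y (t + h)) - inner (X t) (Y t) -
    h * (inner dX (Y t) + inner (X t) dY) =
    inner A (Y t) + h * inner A dY + inner A B + h ^+ 2 * inner dX dY
      + h * inner dX B + inner (X t) B.
  rewrite {1}XE (aDl siL LhX LA LYh) (aDl siL (siZ siL h LdX) LXt LYh).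
  by rewrite (aZl siL h LdX LYh) !dec//; ring.
have hle x : `|h * x| <= `|x| by rewrite normrM ler_piMl// ltW.
have b1 := inner_small LA LYt D0 h20 sA.
have b2 := inner_small LA LdY D0 h20 sA.
have b3 : `|inner A B| <= h ^+ 2 * (D + D').
  apply: le_trans (inner_small LA LB D0 h20 sA) _; rewrite ler_wpM2l// lerD2l.
  by apply: le_trans sB _; rewrite ler_piMr// expr_le1.
have b4 : `|h ^+ 2 * inner dX dY| <= h ^+ 2 * `|inner dX dY| by rewrite normrM (ger0_norm h20).
have b5 : `|inner dX B| <= h ^+ 2 * (D' + sq dX).
  by rewrite (semi_inner_sym siL LdX LB); exact: inner_small.
have b6 : `|inner (X t) B| <= h ^+ 2 * (D' + sq (X t)).
  by rewrite (semi_inner_sym siL LXt LB); exact: inner_small.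
rewrite E [leRHS]mulrC /M !mulrDr.
rewrite !mulrDr in b1 b2 b3 b5 b6.
have b2' := le_trans (hle _) b2; have b5' := le_trans (hle _) b5.
set a1 := inner A (Y t); set a2 := h * inner A dY; set a3 := inner A B.
set a4 := h ^+ 2 * inner dX dY; set a5 := h * inner dX B; set a6 := inner (X t) B.
have : `|a1 + a2 + a3 + a4 + a5 + a6| <= `|a1| + `|a2| + `|a3| + `|a4| + `|a5| + `|a6|.
  by do 5 (apply: le_trans (ler_normD _ _) _; rewrite ?lerD2r).
move: b1 b2' b3 b4 b5' b6; rewrite -/a1 -/a2 -/a3 -/a4 -/a5 -/a6; lra.
Qed.

Lemma mean_value (f df : R -> R) x y : (forall z : R, is_derive z 1 f (df z)) ->
  exists2 c, `|c - x| <= `|y - x| & f y - f x = df c * (y - x).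
Proof.
move=> fdf.
have cf (a b : R) : {within `[a, b], continuous f}.
  apply: continuous_subspaceT => z; apply/differentiable_continuous/derivable1_diffP.
  by case: (fdf z).
have [xy|yx|->] := ltgtP x y; last by exists y; rewrite ?subrr// mulr0.
- have [c] := MVT xy (fun z _ => fdf z) (cf x y).
  rewrite in_itv/= => /andP[xc cy] fE; exists c => //.
  by rewrite !gtr0_norm ?subr_gt0// lerD2r ltW.
- have [c] := MVT yx (fun z _ => fdf z) (cf y x).
  rewrite in_itv/= => /andP[yc cx] fE; exists c.
    by rewrite !ltr0_norm ?subr_lt0// lerN2 lerD2r ltW.
  by rewrite -[f y - f x]opprB fE -mulrN opprB.
Qed.

Lemma taylor2 k A x h : smooth k -> (forall x, `|derive1 (derive1 k) x| <= A) ->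
  `|k (x - h) - k x + h * derive1 k x| <= A * h ^+ 2.
Proof.
move=> sk hA; have sk' := smooth_derive1 sk.
have [c hc ->] := mean_value x (x - h) (fun z => smooth_is_derive z sk).
have [c' _ hc'] := mean_value x c (fun z => smooth_is_derive z sk').
have xh : x - h - x = - h by ring.
rewrite xh normrN in hc *.
have -> : derive1 k c * - h + h * derive1 k x = - (derive1 k c - derive1 k x) * h by ring.
rewrite hc' normrM normrN normrM -(real_normK (num_real h)) expr2 mulrA.
by rewrite ler_wpM2r// ler_pM.
Qed.

(** Weighting with the kernel moved forward by [t] gives the mollification at time [t]. *)
Definition tshift k t s : R := k (s - t).

Lemma tshiftE k t : tshift k t = (fun s => k (1 * s + - t)).
Proof. by apply/funext => s; rewrite mul1r. Qed.

Lemma derive1_tshift k t : smooth k -> derive1 (tshift k t) = tshift (derive1 k) t.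
Proof.
by move=> sk; rewrite tshiftE (derive1_affine 1 (- t) sk) tshiftE; apply/funext => s; rewrite mul1r.
Qed.

Lemma tshift_out k (a b t s : R) : (forall t, t \notin `[a, b]%R -> k t = 0) ->
  s \notin `[a + t, b + t]%R -> tshift k t s = 0.
Proof.
move=> k0; rewrite in_itv/= => h; apply: k0; rewrite in_itv/=.
by rewrite lerBrDr lerBlDr.
Qed.

(** Only [a + t > 0] is asked: small negative shifts are allowed, so that two-sided derivatives
    exist at [t = 0]. *)
Lemma tshift_kernel k (a b t : R) : kernel k -> a <= b -> 0 < a + t ->
  (forall t, t \notin `[a, b]%R -> k t = 0) -> kernel (tshift k t).
Proof.
move=> kk ab at0 k0.
apply: (@testI _ _ (@J_itv R) _ (a + t) (b + t)).
- by rewrite /= in_itv/= at0.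
- by rewrite /= in_itv/= andbT (lt_le_trans at0)// lerD2r.
- by rewrite tshiftE; exact: (@smooth_affine _ k 1 (- t) (test_smooth kk)).
- by move=> s; exact: tshift_out.
Qed.

Lemma tshift_kernel_ge0 k t : kernel k -> 0 <= t -> kernel (tshift k t).
Proof.
move=> kk t0; have [a [b [a0 ab k0]]] := kernel_support kk.
by apply: (tshift_kernel kk (ltW ab) _ k0); rewrite ltr_wpDr.
Qed.

(** A fixed representative for each kernel: the first component is the mollification, the second its
    derivative in [x]. *)
Definition mollify u k := xget (0, 0) [set p | mollified L u k p.1 p.2].

(** The sign comes from the derivative in [t] of [k (s - t)]. So [dkernel] on the kernel is the time
    derivative of the mollification. *)
Definition dkernel k := (-1) *: derive1 k.

Lemma kernel_dkernel k : kernel k -> kernel (dkernel k).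
Proof.
move=> kk; apply: (testZ (@J_itv R) (@J_neq0 R)).
exact: (test_derive1 (@J_itv R) (@J_neq0 R) kk).
Qed.

Section OneFunction.
Variable u : R -> R -> R.
Hypotheses (cu : continuousL2 L u) (zu : zero_boundary L u).

Lemma mollifyP k : kernel k -> mollified L u k (mollify u k).1 (mollify u k).2.
Proof.
move=> kk; have [v [g hvg]] := mollified_exists L0 cu zu kk.
by rewrite /mollify; case: xgetP => [p -> //|/(_ (v, g))].
Qed.

(** The remainder is itself a mollification, with the second-order Taylor remainder of the kernel as
    weight, of size at most [A h^2]. [mollified_bound] applies to any representative, hence to this
    combination of chosen ones. *)
Lemma mollify_L2_derivative k t : kernel k -> 0 <= t ->
  L2_derivative (fun s => (mollify u (tshift k s)).1) t (mollify u (tshift (dkernel k) t)).1 /\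
  L2_derivative (fun s => (mollify u (tshift k s)).2) t (mollify u (tshift (dkernel k) t)).2.
Proof.
move=> kk t0; have [a [b [a0 ab k0]]] := kernel_support kk.
have dkk := kernel_dkernel kk.
have kk'' := test_derive1 (@J_itv R) (@J_neq0 R) (test_derive1 (@J_itv R) (@J_neq0 R) kk).
have [A A0 hA] := test_bounded (@J_neq0 R) kk''.
(* For [|h| < a / 2] all the shifted kernels are supported in [[a / 2, b + t + a / 2]], so one
   constant serves every [h]. *)
have a20 : 0 < a / 2 by rewrite divr_gt0.
have ab2 : a / 2 < b + t + a / 2 by lra.
have [C C0 hC] := mollified_bound L0 cu zu a20 ab2.
have mdt := mollifyP (tshift_kernel_ge0 dkk t0).
have kt := tshift_kernel_ge0 kk t0; have mt := mollifyP kt.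
have [[Ldt Ldt' _] _] := mdt.
have key h : `|h| < a / 2 ->
    [/\ L2 (mollify u (tshift k (t + h))).1, L2 (mollify u (tshift k (t + h))).2 &
    sq ((mollify u (tshift k (t + h))).1 - (mollify u (tshift k t)).1
      - h *: (mollify u (tshift (dkernel k) t)).1) +
    sq ((mollify u (tshift k (t + h))).2 - (mollify u (tshift k t)).2
      - h *: (mollify u (tshift (dkernel k) t)).2) <= C * A ^+ 2 * (h ^+ 2) ^+ 2].
  move=> hr; have [h1 h2] : - h < a / 2 /\ h < a / 2.
    by move: hr; rewrite ltr_norml => /andP[]; split=> //; lra.
  have kth : kernel (tshift k (t + h)) by apply: (tshift_kernel kk (ltW ab) _ k0); lra.
  have mth := mollifyP kth; have [[Lth Lth' _] _] := mth.
  split => //.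
  have k1 := testP (@J_itv R) (@J_neq0 R) (-1) kt kth.
  have m1 := mollifiedP L0 cu (-1) kt kth mt mth.
  have m2 := mollifiedP L0 cu (- h) (tshift_kernel_ge0 dkk t0) k1 mdt m1.
  have k2 := testP (@J_itv R) (@J_neq0 R) (- h) (tshift_kernel_ge0 dkk t0) k1.
  have E (V : lmodType R) (x y z : V) : x - y - h *: z = - h *: z + (-1 *: y + x).
    by rewrite scaleN1r scaleNr addrC [- y + x]addrC.
  rewrite !E -mulrA -exprMn.
  apply: (hC _ (A * h ^+ 2) _ _ k2 _ _ m2).
  - move=> s; rewrite in_itv/= negb_and -!ltNge => hs.
    have z1 : tshift k t s = 0.
      apply: (tshift_out k0); rewrite in_itv/= negb_and -!ltNge.
      by apply/orP; case/orP: hs => hs; [left; lra|right; lra].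
    have z2 : tshift k (t + h) s = 0.
      apply: (tshift_out k0); rewrite in_itv/= negb_and -!ltNge.
      by apply/orP; case/orP: hs => hs; [left; lra|right; lra].
    have z3 : tshift (dkernel k) t s = 0.
      have -> : tshift (dkernel k) t s = - derive1 (tshift k t) s.
        rewrite (derive1_tshift _ (test_smooth kk)).
        by rewrite /tshift/dkernel -[LHS]/(-1 * derive1 k (s - t)) mulN1r.
      rewrite derive1E.
      have -> : 'D_1 (tshift k t) s = 'D_1 (cst 0) s.
        apply: near_eq_derive; case/orP: hs => hs; near=> z;
        apply: (tshift_out k0); rewrite in_itv/= negb_and -!ltNge; apply/orP;
        [left|right].
          have : z < a / 2 by near: z; exact: lt_nbhsl.
          lra.
        have : b + t + a / 2 < z by near: z; exact: lt_nbhsr.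
        lra.
      by rewrite derive_cst oppr0.
    rewrite -[LHS]/(- h * tshift (dkernel k) t s + (-1 * tshift k t s + tshift k (t + h) s)).
    by rewrite z1 z2 z3 !mulr0 !addr0.
  - move=> s.
    have := taylor2 (s - t) h (test_smooth kk) hA.
    rewrite -[(- h *: tshift (dkernel k) t + (-1 *: tshift k t + tshift k (t + h))) s]/
      (- h * (-1 * derive1 k (s - t)) + (-1 * k (s - t) + k (s - (t + h)))).
    have -> : s - (t + h) = s - t - h by ring.
    congr (`|_| <= _); ring.
split; exists (C * A ^+ 2), (a / 2); split => // h /key[Lth Lth' hb]; split => //;
  by apply: le_trans hb; rewrite ?lerDl ?lerDr sq_ge0.
Unshelve. all: end_near. Qed.

End OneFunction.
End TimeDerivative.

(** * The Lyapunov functional *)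

Section Lyapunov.
Variable R : realType.

Lemma young (e c v w y : R) : 0 < e -> 0 <= v -> 0 <= w -> y ^+ 2 <= v * w ->
  c * y <= e * v + c ^+ 2 / e * w.
Proof.
move=> e0 v0 w0 yvw.
have h : (2 * (c * y)) ^+ 2 <= (e * v + c ^+ 2 / e * w) ^+ 2.
  apply: (@le_trans _ _ (4 * (e * v) * (c ^+ 2 / e * w))).
    have -> : 4 * (e * v) * (c ^+ 2 / e * w) = 4 * c ^+ 2 * (v * w) by field; rewrite gt_eqF.
    have -> : (2 * (c * y)) ^+ 2 = 4 * c ^+ 2 * y ^+ 2 by ring.
    by rewrite ler_wpM2l// mulr_ge0// sqr_ge0.
  have := sqr_ge0 (e * v - c ^+ 2 / e * w); lra.
have b0 : 0 <= e * v + c ^+ 2 / e * w.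
  have ce : 0 <= c ^+ 2 / e by rewrite divr_ge0 ?sqr_ge0// ltW.
  by rewrite addr_ge0// mulr_ge0// ltW.
have : 2 * (c * y) <= e * v + c ^+ 2 / e * w.
  by move: (2 * (c * y)) (e * v + _) h b0 => p q h b0; rewrite leNgt; apply/negP; nra.
move: (c * y) => z; lra.
Qed.

(** The vector [(c, - b)] gives the value [c (a c - b^2)]. *)
Lemma symmx2_posdef (a b c : R) : posdefmx (symmx2 a b c) -> 0 < c ->
  b ^+ 2 < a * c.
Proof.
move=> [_ pos] c0; pose v : 'cV[R]_(1 + 1) := col_mx c%:M (- b)%:M.
have v0 : v != 0.
  apply/eqP => v0; have := congr1 (fun w : 'cV[R]_(1 + 1) => usubmx w 0 0) v0.
  by rewrite /v col_mxKu !mxE mulr1n => c_eq0; move: c0; rewrite c_eq0 ltxx.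
have := pos v v0.
rewrite /symmx2 tr_col_mx mul_row_block mul_row_col !tr_scalar_mx.
rewrite -!scalar_mxM -!raddfD/= -!scalar_mxM -raddfD/= mxE eqxx mulr1n.
have -> : (c * a + - b * b) * c + (c * b + - b * c) * - b = c * (a * c - b ^+ 2) by ring.
by rewrite pmulr_rgt0// subr_gt0.
Qed.

Variables (rho1 rho2 kappa alpha delta h tau0 r mu K d xi1 xi2 : R).
Hypotheses (rho1_gt0 : 0 < rho1) (rho2_gt0 : 0 < rho2) (kappa_gt0 : 0 < kappa)
  (alpha_gt0 : 0 < alpha) (delta_gt0 : 0 < delta) (h_gt0 : 0 < h)
  (tau0_gt0 : 0 < tau0) (r_gt0 : 0 < r) (mu_gt0 : 0 < mu) (K_ge0 : 0 <= K)
  (det_gt0 : d ^+ 2 < tau0 * r).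

(** [s] is the determinant over the trace, a lower bound for the smaller eigenvalue. Subtracting [s]
    times the identity leaves a nonnegative form, as [d^2 <= (tau0 - s) (r - s)]. *)
Lemma quad_coercive : exists2 s, 0 < s & forall T S m : R, 0 <= T -> 0 <= S ->
  m ^+ 2 <= T * S -> s * (T + S) <= tau0 * T + r * S + 2 * d * m.
Proof.
have tr0 : 0 < tau0 + r by rewrite addr_gt0.
have D0 : 0 < tau0 * r - d ^+ 2 by rewrite subr_gt0.
pose s := (tau0 * r - d ^+ 2) / (tau0 + r).
have s0 : 0 < s by rewrite divr_gt0.
have sE : s * (tau0 + r) = tau0 * r - d ^+ 2 by rewrite divfK// gt_eqF.
have d20 := sqr_ge0 d.
exists s => // T S m T0 S0 mTS.
have st : s <= tau0 by rewrite ler_pdivrMr//; move: tau0_gt0 r_gt0 => ? ?; nra.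
have sr : s <= r by rewrite ler_pdivrMr//; move: tau0_gt0 r_gt0 => ? ?; nra.
have pd : d ^+ 2 <= (tau0 - s) * (r - s).
  have -> : (tau0 - s) * (r - s) = tau0 * r - s * (tau0 + r) + s ^+ 2 by ring.
  by rewrite sE; have := sqr_ge0 s; lra.
have p0 : 0 <= (tau0 - s) * T by rewrite mulr_ge0// subr_ge0.
have q0 : 0 <= (r - s) * S by rewrite mulr_ge0// subr_ge0.
have hh : (2 * d * m) ^+ 2 <= ((tau0 - s) * T + (r - s) * S) ^+ 2.
  have : d ^+ 2 * m ^+ 2 <= (tau0 - s) * (r - s) * (T * S).
    by apply: ler_pM; rewrite ?sqr_ge0.
  have := sqr_ge0 ((tau0 - s) * T - (r - s) * S); lra.
have : - (2 * d * m) <= (tau0 - s) * T + (r - s) * S.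
  move: hh (addr_ge0 p0 q0); move: (2 * d * m) (_ + _) => p q hh q1.
  by rewrite leNgt; apply/negP; nra.
lra.
Qed.

Definition dissipation (a1 a2 Th Pi : R) :=
  mu * a1 + mu * rho2 / kappa * a2 + delta * Th + h * Pi.

(** Twice the energy; hence its derivative is minus twice [dissipation]. *)
Definition total (a1 a2 b s f T S m : R) :=
  rho1 * a1 + alpha * b + kappa * s + rho1 * rho2 / kappa * a2 + rho2 * f
  + (tau0 * T + r * S + 2 * d * m).

(* The squared norms and the inner products that occur in the Lyapunov
   functional at one instant: a1 = |phi_t|^2, a2 = |phi_tt|^2, b = |psi_x|^2,
   s = |phi_x + psi|^2, f = |phi_tx|^2, T = |theta|^2, S = |P|^2,
   m = <theta, P>, Th = |theta_x|^2, Pi = |P_x|^2, p = |phi_x|^2, z = |psi|^2,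
   e0 = |phi|^2. *)
Record snapshot (a1 a2 b s f T S m Th Pi p z e0 x1 x2 x3 x4 x5 x6 x8 : R) : Prop := {
  snap_ge0 : [/\ 0 <= a1, 0 <= a2, 0 <= b, 0 <= s & 0 <= f];
  snap_ge0' : [/\ 0 <= T, 0 <= S, 0 <= p, 0 <= z & 0 <= e0];
  snap_poincare : [/\ T <= K * Th, S <= K * Pi, z <= K * b, e0 <= K * p &
    p <= 2 * s + 2 * z];
  snap_dx_ge0 : 0 <= Th /\ 0 <= Pi;
  snap_m : m ^+ 2 <= T * S;
  snap_cs1 : x1 ^+ 2 <= b * a2;
  snap_cs2 : x2 ^+ 2 <= b * T;
  snap_cs3 : x3 ^+ 2 <= b * S;
  snap_cs4 : x4 ^+ 2 <= e0 * a2;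
  snap_cs5 : x5 ^+ 2 <= e0 * a1;
  snap_cs6 : x6 ^+ 2 <= a1 * a2;
  snap_cs8 : x8 ^+ 2 <= b * a1;
  snap_static : alpha * b + kappa * s
    = - rho2 * x1 + - xi1 * x2 + - xi2 * x3 + - rho1 * x4 + - mu * x5 }.

End Lyapunov.

(** The remaining symbols are x1 = <phi_tt, psi_x>, x2 = <theta, psi_x>, x3 = <P, psi_x>, x4 =
    <phi_tt, phi>, x5 = <phi_t, phi>, x6 = <phi_tt, phi_t>, x8 = <psi_x, phi_t>, and [K] is the
    Poincaré constant. The last conclusion bounds the derivative of [N * W + F]. *)
Lemma lyapunov_constants (R : realType)
  (rho1 rho2 kappa alpha delta h tau0 r mu K d xi1 xi2 : R)
  (rho1_gt0 : 0 < rho1) (rho2_gt0 : 0 < rho2) (kappa_gt0 : 0 < kappa)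
  (alpha_gt0 : 0 < alpha) (delta_gt0 : 0 < delta) (h_gt0 : 0 < h)
  (tau0_gt0 : 0 < tau0) (r_gt0 : 0 < r) (mu_gt0 : 0 < mu) (K_ge0 : 0 <= K)
  (det_gt0 : d ^+ 2 < tau0 * r) :
  exists N l Q, [/\ 0 < N, 0 < l, 0 < Q &
  forall a1 a2 b s f T S m Th Pi p z e0 x1 x2 x3 x4 x5 x6 x8,
  snapshot rho1 rho2 kappa alpha mu K xi1 xi2
    a1 a2 b s f T S m Th Pi p z e0 x1 x2 x3 x4 x5 x6 x8 ->
  let W := total rho1 rho2 kappa alpha tau0 r d a1 a2 b s f T S m in
  let F := rho1 * x6 - kappa * x8 in
  [/\ W <= N * W + F, N * W + F <= Q * W &
    N * (- (2 * dissipation rho2 kappa delta h mu a1 a2 Th Pi)) +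
      (- kappa * f - mu * x6 + rho1 * a2 - kappa * x1) <= - l * (N * W + F)]].
Proof.
have [sg sg0 hsg] := quad_coercive tau0_gt0 r_gt0 det_gt0.
have nz := (gt_eqF rho1_gt0, gt_eqF rho2_gt0, gt_eqF kappa_gt0, gt_eqF alpha_gt0,
  gt_eqF mu_gt0, gt_eqF delta_gt0, gt_eqF h_gt0).
have K3 : 0 < 3 + 4 * K ^+ 2 by rewrite ltr_wpDr// mulr_ge0// sqr_ge0.
have K4 : 0 < 4 * K + 1 by rewrite ltr_wpDl// mulr_ge0.
(* Young's inequality spends [3 e b + 2 e e0], and [e0 <= K p <= 2 K s + 2 K^2 b]. The two bounds on
   [e] let half of [alpha b + kappa s] absorb this. *)
pose e := Num.min (alpha / 2 / (3 + 4 * K ^+ 2)) (kappa / 2 / (4 * K + 1)).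
have e0 : 0 < e by rewrite lt_min !divr_gt0.
have ea : e * (3 + 4 * K ^+ 2) <= alpha / 2 by rewrite -ler_pdivlMr// ge_min lexx.
have ek : e * (4 * K) <= kappa / 2.
  apply: (@le_trans _ _ (e * (4 * K + 1))); first by rewrite ler_wpM2l ?(ltW e0)// lerDl.
  by rewrite -ler_pdivlMr// ge_min lexx orbT.
(* [c0 * D] dominates [a1], [a2], [T] and [S], one summand for each; the last two use Poincaré. *)
pose c0 := mu^-1 + kappa / (mu * rho2) + K / delta + K / h.
have c1 : 0 <= mu^-1 by rewrite invr_ge0 ltW.
have c2 : 0 <= kappa / (mu * rho2) by rewrite ltW// divr_gt0// mulr_gt0.
have c3 : 0 <= K / delta by rewrite divr_ge0// ltW.
have c4 : 0 <= K / h by rewrite divr_ge0// ltW.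
have c00 : 0 <= c0 by rewrite !addr_ge0.
(* [alpha b + kappa s <= C1 * D]: what Young leaves of the five products in [snap_static], doubled
   by the absorption. *)
pose C1 := 2 * ((rho2 ^+ 2 + xi1 ^+ 2 + xi2 ^+ 2 + rho1 ^+ 2 + mu ^+ 2) / e * c0).
have C10 : 0 <= C1.
  by rewrite mulr_ge0// mulr_ge0// divr_ge0 ?(ltW e0)// !addr_ge0// sqr_ge0.
(* [C2 * D] dominates the derivative of [F] apart from its good term [- kappa * f]. *)
pose C2 := 2 * mu * c0 + rho1 * c0 + kappa * (c0 + C1 / alpha).
have rho1_ge0 := ltW rho1_gt0; have rho2_ge0 := ltW rho2_gt0.
have kappa_ge0 := ltW kappa_gt0; have alpha_ge0 := ltW alpha_gt0.
have mu_ge0 := ltW mu_gt0; have delta_ge0 := ltW delta_gt0; have h_ge0 := ltW h_gt0.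
have tau0_ge0 := ltW tau0_gt0; have r_ge0 := ltW r_gt0.
have rr0 : 0 < rho1 * rho2 / kappa by rewrite divr_gt0// mulr_gt0.
have C20 : 0 <= C2 by rewrite !addr_ge0 ?mulr_ge0// addr_ge0// divr_ge0.
(* [|F| <= C4 * W]. *)
pose C4 := rho1 * (rho1^-1 + (rho1 * rho2 / kappa)^-1) + kappa * (alpha^-1 + rho1^-1).
have C40 : 0 <= C4 by rewrite addr_ge0// mulr_ge0// addr_ge0// invr_ge0// ltW.
(* [W <= C3 * (D + f)]: dissipation and [f] together control the whole energy. *)
pose C3 := 1 + rho1 * c0 + C1 + rho1 * rho2 / kappa * c0 + rho2 + (tau0 + r + 4 * `|d|) * c0.
have C30 : 0 < C3.
  rewrite /C3 -!addrA ltr_wpDr// !addr_ge0// mulr_ge0 ?(ltW rr0)//.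
  by rewrite !addr_ge0// mulr_ge0.
(* [C4 + 1] gives [W <= N * W + F]; [C2] and the 1 make [- 2 N D] beat [C2 * D] with at least [D] to
   spare. *)
pose N := C2 + C4 + 1; pose Q := N + C4.
have N0 : 0 < N by rewrite /N ltr_wpDl// addr_ge0.
have Q0 : 0 < Q by rewrite /Q ltr_wpDr.
(* [D + kappa f >= mk (D + f) >= mk / C3 * W], and division by [Q] turns this into a rate for
   [N * W + F]. *)
pose mk := Num.min 1 kappa; have mk0 : 0 < mk by rewrite lt_min ltr01.
exists N, (mk / C3 / Q), Q; split => //; first by rewrite !divr_gt0.
move=> a1 a2 b s f T S m Th Pi p z ee x1 x2 x3 x4 x5 x6 x8 snap W F.
have [[a1_0 a2_0 b_0 s_0 f_0] [T_0 S_0 p_0 z_0 ee_0] [hT hS hz hee hp] [Th_0 Pi_0]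
  hm h1 h2 h3 h4 h5 h6 h8 hst] := snap.
pose D := dissipation rho2 kappa delta h mu a1 a2 Th Pi.
have u1 : 0 <= mu * a1 by rewrite mulr_ge0.
have u2 : 0 <= mu * rho2 / kappa * a2 by rewrite mulr_ge0// divr_ge0// mulr_ge0.
have u3 : 0 <= delta * Th by rewrite mulr_ge0.
have u4 : 0 <= h * Pi by rewrite mulr_ge0.
have DE : D = mu * a1 + mu * rho2 / kappa * a2 + delta * Th + h * Pi by [].
have D0 : 0 <= D by rewrite DE; clear -u1 u2 u3 u4; lra.
have cD x : 0 <= x -> 0 <= x * D by move=> x0; rewrite mulr_ge0.
have := cD _ c1; have := cD _ c2; have := cD _ c3; have := cD _ c4.
have c0E : c0 * D = mu^-1 * D + kappa / (mu * rho2) * D + K / delta * D + K / h * D.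
  by rewrite /c0 !mulrDl.
move=> v4 v3 v2 v1.
have Da1 : a1 <= c0 * D.
  have : mu^-1 * (mu * a1) <= mu^-1 * D.
    by rewrite ler_wpM2l// DE; clear -u1 u2 u3 u4; lra.
  by rewrite mulKf ?nz// c0E; clear -v1 v2 v3 v4; lra.
have Da2 : a2 <= c0 * D.
  have : kappa / (mu * rho2) * (mu * rho2 / kappa * a2) <= kappa / (mu * rho2) * D.
    
    by rewrite ler_wpM2l// DE; clear -u1 u2 u3 u4; lra.
  have -> : kappa / (mu * rho2) * (mu * rho2 / kappa * a2) = a2 by field; rewrite !nz.
  by rewrite c0E; clear -v1 v2 v3 v4 hT hS; lra.
have DT : T <= c0 * D.
  have : K / delta * (delta * Th) <= K / delta * D.
    by rewrite ler_wpM2l// DE; clear -u1 u2 u3 u4; lra.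
  have -> : K / delta * (delta * Th) = K * Th by field; rewrite !nz.
  by rewrite c0E; clear -v1 v2 v3 v4 hT hS; lra.
have DS : S <= c0 * D.
  have : K / h * (h * Pi) <= K / h * D.
    by rewrite ler_wpM2l// DE; clear -u1 u2 u3 u4; lra.
  have -> : K / h * (h * Pi) = K * Pi by field; rewrite !nz.
  by rewrite c0E; clear -v1 v2 v3 v4 hT hS; lra.
have Dbs : alpha * b + kappa * s <= C1 * D.
  have y1 := young (- rho2) e0 b_0 a2_0 h1.
  have y2 := young (- xi1) e0 b_0 T_0 h2.
  have y3 := young (- xi2) e0 b_0 S_0 h3.
  have y4 := young (- rho1) e0 ee_0 a2_0 h4.
  have y5 := young (- mu) e0 ee_0 a1_0 h5.
  rewrite !sqrrN in y1 y2 y3 y4 y5.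
  have w (c v : R) : v <= c0 * D -> c ^+ 2 / e * v <= c ^+ 2 / e * (c0 * D).
    by move=> hv; rewrite ler_wpM2l// divr_ge0 ?sqr_ge0// ltW.
  have := w rho2 _ Da2; have := w xi1 _ DT; have := w xi2 _ DS.
  have := w rho1 _ Da2; have := w mu _ Da1.
  have hb : e * b + e * b + e * b + e * ee + e * ee <= alpha / 2 * b + kappa / 2 * s.
    have g1 : e * ee <= e * (K * p) by rewrite ler_wpM2l// ltW.
    have g2 : e * K * p <= e * K * (2 * s + 2 * z) by rewrite ler_wpM2l// mulr_ge0// ltW.
    have g3 : e * K * z <= e * K * (K * b) by rewrite ler_wpM2l// mulr_ge0// ltW.
    have g4 : e * (3 + 4 * K ^+ 2) * b <= alpha / 2 * b by rewrite ler_wpM2r.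
    have g5 : e * (4 * K) * s <= kappa / 2 * s by rewrite ler_wpM2r.
    by clear -g1 g2 g3 g4 g5; lra.
  have -> : C1 * D = 2 * (rho2 ^+ 2 / e * (c0 * D) + xi1 ^+ 2 / e * (c0 * D) +
    xi2 ^+ 2 / e * (c0 * D) + rho1 ^+ 2 / e * (c0 * D) + mu ^+ 2 / e * (c0 * D)).
    by rewrite /C1; ring.
  by clear -y1 y2 y3 y4 y5 hb hst; lra.
have Db : b <= C1 / alpha * D.
  rewrite mulrAC ler_pdivlMr// mulrC; have : 0 <= kappa * s by rewrite mulr_ge0.
  by clear -Dbs; lra.
have amgm (x v w : R) : 0 <= v -> 0 <= w -> x ^+ 2 <= v * w -> `|x| <= v + w.
  move=> v0 w0 hx; rewrite -ler_sqr ?nnegrE ?addr_ge0// real_normK ?num_real//.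
  by apply: le_trans hx _; have := mulr_ge0 v0 w0; have := sqr_ge0 v; have := sqr_ge0 w; clear; lra.
have /ler_normlP[x6l x6r] := amgm _ _ _ a1_0 a2_0 h6.
have /ler_normlP[x1l x1r] := amgm _ _ _ b_0 a2_0 h1.
have /ler_normlP[x8l x8r] := amgm _ _ _ b_0 a1_0 h8.
have /ler_normlP[ml mr] := amgm _ _ _ T_0 S_0 hm.
have hTS := hsg T S m T_0 S_0 hm.
have TS0 : 0 <= sg * (T + S) by rewrite mulr_ge0 ?(ltW sg0)// addr_ge0.
have w1 : 0 <= rho1 * a1 by rewrite mulr_ge0.
have w2 : 0 <= alpha * b by rewrite mulr_ge0.
have w3 : 0 <= kappa * s by rewrite mulr_ge0.
have w4 : 0 <= rho1 * rho2 / kappa * a2 by rewrite mulr_ge0// ltW.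
have w5 : 0 <= rho2 * f by rewrite mulr_ge0.
have WE : W = rho1 * a1 + alpha * b + kappa * s + rho1 * rho2 / kappa * a2 + rho2 * f
  + (tau0 * T + r * S + 2 * d * m) by [].
have W0 : 0 <= W by rewrite WE; clear -w1 w2 w3 w4 w5 hTS TS0; lra.
have FW : `|F| <= C4 * W.
  have q1 : a1 <= rho1^-1 * W.
    by rewrite mulrC ler_pdivlMr// WE mulrC; clear -w1 w2 w3 w4 w5 hTS TS0; lra.
  have q2 : a2 <= (rho1 * rho2 / kappa)^-1 * W.
    by rewrite mulrC ler_pdivlMr// WE mulrC; clear -w1 w2 w3 w4 w5 hTS TS0; lra.
  have q3 : b <= alpha^-1 * W.
    by rewrite mulrC ler_pdivlMr// WE mulrC; clear -w1 w2 w3 w4 w5 hTS TS0; lra.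
  have r1 : rho1 * `|x6| <= rho1 * (rho1^-1 * W + (rho1 * rho2 / kappa)^-1 * W).
    by rewrite ler_wpM2l//; apply: le_trans (amgm _ _ _ a1_0 a2_0 h6) _; rewrite lerD.
  have r2 : kappa * `|x8| <= kappa * (alpha^-1 * W + rho1^-1 * W).
    by rewrite ler_wpM2l//; apply: le_trans (amgm _ _ _ b_0 a1_0 h8) _; rewrite lerD.
  have -> : C4 * W = rho1 * (rho1^-1 * W + (rho1 * rho2 / kappa)^-1 * W) +
    kappa * (alpha^-1 * W + rho1^-1 * W) by rewrite /C4; ring.
  apply: le_trans (ler_normB _ _) _; rewrite !normrM (gtr0_norm rho1_gt0) (gtr0_norm kappa_gt0).
  exact: lerD.
have /ler_normlP[Fl Fr] := FW.
have NE : N * W = C2 * W + C4 * W + W by rewrite /N; ring.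
have C2W : 0 <= C2 * W by rewrite mulr_ge0.
have C4W : 0 <= C4 * W by rewrite mulr_ge0.
have QE : Q * W = N * W + C4 * W by rewrite /Q mulrDl.
have WC3 : W <= C3 * (D + f).
  have dm : 2 * d * m <= 2 * `|d| * (T + S).
    rewrite -!mulrA ler_wpM2l//; apply: le_trans (ler_norm _) _.
    by rewrite normrM ler_wpM2l//; exact: amgm.
  have q1 : rho1 * a1 <= rho1 * (c0 * D) by rewrite ler_wpM2l.
  have q2 : rho1 * rho2 / kappa * a2 <= rho1 * rho2 / kappa * (c0 * D).
    by rewrite ler_wpM2l// ltW.
  have q3 : tau0 * T <= tau0 * (c0 * D) by rewrite ler_wpM2l.
  have q4 : r * S <= r * (c0 * D) by rewrite ler_wpM2l.
  have q5 : 2 * `|d| * (T + S) <= 2 * `|d| * (c0 * D + c0 * D).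
    by rewrite ler_wpM2l ?mulr_ge0// lerD.
  have -> : C3 * (D + f) = (rho1 * (c0 * D) + C1 * D + rho1 * rho2 / kappa * (c0 * D)
      + rho2 * f + (tau0 * (c0 * D) + r * (c0 * D) + 2 * `|d| * (c0 * D + c0 * D)))
      + (D + f + rho2 * D + rho1 * c0 * f + C1 * f
      + rho1 * rho2 / kappa * c0 * f + (tau0 + r + 4 * `|d|) * c0 * f).
    by rewrite /C3; ring.
  have t1 : 0 <= rho2 * D by rewrite mulr_ge0.
  have t2 : 0 <= rho1 * c0 * f by rewrite !mulr_ge0.
  have t3 : 0 <= C1 * f by rewrite mulr_ge0.
  have t4 : 0 <= rho1 * rho2 / kappa * c0 * f by rewrite mulr_ge0// mulr_ge0// ltW.
  have t5 : 0 <= (tau0 + r + 4 * `|d|) * c0 * f.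
    by rewrite mulr_ge0// mulr_ge0// !addr_ge0// mulr_ge0.
  rewrite WE; clear -q1 q2 q3 q4 q5 dm Dbs t1 t2 t3 t4 t5 f_0 D0; lra.
have l0 : 0 <= mk / C3 by rewrite divr_ge0// ltW.
have lW : mk / C3 / Q * (N * W + F) <= D + kappa * f.
  apply: (@le_trans _ _ (mk / C3 / Q * (Q * W))).
    by apply: ler_wpM2l; [rewrite divr_ge0// ltW|rewrite QE lerD2l].
  rewrite mulrA divfK ?gt_eqF//.
  apply: (@le_trans _ _ (mk / C3 * (C3 * (D + f)))); first by rewrite ler_wpM2l.
  rewrite mulrA divfK ?gt_eqF// mulrDr lerD//.
    by rewrite ler_piMl// ge_min lexx.
  by rewrite ler_wpM2r// ge_min lexx orbT.
have C2D : - mu * x6 + rho1 * a2 - kappa * x1 <= C2 * D.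
  have q1 : mu * (- x6) <= mu * (c0 * D + c0 * D).
    by rewrite ler_wpM2l//; apply: le_trans x6l _; exact: lerD.
  have q2 : rho1 * a2 <= rho1 * (c0 * D) by rewrite ler_wpM2l.
  have q3 : kappa * (- x1) <= kappa * (C1 / alpha * D + c0 * D).
    by rewrite ler_wpM2l//; apply: le_trans x1l _; exact: lerD.
  have -> : C2 * D = mu * (c0 * D + c0 * D) + rho1 * (c0 * D) +
    kappa * (C1 / alpha * D + c0 * D) by rewrite /C2; ring.
  by clear -q1 q2 q3; lra.
split.
- by clear -NE Fl C2W W0; lra.
- by rewrite QE lerD2l.
- have ND : N * (2 * D) = 2 * (C2 * D) + 2 * (C4 * D) + 2 * D by rewrite /N; ring.
  have z1 : 0 <= C2 * D by rewrite mulr_ge0.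
  have z2 : 0 <= C4 * D by rewrite mulr_ge0.
  have -> : - (mk / C3 / Q) * (N * W + F) = - (mk / C3 / Q * (N * W + F)) by exact: mulNr.
  rewrite -/D [N * - _]mulrN ND; move: lW; set y := _ * (N * W + F).
  by clear -C2D z1 z2 D0; lra.
Qed.

(** * Gronwall's inequality and averages over time *)

Section Preliminaries.
Variable R : realType.
Local Notation mu := (@lebesgue_measure R).
Local Notation J := (`]0, +oo[%classic : set R).
Local Notation kernel := (test_function J).

Lemma exp_decay (f df : R -> R) l :
  (forall t : R, 0 <= t -> is_derive t 1 f (df t)) ->
  (forall t, 0 <= t -> df t <= - l * f t) ->
  forall t, 0 <= t -> f t <= f 0 * expR (- l * t).
Proof.
move=> fdf dfl t t0; pose g s := f s * expR (l * s).
have dg (s : R) : 0 <= s -> is_derive s 1 g (f s * (expR (l * s) * l) + expR (l * s) * df s).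
  move=> s0; have h1 := fdf s s0.
  have h2 : is_derive s 1 (fun z : R => expR (l * z)) (expR (l * s) * l).
    apply: (@is_derive1_comp _ expR (fun z : R => l * z)).
    by apply: is_derive_eq; rewrite -[l *: 1]/(l * 1) mulr1.
  exact: (@is_deriveM _ _ f (fun z : R => expR (l * z))).
have g_le : g t <= g 0.
  apply: (@ler0_derive1_le_cc _ g 0 t); last 3 first.
  - by rewrite in_itv/= t0 lexx.
  - by rewrite in_itv/= t0 lexx.
  - exact: t0.
  - by move=> s; rewrite in_itv/= => /andP[/ltW s0 _]; case: (dg s s0).
  - move=> s; rewrite in_itv/= => /andP[/ltW s0 _].
    rewrite derive1E (@derive_val _ _ _ _ _ _ _ (dg s s0)).
    have := dfl s s0; have := expR_gt0 (l * s).
    move: (expR _) (f s) (df s) => E y dy E0 h.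
    have -> : y * (E * l) + E * dy = E * (dy - (- l * y)) by ring.
    by rewrite pmulr_rle0// subr_le0.
  - apply: continuous_in_subspaceT => s; rewrite inE /= in_itv/= => /andP[s0 _].
    by apply/differentiable_continuous/derivable1_diffP; case: (dg s s0).
rewrite /g mulr0 expR0 mulr1 in g_le.
by rewrite mulNr expRN ler_pdivlMr ?expR_gt0.
Qed.

(** If [g] exceeded [B] at a point it would do so on an open interval, which has positive
    measure. *)
Lemma ae_continuous_le (g : R -> R) B : continuous_J g ->
  {ae mu, forall t, 0 <= t -> g t <= B} -> forall t, 0 < t -> g t <= B.
Proof.
move=> cg [N [mN N0 hN]] t t0; rewrite leNgt; apply/negP => gB.
have h : \forall s \near t, 0 < s /\ B < g s.
  near=> s; split; first by near: s; exact: lt_nbhsr.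
  by near: s; have := cg t t0 => /cvgr_gt; apply.
have [e /= e0 he] := h.
have sub : `]t - e, t + e[ `<=` N.
  move=> s /=; rewrite in_itv/= => /andP[s1 s2]; apply: hN => /= hs.
  have [s0 Bs] : 0 < s /\ B < g s.
    by apply: he; rewrite /= ltr_norml; apply/andP; split; lra.
  by have := hs (ltW s0); rewrite leNgt Bs.
pose O : set R := `]t - e, t + e[.
have mO : measurable (O : set (measurableTypeR R)) by exact: measurable_itv.
have : (mu O <= mu N)%E by apply: le_measure; [rewrite inE|rewrite inE|].
rewrite N0 [leLHS](lebesgue_measure_itv `]t - e, t + e[%R)/= lte_fin ifT; last by lra.
by rewrite -EFinB lee_fin; lra.
Unshelve. all: end_near. Qed.

(** Jensen's inequality for the probability density [k]; [f] is only bounded where [k] is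
    nonzero. *)
Lemma average_sq_le (f k : R -> R) B : continuous_J f -> kernel k ->
  (forall t, 0 <= k t) -> \int[mu]_(t in J) k t = 1 ->
  (forall t, 0 < t -> k t != 0 -> f t ^+ 2 <= B) ->
  (\int[mu]_(t in J) (f t * k t)) ^+ 2 <= B.
Proof.
move=> cf kk k0 k1 fB; have mJ := @measurable_J R.
have c1 : continuous_J (cst 1 : R -> R) by move=> t _; exact: cvg_cst.
have ik : mu.-integrable J (EFin \o k).
  have := integrable_kernel c1 kk; rewrite (_ : (fun t => _) = k)//.
  by apply/funext => t; rewrite mul1r.
have ifk := integrable_kernel cf kk.
(* Since [k] has integral 1 it is nonzero somewhere, and there the hypothesis shows that [B] is
   nonnegative. *)
have [t0 t0_gt0 kt0] : exists2 t, 0 < t & k t != 0.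
  apply: contrapT => h; have : \int[mu]_(t in J) k t = 0.
    rewrite (@eq_Rintegral _ _ _ mu J (cst 0)).
      by rewrite (Rintegral_cst mu mJ 0) mul0r.
    move=> t; rewrite inE /= in_itv/= andbT => tp; apply/eqP.
    by apply: contrapT => /negP kt; apply: h; exists t.
  by rewrite k1 => /eqP; rewrite oner_eq0.
have B0 : 0 <= B := le_trans (sqr_ge0 _) (fB _ t0_gt0 kt0).
have sB : Num.sqrt B ^+ 2 = B by rewrite sqr_sqrtr.
rewrite -[leRHS]sB -(real_normK (num_real (\int[mu]_(t in J) _))).
rewrite ler_sqr ?nnegrE ?sqrtr_ge0//.
apply: le_trans (le_normr_Rintegral mJ ifk) _.
rewrite -[leRHS]mulr1 -k1 -(RintegralZl (Num.sqrt B) mJ ik).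
apply: (le_Rintegral mJ (integrable_abse ifk) (integrableZl mJ _ ik)) => t.
rewrite /= in_itv/= andbT => tp; rewrite normrM (ger0_norm (k0 t)).
have [->|kt] := eqVneq (k t) 0; first by rewrite !mulr0.
apply: ler_wpM2r => //; rewrite -ler_sqr ?nnegrE ?sqrtr_ge0// sB.
by rewrite real_normK ?num_real// fB.
Qed.

Lemma unit_bump_kernel (e : R) : 0 < e -> exists k, [/\ kernel k,
  forall t, 0 <= k t, forall t, k t != 0 -> 0 < t < e & \int[mu]_(t in J) k t = 1].
Proof.
move=> e0; pose a := e / 4; pose b := e / 2.
have [a0 ab be] : [/\ 0 < a, a < b & b < e] by rewrite /a /b; split; lra.
pose p := bump 1 a b.
have kp : kernel p by apply: test_bump => //; exact: subset_cc_J.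
have cp : continuous p := test_continuous kp.
have p0 t : 0 <= p t := bump_ge0 _ _ _ _.
pose a' := a + (b - a) / 3; pose b' := b - (b - a) / 3.
have [aa' ab' bb'] : [/\ a < a', a' < b' & b' < b] by rewrite /a' /b'; split; lra.
have [c cab hc] := EVT_min (ltW ab') (continuous_subspaceT cp).
have pc : 0 < p c.
  move: cab; rewrite in_itv/= => /andP[h1 h2].
  by rewrite /p /bump; apply: mulr_gt0; apply: exp_step_gt0; lra.
have c1 : continuous_J (cst 1 : R -> R) by move=> t _; exact: cvg_cst.
have ip : mu.-integrable J (EFin \o p).
  have := integrable_kernel c1 kp; rewrite (_ : (fun t => _) = p)//.
  by apply/funext => t; rewrite mul1r.
have mJ := @measurable_J R.
have m' : measurable (`[a', b'] : set (measurableTypeR R)) by exact: measurable_itv.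
have pos : 0 < \int[mu]_(t in J) p t.
  apply: (@lt_le_trans _ _ (p c * (b' - a'))); first by rewrite mulr_gt0// subr_gt0.
  rewrite -lee_fin /Rintegral (fineK (integrable_fin_num mJ ip)).
  apply: (@le_trans _ _ (\int[mu]_(t in `[a', b']) (cst (p c)%:E) t)%E).
    rewrite (@integral_cst _ _ _ mu _ m') [X in (_ * X)%E](lebesgue_measure_itv `[a', b']%R)/=.
    by rewrite lte_fin ab' -EFinB -EFinM.
  apply: (@le_trans _ _ (\int[mu]_(t in `[a', b']) (p t)%:E)%E).
    apply: ge0_le_lower_integral => t tab; rewrite lee_fin//.
    exact: hc.
  apply: ge0_subset_integral => //.
  - exact: (measurable_int mu ip).
  - by move=> t _; rewrite lee_fin.
  - by apply: subset_cc_J; rewrite (lt_trans a0).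
set i := Rintegral _ _ _ in pos.
exists (i^-1 *: p); split.
- exact: (testZ (@J_itv R) (@J_neq0 R)).
- by move=> t; rewrite -[(i^-1 *: p) t]/(i^-1 * p t) mulr_ge0// invr_ge0 ltW.
- move=> t; rewrite -[(i^-1 *: p) t]/(i^-1 * p t) mulf_eq0 negb_or => /andP[_ pt].
  have : `[a, b] t by apply: contrapT => tab; move: pt; rewrite /p bump_out ?eqxx.
  by rewrite /= in_itv/= => /andP[h1 h2]; rewrite (lt_le_trans a0 h1) (le_lt_trans h2).
- by rewrite (RintegralZl i^-1 mJ ip) mulVf// gt_eqF.
Qed.

End Preliminaries.

(** * The equations of the mollified solution *)

Section LinearCombinations.
Variables (disp : measure_display) (T : measurableType disp) (R : realType).
Variables (m : {measure set T -> \bar R}) (D : set T).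
Hypothesis mD : measurable D.

(** Linear combinations as data, so that an integral is distributed over any number of terms in one
    application and the rest is [ring]. *)
Fixpoint lincomb (s : seq (R * (T -> R))) (t : T) : R :=
  if s is p :: s' then p.1 * p.2 t + lincomb s' t else 0.

Fixpoint lincomb_integrable (s : seq (R * (T -> R))) : Prop :=
  if s is p :: s' then m.-integrable D (EFin \o p.2) /\ lincomb_integrable s' else True.

Fixpoint lincomb_integral (s : seq (R * (T -> R))) : R :=
  if s is p :: s' then p.1 * (\int[m]_(t in D) p.2 t) + lincomb_integral s' else 0.

Lemma lincombP s : lincomb_integrable s ->
  m.-integrable D (EFin \o lincomb s) /\
  \int[m]_(t in D) lincomb s t = lincomb_integral s.
Proof.
elim: s => [_|[c f] s IH /= [if_ /IH[is_ sE]]].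
  split; first exact: integrable0.
  by rewrite /= (Rintegral_cst m mD 0) mul0r.
have icf := integrableZl mD c if_.
split; first exact: (integrableD mD icf is_).
by rewrite (RintegralD mD icf is_) (RintegralZl c mD if_) sE.
Qed.

End LinearCombinations.

Ltac generalize_scalars := repeat match goal with
  | |- context [Rintegral ?m ?D ?f] => generalize (Rintegral m D f); intro
  | |- context [inner ?L ?v ?w] => generalize (inner L v w); intro
  end.

Ltac unfold_lincomb :=
  cbn [lincomb lincomb_integral fst snd]; rewrite /time_pairing; generalize_scalars.

Section Equations.
Variable R : realType.
Variables (rho1 rho2 kappa alpha delta h tau0 r mu L d xi1 xi2 : R).
Hypothesis L0 : 0 < L.
Variables (phi phit phitt psi psit theta P : R -> R -> R).
Hypotheses (sol : solution_class L phi phit phitt psi psit theta P)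
  (eqs : equations rho1 rho2 kappa alpha delta h tau0 r mu L d xi1 xi2
    phi phit phitt psi psit theta P)
  (bnd : boundary_conditions L phi psi theta P).
Local Notation leb := (@lebesgue_measure R).
Local Notation I := `]0, L[%classic.
Local Notation J := (`]0, +oo[%classic : set R).
Local Notation test := (test_function I).
Local Notation kernel := (test_function J).
Local Notation inner := (inner L).
Local Notation sq := (sqnormL2 L).
Local Notation L2 := (L2 L).
Local Notation siL := (L2_semi_inner L).
Local Notation H0pair := (H0pair L).
Local Notation P_ := (time_pairing L).
Local Notation m1 u k := (mollify L u k).1.
Local Notation m2 u k := (mollify L u k).2.
Let testD1 := test_derive1 (@I_itv R L) (I_neq0 L0).
Implicit Types (v w g chi k : R -> R) (u : R -> R -> R).

Lemma mollify_phi k : kernel k -> mollified L phi k (m1 phi k) (m2 phi k).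
Proof. exact: (mollifyP L0 (repr_phi sol) (boundary_phi bnd)). Qed.

Lemma mollify_psi k : kernel k -> mollified L psi k (m1 psi k) (m2 psi k).
Proof. exact: (mollifyP L0 (repr_psi sol) (boundary_psi bnd)). Qed.

Lemma mollify_theta k : kernel k -> mollified L theta k (m1 theta k) (m2 theta k).
Proof. exact: (mollifyP L0 (class_theta sol) (boundary_theta bnd)). Qed.

Lemma mollify_P k : kernel k -> mollified L P k (m1 P k) (m2 P k).
Proof. exact: (mollifyP L0 (class_P sol) (boundary_P bnd)). Qed.

Lemma kernel_derive1 k : kernel k -> kernel (derive1 k).
Proof. exact: (test_derive1 (@J_itv R) (@J_neq0 R)). Qed.

Lemma pairing_dkernelE u k v : continuousL2 L u -> kernel k -> L2 v ->
  P_ u (dkernel k) v = - \int[leb]_(t in J) (inner (u t) v * derive1 k t).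
Proof.
move=> cu kk Lv; have i1 := integrable_pairing cu (kernel_derive1 kk) Lv.
rewrite -mulN1r -(RintegralZl (-1) (@measurable_J R) i1).
by apply: eq_Rintegral => t _; rewrite -[dkernel k t]/(-1 * derive1 k t) mulrCA.
Qed.

(** Time derivatives are moved to the kernel, so that the equations involve mollifications of [phi],
    [psi], [theta] and [P] alone. *)
Lemma pairing_dkernel u ut k v : continuousL2 L u -> is_time_deriv L u ut ->
  kernel k -> test v -> P_ ut k v = P_ u (dkernel k) v.
Proof.
move=> cu uut kk tv; rewrite (pairing_dkernelE cu kk (test_L2 tv)).
by rewrite (uut v k tv kk) opprK.
Qed.

Let cphi := repr_phi sol. Let cphit := repr_phit sol. Let cphitt := class_phitt sol.
Let cpsi := repr_psi sol. Let cth := class_theta sol. Let cP := class_P sol.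

Lemma pairing_phit k v : kernel k -> test v -> P_ phit k v = P_ phi (dkernel k) v.
Proof. exact: (pairing_dkernel cphi (deriv_phi sol)). Qed.

Lemma pairing_phitt k v : kernel k -> test v ->
  P_ phitt k v = P_ phi (dkernel (dkernel k)) v.
Proof.
move=> kk tv; rewrite (pairing_dkernel cphit (deriv_phit sol) kk tv).
exact: (pairing_phit (kernel_dkernel kk) tv).
Qed.

Lemma pairing_psit k v : kernel k -> test v -> P_ psit k v = P_ psi (dkernel k) v.
Proof. exact: (pairing_dkernel cpsi (deriv_psi sol)). Qed.

(** Unlike the other functions, [psit] is not given as continuous in time; weak measurability and
    the almost everywhere bound in [Linfty] take the place of continuity. *)
Lemma integrable_psit k v : kernel k -> test v ->
  leb.-integrable J (EFin \o (fun t => inner (psit t) v * k t)).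
Proof.
move=> kk tv; have Lv := test_L2 tv; have [mpsit [M hM]] := class_psit sol.
have mJ := @measurable_J R.
have mf : measurable_fun J (fun t => inner (psit t) v * k t).
  apply: measurable_funM; last exact: (continuous_J_measurable (kernel_continuous_J kk)).
  apply: measurable_funS (mpsit v Lv); first exact: measurable_itv.
  by move=> t; rewrite /= !in_itv/= !andbT; exact: ltW.
have c1 : continuous_J (cst 1 : R -> R) by move=> t _; exact: cvg_cst.
have ik : leb.-integrable J (EFin \o k).
  have := integrable_kernel c1 kk; rewrite (_ : (fun t => _) = k)//.
  by apply/funext => t; rewrite mul1r.
pose c := Num.sqrt (M * sq v).
have /integrableP[mg ig] := integrableZl mJ c (integrable_abse ik).
apply/integrableP; split; first exact/measurable_EFinP.
apply: le_lt_trans ig; apply: ae_ge0_le_integral => //.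
- by apply: measurableT_comp => //; exact/measurable_EFinP.
- exact: measurableT_comp.
apply: (@filterS _ _ (ae_filter_ringOfSetsType leb) _ _ _ hM) => t ht.
rewrite /= in_itv/= andbT => t0; have [[Lpt _] Mt] := ht (ltW t0).
rewrite lee_fin [leRHS]ger0_norm; last by rewrite mulr_ge0 ?sqrtr_ge0.
rewrite normrM ler_wpM2r//.
have h1 := cauchy_schwarz siL Lpt Lv.
have h2 : inner (psit t) v ^+ 2 <= M * sq v.
  by apply: le_trans h1 _; rewrite ler_wpM2r// sq_ge0.
by rewrite -sqrtr_sqr ler_wsqrtr.
Qed.

Lemma kernel_equation1 k chi : kernel k -> test chi ->
  rho1 * P_ phi (dkernel (dkernel k)) chi
  + kappa * (P_ psi k (derive1 chi) - P_ phi k (derive1n 2 chi))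
  + mu * P_ phi (dkernel k) chi = 0.
Proof.
move=> kk tc; have Lc := test_L2 tc; have Lc' := test_L2 (testD1 tc).
have Lc'' := test_L2 (testD1 (testD1 tc)).
rewrite -(pairing_phitt kk tc) -(pairing_phit kk tc) -[RHS](equation1 eqs tc kk).
pose s : seq (R * (R -> R)) := [:: (rho1, fun t => inner (phitt t) chi * k t);
      (kappa, fun t => inner (psi t) (derive1 chi) * k t);
      (- kappa, fun t => inner (phi t) (derive1n 2 chi) * k t);
      (mu, fun t => inner (phit t) chi * k t)].
have [_ E] := @lincombP _ _ _ leb J (@measurable_J R) s
  (conj (integrable_pairing cphitt kk Lc) (conj (integrable_pairing cpsi kk Lc')
  (conj (integrable_pairing cphi kk Lc'') (conj (integrable_pairing cphit kk Lc) Logic.I)))).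
transitivity (lincomb_integral leb J s); first by rewrite /s; unfold_lincomb; ring.
by rewrite -E; apply: eq_Rintegral => t _; rewrite /s; unfold_lincomb; ring.
Qed.

Lemma kernel_equation2 k chi : kernel k -> test chi ->
  rho2 * P_ phi (dkernel (dkernel k)) (derive1 chi)
  - alpha * P_ psi k (derive1n 2 chi)
  + kappa * (P_ psi k chi - P_ phi k (derive1 chi))
  + xi1 * P_ theta k (derive1 chi) + xi2 * P_ P k (derive1 chi) = 0.
Proof.
move=> kk tc; have Lc := test_L2 tc; have Lc' := test_L2 (testD1 tc).
have Lc'' := test_L2 (testD1 (testD1 tc)).
rewrite -(pairing_phitt kk (testD1 tc)) -[RHS](equation2 eqs tc kk).
pose s : seq (R * (R -> R)) := [:: (rho2, fun t => inner (phitt t) (derive1 chi) * k t);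
      (- alpha, fun t => inner (psi t) (derive1n 2 chi) * k t);
      (kappa, fun t => inner (psi t) chi * k t);
      (- kappa, fun t => inner (phi t) (derive1 chi) * k t);
      (xi1, fun t => inner (theta t) (derive1 chi) * k t);
      (xi2, fun t => inner (P t) (derive1 chi) * k t)].
have [_ E] := @lincombP _ _ _ leb J (@measurable_J R) s
  (conj (integrable_pairing cphitt kk Lc') (conj (integrable_pairing cpsi kk Lc'')
  (conj (integrable_pairing cpsi kk Lc) (conj (integrable_pairing cphi kk Lc')
  (conj (integrable_pairing cth kk Lc') (conj (integrable_pairing cP kk Lc') Logic.I)))))).
transitivity (lincomb_integral leb J s); first by rewrite /s; unfold_lincomb; ring.
by rewrite -E; apply: eq_Rintegral => t _; rewrite /s; unfold_lincomb; ring.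
Qed.

(** The third and fourth equations have the same form with [theta] and [P] exchanged, hence the free
    coefficients and functions. *)
Lemma kernel_equation34 a b c e (u1 u2 : R -> R -> R) k chi :
  continuousL2 L u1 -> continuousL2 L u2 -> kernel k -> test chi ->
  \int[leb]_(t in J) (- (a * inner (u1 t) chi + b * inner (u2 t) chi) * derive1 k t
     + (c * inner (psit t) (derive1 chi) - e * inner (u1 t) (derive1n 2 chi)) * k t) = 0 ->
  a * P_ u1 (dkernel k) chi + b * P_ u2 (dkernel k) chi
  + c * P_ psi (dkernel k) (derive1 chi) - e * P_ u1 k (derive1n 2 chi) = 0.
Proof.
move=> cu1 cu2 kk tc eq0; have Lc := test_L2 tc; have tc' := testD1 tc.
have Lc'' := test_L2 (testD1 (testD1 tc)); have kk' := kernel_derive1 kk.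
rewrite -(pairing_psit kk tc') !pairing_dkernelE// -[RHS]eq0.
pose s : seq (R * (R -> R)) := [:: (- a, fun t => inner (u1 t) chi * derive1 k t);
      (- b, fun t => inner (u2 t) chi * derive1 k t);
      (c, fun t => inner (psit t) (derive1 chi) * k t);
      (- e, fun t => inner (u1 t) (derive1n 2 chi) * k t)].
have [_ E] := @lincombP _ _ _ leb J (@measurable_J R) s
  (conj (integrable_pairing cu1 kk' Lc) (conj (integrable_pairing cu2 kk' Lc)
  (conj (integrable_psit kk tc') (conj (integrable_pairing cu1 kk Lc'') Logic.I)))).
pose A := \int[leb]_(t in J) (inner (u1 t) chi * derive1 k t).
pose B := \int[leb]_(t in J) (inner (u2 t) chi * derive1 k t).
pose C := P_ psit k (derive1 chi); pose D := P_ u1 k (derive1n 2 chi).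
have {}E : \int[leb]_(t in J) lincomb s t = - a * A + (- b * B + (c * C + (- e * D + 0))).
  exact: E.
transitivity (- a * A + (- b * B + (c * C + (- e * D + 0)))).
  rewrite -/A -/B -/C -/D; move: A B C D {E} => A B C D; ring.
refine (etrans (esym E) _); apply: eq_Rintegral => t _.
pose x := inner (u1 t) chi; pose y := inner (u2 t) chi.
pose z := inner (psit t) (derive1 chi); pose w := inner (u1 t) (derive1n 2 chi).
transitivity (- a * (x * derive1 k t) + (- b * (y * derive1 k t) +
  (c * (z * k t) + (- e * (w * k t) + 0)))); first exact: erefl.
transitivity (- (a * x + b * y) * derive1 k t + (c * z - e * w) * k t); last exact: erefl.
by move: x y z w (derive1 k t) (k t) => x y z w k1 k2; ring.
Qed.

(* Unification must not compare distinct mollifications by unfolding them. *)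
Opaque mollify dkernel Defs.inner time_pairing.

Lemma mollified_derive2 u k chi : mollified L u k (m1 u k) (m2 u k) -> test chi ->
  P_ u k (derive1n 2 chi) = - inner (m2 u k) (derive1 chi).
Proof.
move=> [hu uP] tc; have tc' := testD1 tc; have tc'' := testD1 tc'.
rewrite -(uP _ tc''); exact: (H0pair_skew L0 hu (test_H0pair L0 tc')).
Qed.

Lemma mollified_derive1 u k chi : mollified L u k (m1 u k) (m2 u k) -> test chi ->
  P_ u k (derive1 chi) = - inner (m2 u k) chi.
Proof.
move=> [hu uP] tc; have tc' := testD1 tc.
rewrite -(uP _ tc'); exact: (H0pair_skew L0 hu (test_H0pair L0 tc)).
Qed.

(** Weak equations may be tested with elements of H^1_0, in particular with the mollified functions
    themselves. The second equation has this many terms. *)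
Lemma H0pair_eq6 (a b c1 c2 c3 c4 : R) x1 x2 y1 y2 y3 y4 v g :
  L2 x1 -> L2 x2 -> L2 y1 -> L2 y2 -> L2 y3 -> L2 y4 ->
  (forall chi, test chi -> a * inner x1 chi + b * inner x2 chi
    + c1 * inner y1 (derive1 chi) + c2 * inner y2 (derive1 chi)
    + c3 * inner y3 (derive1 chi) + c4 * inner y4 (derive1 chi) = 0) ->
  H0pair v g ->
  a * inner x1 v + b * inner x2 v
    + c1 * inner y1 g + c2 * inner y2 g + c3 * inner y3 g + c4 * inner y4 g = 0.
Proof.
move=> Lx1 Lx2 Ly1 Ly2 Ly3 Ly4 eq0 hv; have [Lv Lg _] := hv.
have Lx := siD siL (siZ siL a Lx1) (siZ siL b Lx2).
have Ly := siD siL (siZ siL c1 Ly1) (siZ siL c2 Ly2).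
have Lz := siD siL (siZ siL c3 Ly3) (siZ siL c4 Ly4).
have E x y z c c' : L2 x -> L2 y -> L2 z ->
    inner (c *: x + c' *: y) z = c * inner x z + c' * inner y z.
  move=> Lx_ Ly_ Lz_; rewrite (aDl siL (siZ siL c Lx_) (siZ siL c' Ly_) Lz_).
  by rewrite (aZl siL c Lx_ Lz_) (aZl siL c' Ly_ Lz_).
have sum0 : inner (a *: x1 + b *: x2) v
    + inner (c1 *: y1 + c2 *: y2 + (c3 *: y3 + c4 *: y4)) g = 0.
  apply: (H0pair_eq L0 Lx (siD siL Ly Lz) _ hv) => chi tc; rewrite -[RHS](eq0 _ tc).
  have Lc := test_L2 tc; have Lc' := test_L2 (testD1 tc).
  rewrite (aDl siL Ly Lz Lc') (E _ _ _ _ _ Lx1 Lx2 Lc) (E _ _ _ _ _ Ly1 Ly2 Lc').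
  by rewrite (E _ _ _ _ _ Ly3 Ly4 Lc') !addrA.
rewrite -[RHS]sum0 (aDl siL Ly Lz Lg) (E _ _ _ _ _ Lx1 Lx2 Lv) (E _ _ _ _ _ Ly1 Ly2 Lg).
by rewrite (E _ _ _ _ _ Ly3 Ly4 Lg) !addrA.
Qed.

Lemma H0pair_eq4 (a b c1 c2 : R) x1 x2 y1 y2 v g :
  L2 x1 -> L2 x2 -> L2 y1 -> L2 y2 ->
  (forall chi, test chi -> a * inner x1 chi + b * inner x2 chi
    + c1 * inner y1 (derive1 chi) + c2 * inner y2 (derive1 chi) = 0) ->
  H0pair v g ->
  a * inner x1 v + b * inner x2 v + c1 * inner y1 g + c2 * inner y2 g = 0.
Proof.
move=> Lx1 Lx2 Ly1 Ly2 eq0 hv.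
have := @H0pair_eq6 a b c1 c2 0 0 _ _ _ _ _ _ v g Lx1 Lx2 Ly1 Ly2 Ly1 Ly2 _ hv.
by rewrite !mul0r !addr0; apply=> chi tc; rewrite !mul0r !addr0 eq0.
Qed.

Lemma mollified_equation1 k v g : kernel k -> H0pair v g ->
  rho1 * inner (m1 phi (dkernel (dkernel k))) v + mu * inner (m1 phi (dkernel k)) v
  + kappa * inner (m1 psi k) g + kappa * inner (m2 phi k) g = 0.
Proof.
move=> kk; have kk1 := kernel_dkernel kk; have kk2 := kernel_dkernel kk1.
have M0 := mollify_phi kk; have M1 := mollify_phi kk1; have M2 := mollify_phi kk2.
have N0 := mollify_psi kk.
have [[_ L1' _] P0] := M0; have [[L2_ _ _] P1] := M1; have [[L3 _ _] P2] := M2.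
have [[L4 _ _] Q0] := N0.
apply: (H0pair_eq4 L3 L2_ L4 L1') => chi tc.
have alg (A B C D pA pB pC pD : R) : A = pA -> B = pB -> C = pC -> pD = - D ->
    rho1 * pA + kappa * (pC - pD) + mu * pB = 0 ->
    rho1 * A + mu * B + kappa * C + kappa * D = 0 by move=> -> -> -> -> <-; ring.
exact: (alg _ _ _ _ _ _ _ _ (P2 _ tc) (P1 _ tc) (Q0 _ (testD1 tc))
  (mollified_derive2 M0 tc) (kernel_equation1 kk tc)).
Qed.

Lemma mollified_equation2 k v g : kernel k -> H0pair v g ->
  kappa * inner (m1 psi k) v + kappa * inner (m2 phi k) v
  + rho2 * inner (m1 phi (dkernel (dkernel k))) g + alpha * inner (m2 psi k) g
  + xi1 * inner (m1 theta k) g + xi2 * inner (m1 P k) g = 0.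
Proof.
move=> kk; have kk1 := kernel_dkernel kk; have kk2 := kernel_dkernel kk1.
have M0 := mollify_phi kk; have M2 := mollify_phi kk2; have N0 := mollify_psi kk.
have T0 := mollify_theta kk; have S0 := mollify_P kk.
have [[_ L1' _] P0] := M0; have [[L3 _ _] P2] := M2.
have [[L4 L4' _] Q0] := N0; have [[L5 _ _] T0P] := T0; have [[L6 _ _] S0P] := S0.
apply: (H0pair_eq6 L4 L1' L3 L4' L5 L6) => chi tc.
have alg (A B C D E F pA pB pC pD pE pF : R) : A = pA -> pB = - B -> C = pC ->
    pD = - D -> E = pE -> F = pF ->
    rho2 * pC - alpha * pD + kappa * (pA - pB) + xi1 * pE + xi2 * pF = 0 ->
    kappa * A + kappa * B + rho2 * C + alpha * D + xi1 * E + xi2 * F = 0.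
  by move=> -> -> -> -> -> -> <-; ring.
exact: (alg _ _ _ _ _ _ _ _ _ _ _ _ (Q0 _ tc) (mollified_derive1 M0 tc)
  (P2 _ (testD1 tc)) (mollified_derive2 N0 tc) (T0P _ (testD1 tc)) (S0P _ (testD1 tc))
  (kernel_equation2 kk tc)).
Qed.

Lemma mollified_equation34 a b c e (u1 u2 : R -> R -> R) k v g :
  continuousL2 L u1 -> continuousL2 L u2 -> zero_boundary L u1 -> zero_boundary L u2 ->
  (forall chi, test chi -> \int[leb]_(t in J)
    (- (a * inner (u1 t) chi + b * inner (u2 t) chi) * derive1 k t
     + (c * inner (psit t) (derive1 chi) - e * inner (u1 t) (derive1n 2 chi)) * k t) = 0) ->
  kernel k -> H0pair v g ->
  a * inner (m1 u1 (dkernel k)) v + b * inner (m1 u2 (dkernel k)) v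
  + c * inner (m1 psi (dkernel k)) g + e * inner (m2 u1 k) g = 0.
Proof.
move=> cu1 cu2 zu1 zu2 eq0 kk; have kk1 := kernel_dkernel kk.
have M0 := mollifyP L0 cu1 zu1 kk; have M1 := mollifyP L0 cu1 zu1 kk1.
have N1 := mollifyP L0 cu2 zu2 kk1; have S1 := mollify_psi kk1.
have [[_ L1' _] P0] := M0; have [[L3 _ _] P1] := M1.
have [[L4 _ _] Q1] := N1; have [[L5 _ _] S1P] := S1.
apply: (H0pair_eq4 L3 L4 L5 L1') => chi tc.
have alg (A B C D pA pB pC pD : R) : A = pA -> B = pB -> C = pC -> pD = - D ->
    a * pA + b * pB + c * pC - e * pD = 0 ->
    a * A + b * B + c * C + e * D = 0 by move=> -> -> -> -> <-; ring.
exact: (alg _ _ _ _ _ _ _ _ (P1 _ tc) (Q1 _ tc) (S1P _ (testD1 tc))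
  (mollified_derive2 M0 tc) (kernel_equation34 cu1 cu2 kk tc (eq0 _ tc))).
Qed.

Lemma mollified_equation3 k v g : kernel k -> H0pair v g ->
  tau0 * inner (m1 theta (dkernel k)) v + d * inner (m1 P (dkernel k)) v
  + xi1 * inner (m1 psi (dkernel k)) g + delta * inner (m2 theta k) g = 0.
Proof.
move=> kk hv; exact: (mollified_equation34 cth cP (boundary_theta bnd) (boundary_P bnd)
  (fun chi tc => equation3 eqs tc kk) kk hv).
Qed.

Lemma mollified_equation4 k v g : kernel k -> H0pair v g ->
  r * inner (m1 P (dkernel k)) v + d * inner (m1 theta (dkernel k)) v
  + xi2 * inner (m1 psi (dkernel k)) g + h * inner (m2 P k) g = 0.
Proof.
move=> kk hv.
have eq0 chi : test chi -> \int[leb]_(t in J)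
    (- (r * inner (P t) chi + d * inner (theta t) chi) * derive1 k t
     + (xi2 * inner (psit t) (derive1 chi) - h * inner (P t) (derive1n 2 chi)) * k t) = 0.
  move=> tc; refine (etrans _ (equation4 eqs tc kk)).
  by apply: eq_Rintegral => t _; rewrite [r * _ + _]addrC.
exact: (mollified_equation34 cP cth (boundary_P bnd) (boundary_theta bnd) eq0 kk hv).
Qed.

End Equations.

(** * Algebraic identities behind the energy and cross-term derivatives *)

(** Products are named by their factors: [f] is phi, [p] is psi, [th] is theta and [S] is P; the
    digit counts time derivatives and a prime marks the x-derivative. The multipliers are phi_t in
    the first equation, psi_t in the second, [(rho2 / kappa) phi_tt] in the time derivative of the
    first, theta in the third and P in the fourth. The skew relations cancel the coupling terms. *)
Lemma energy_balance (R : realType) (rho1 rho2 kappa alpha delta h tau0 r mu d xi1 xi2 : R)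
  (f1f1 f1f2 f2f3 f2f2 p0f1' f0'f1' f0'p1 p0p1 f2p1' p0'p1' thp1' Sp1' p1f2' f1'f2'
   thth1 thS1 th1S SS1 p1th' p1S' th'th' S'S' : R) : kappa != 0 ->
  rho1 * f1f2 + mu * f1f1 + kappa * p0f1' + kappa * f0'f1' = 0 ->
  kappa * p0p1 + kappa * f0'p1 + rho2 * f2p1' + alpha * p0'p1' + xi1 * thp1' + xi2 * Sp1' = 0 ->
  rho1 * f2f3 + mu * f2f2 + kappa * p1f2' + kappa * f1'f2' = 0 ->
  tau0 * thth1 + d * thS1 + xi1 * p1th' + delta * th'th' = 0 ->
  r * SS1 + d * th1S + xi2 * p1S' + h * S'S' = 0 ->
  f2p1' = - p1f2' -> p1th' = - thp1' -> p1S' = - Sp1' ->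
  rho1 * (2 * f1f2) + alpha * (2 * p0'p1')
  + kappa * (2 * f0'f1' + 2 * (p0f1' + f0'p1) + 2 * p0p1)
  + rho1 * rho2 / kappa * (2 * f2f3) + rho2 * (2 * f1'f2')
  + (tau0 * (2 * thth1) + r * (2 * SS1) + 2 * d * (th1S + thS1))
  = - (2 * dissipation rho2 kappa delta h mu f1f1 f2f2 th'th' S'S').
Proof.
move=> k0 e1 e2 e3 e4 e5 s1 s2 s3; rewrite s1 s2 s3 in e2 e4 e5.
apply/eqP; rewrite -subr_eq0; apply/eqP.
transitivity (2 * (rho1 * f1f2 + mu * f1f1 + kappa * p0f1' + kappa * f0'f1')
  + 2 * (kappa * p0p1 + kappa * f0'p1 + rho2 * - p1f2' + alpha * p0'p1' + xi1 * thp1' + xi2 * Sp1')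
  + 2 * rho2 / kappa * (rho1 * f2f3 + mu * f2f2 + kappa * p1f2' + kappa * f1'f2')
  + 2 * (tau0 * thth1 + d * thS1 + xi1 * - thp1' + delta * th'th')
  + 2 * (r * SS1 + d * th1S + xi2 * - Sp1' + h * S'S')).
  by rewrite /dissipation; field.
by rewrite e1 e2 e3 e4 e5 !mulr0 !addr0.
Qed.

(** The first equation tested with phi plus the second tested with psi, where |phi_x + psi|^2 is
    expanded as [p + 2 * q + z]. *)
Lemma static_balance (R : realType) (rho1 rho2 kappa alpha mu xi1 xi2 : R)
  (x4 x5 q p x1 b x2 x3 z : R) :
  rho1 * x4 + mu * x5 + kappa * q + kappa * p = 0 ->
  kappa * z + kappa * q + rho2 * x1 + alpha * b + xi1 * x2 + xi2 * x3 = 0 ->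
  alpha * b + kappa * (p + 2 * q + z)
    = - rho2 * x1 + - xi1 * x2 + - xi2 * x3 + - rho1 * x4 + - mu * x5.
Proof. by move=> h1 h2; lra. Qed.

(** With the hypothesis |phi_x + 2 psi|^2 >= 0, this gives |phi_x|^2 <= 2 |phi_x + psi|^2 + 2
    |psi|^2. *)
Lemma quad_alg (R : realType) (x y z : R) : 0 <= x + 2 * 2 * y + 2 ^+ 2 * z ->
  x <= 2 * (x + 2 * y + z) + 2 * z.
Proof. lra. Qed.

(** The time derivative of the first equation tested with phi_t. Integrating <psi_t, phi_tx> by
    parts matches it with the derivative of <psi_x, phi_t>. *)
Lemma cross_balance (R : realType) (rho1 kappa mu : R)
  (f3f1 f2f1 p1f1' f1'f1' f2f2 p0'f2 p1'f1 : R) :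
  rho1 * f3f1 + mu * f2f1 + kappa * p1f1' + kappa * f1'f1' = 0 -> p1f1' = - p1'f1 ->
  rho1 * (f3f1 + f2f2) - kappa * (p1'f1 + p0'f2)
  = - kappa * f1'f1' - mu * f2f1 + rho1 * f2f2 - kappa * p0'f2.
Proof. by move=> h e; rewrite e in h; lra. Qed.

Lemma is_derive_total (R : realType) (rho1 rho2 kappa alpha tau0 r d t : R)
  (a1 a2 b s f T S m : R -> R) (da1 da2 db ds df dT dS dm : R) :
  is_derive t 1 a1 da1 -> is_derive t 1 a2 da2 -> is_derive t 1 b db ->
  is_derive t 1 s ds -> is_derive t 1 f df -> is_derive t 1 T dT ->
  is_derive t 1 S dS -> is_derive t 1 m dm ->
  is_derive t 1 (fun x => total rho1 rho2 kappa alpha tau0 r d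
    (a1 x) (a2 x) (b x) (s x) (f x) (T x) (S x) (m x))
  (rho1 * da1 + alpha * db + kappa * ds + rho1 * rho2 / kappa * da2 + rho2 * df
   + (tau0 * dT + r * dS + 2 * d * dm)).
Proof.
move=> h1 h2 h3 h4 h5 h6 h7 h8.
have Z c (g : R -> R) dg : is_derive t 1 g dg -> is_derive t 1 (fun x => c * g x) (c * dg).
  by move=> ?; exact: is_deriveZ.
have D (g k : R -> R) dg dk_ : is_derive t 1 g dg -> is_derive t 1 k dk_ ->
    is_derive t 1 (fun x => g x + k x) (dg + dk_).
  by move=> ? ?; exact: is_deriveD.
exact: (D _ _ _ _ (D _ _ _ _ (D _ _ _ _ (D _ _ _ _ (D _ _ _ _ (Z rho1 _ _ h1)
  (Z alpha _ _ h3)) (Z kappa _ _ h4)) (Z _ _ _ h2)) (Z rho2 _ _ h5))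
  (D _ _ _ _ (D _ _ _ _ (Z tau0 _ _ h6) (Z r _ _ h7)) (Z (2 * d) _ _ h8))).
Qed.

Lemma is_derive_congr (R : realType) (f : R -> R) (t a b : R) :
  is_derive t 1 f a -> a = b -> is_derive t 1 f b.
Proof. by move=> h <-. Qed.

(** * Exponential decay of the mollified energy *)

Section Decay.
Variable R : realType.
Variables (rho1 rho2 kappa alpha delta h tau0 r mu L d xi1 xi2 : R).
Hypothesis L0 : 0 < L.
Variables (phi phit phitt psi psit theta P : R -> R -> R).
Hypotheses (sol : solution_class L phi phit phitt psi psit theta P)
  (eqs : equations rho1 rho2 kappa alpha delta h tau0 r mu L d xi1 xi2
    phi phit phitt psi psit theta P)
  (bnd : boundary_conditions L phi psi theta P).
Local Notation J := (`]0, +oo[%classic : set R).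
Local Notation kernel := (test_function J).
Local Notation inner := (inner L).
Local Notation L2 := (L2 L).
Local Notation siL := (L2_semi_inner L).
Local Notation H0pair := (H0pair L).
Local Notation m1 u k := (mollify L u k).1.
Local Notation m2 u k := (mollify L u k).2.
Local Notation dk := dkernel.
Implicit Types (k eta : R -> R) (u : R -> R -> R).

Lemma dkernel_tshift eta t : kernel eta -> dk (tshift eta t) = tshift (dk eta) t.
Proof.
move=> ke; rewrite /dkernel (derive1_tshift t (test_smooth ke)).
by apply/funext => s.
Qed.

Variable eta : R -> R.
Hypothesis keta : kernel eta.
Let k1 := kernel_dkernel keta.
Let k2 := kernel_dkernel k1.

Definition snap_b t := inner (m2 psi (tshift eta t)) (m2 psi (tshift eta t)).
Definition snap_s t := inner (m2 phi (tshift eta t)) (m2 phi (tshift eta t))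
  + 2 * inner (m2 phi (tshift eta t)) (m1 psi (tshift eta t))
  + inner (m1 psi (tshift eta t)) (m1 psi (tshift eta t)).
Definition snap_a1 t := inner (m1 phi (tshift (dk eta) t)) (m1 phi (tshift (dk eta) t)).
Definition snap_a2 t := inner (m1 phi (tshift (dk (dk eta)) t)) (m1 phi (tshift (dk (dk eta)) t)).
Definition snap_f t := inner (m2 phi (tshift (dk eta) t)) (m2 phi (tshift (dk eta) t)).
Definition snap_T t := inner (m1 theta (tshift eta t)) (m1 theta (tshift eta t)).
Definition snap_S t := inner (m1 P (tshift eta t)) (m1 P (tshift eta t)).
Definition snap_TS t := inner (m1 theta (tshift eta t)) (m1 P (tshift eta t)).
Definition snap_p t := inner (m2 phi (tshift eta t)) (m2 phi (tshift eta t)).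
Definition snap_z t := inner (m1 psi (tshift eta t)) (m1 psi (tshift eta t)).
Definition snap_x1 t := inner (m1 phi (tshift (dk (dk eta)) t)) (m2 psi (tshift eta t)).
Definition snap_x6 t := inner (m1 phi (tshift (dk (dk eta)) t)) (m1 phi (tshift (dk eta) t)).
Definition snap_x8 t := inner (m2 psi (tshift eta t)) (m1 phi (tshift (dk eta) t)).

Definition mollified_energy t := total rho1 rho2 kappa alpha tau0 r d (snap_a1 t)
  (snap_a2 t) (snap_b t) (snap_s t) (snap_f t) (snap_T t) (snap_S t) (snap_TS t).
Definition mollified_cross t := rho1 * snap_x6 t - kappa * snap_x8 t.
Definition mollified_dissipation t := dissipation rho2 kappa delta h mu (snap_a1 t) (snap_a2 t)
  (inner (m2 theta (tshift eta t)) (m2 theta (tshift eta t)))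
  (inner (m2 P (tshift eta t)) (m2 P (tshift eta t))).

Let cphi := repr_phi sol. Let cpsi := repr_psi sol.
Let cth := class_theta sol. Let cP := class_P sol.
Let zphi := boundary_phi bnd. Let zpsi := boundary_psi bnd.
Let zth := boundary_theta bnd. Let zP := boundary_P bnd.

Let shk t k : 0 <= t -> kernel k -> kernel (tshift k t).
Proof. by move=> t0 kk; exact: tshift_kernel_ge0. Qed.

Opaque mollify dkernel Defs.inner time_pairing tshift.

(** The quantities left existential enter the static estimate only, not the functional or its
    derivative. *)
Lemma mollified_snapshot t : 0 <= t -> exists e0 x2 x3 x4 x5,
  snapshot rho1 rho2 kappa alpha mu (4 * L ^+ 2) xi1 xi2
    (snap_a1 t) (snap_a2 t) (snap_b t) (snap_s t) (snap_f t) (snap_T t) (snap_S t) (snap_TS t)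
    (inner (m2 theta (tshift eta t)) (m2 theta (tshift eta t)))
    (inner (m2 P (tshift eta t)) (m2 P (tshift eta t)))
    (snap_p t) (snap_z t) e0 (snap_x1 t) x2 x3 x4 x5 (snap_x6 t) (snap_x8 t).
Proof.
move=> t0; have kt := shk t0 keta; have kt1 := shk t0 k1; have kt2 := shk t0 k2.
have [hf0 _] := mollify_phi L0 sol bnd kt; have [hf1 _] := mollify_phi L0 sol bnd kt1.
have [hf2 _] := mollify_phi L0 sol bnd kt2; have [hp0 _] := mollify_psi L0 sol bnd kt.
have [hth _] := mollify_theta L0 sol bnd kt; have [hS _] := mollify_P L0 sol bnd kt.
have [Lf0 Lf0' _] := hf0; have [Lf1 Lf1' _] := hf1; have [Lf2 _ _] := hf2.
have [Lp0 Lp0' _] := hp0; have [Lth Lth' _] := hth; have [LS LS' _] := hS.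
have e6 := mollified_equation1 L0 sol eqs bnd kt hf0.
have e7 := mollified_equation2 L0 sol eqs bnd kt hp0.
rewrite (dkernel_tshift t keta) (dkernel_tshift t k1) in e6 e7.
have ge0 w : L2 w -> 0 <= inner w w by move=> _; exact: sq_ge0.
have cs v w : L2 v -> L2 w -> inner v w ^+ 2 <= inner v v * inner w w.
  by move=> Lv Lw; exact: (cauchy_schwarz siL Lv Lw).
have sD c := sqD siL c Lf0' Lp0.
have sDge c : 0 <= inner (m2 phi (tshift eta t) + c *: m1 psi (tshift eta t))
    (m2 phi (tshift eta t) + c *: m1 psi (tshift eta t)).
  exact: sq_ge0.
have sym1 := semi_inner_sym siL Lp0 Lf0'.
exists (inner (m1 phi (tshift eta t)) (m1 phi (tshift eta t))),
  (inner (m1 theta (tshift eta t)) (m2 psi (tshift eta t))),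
  (inner (m1 P (tshift eta t)) (m2 psi (tshift eta t))),
  (inner (m1 phi (tshift (dk (dk eta)) t)) (m1 phi (tshift eta t))),
  (inner (m1 phi (tshift (dk eta) t)) (m1 phi (tshift eta t))).
split.
- split; [exact: ge0|exact: ge0|exact: ge0| |exact: ge0].
  by have := sDge 1; rewrite sD mulr1 expr1n mul1r.
- by split; exact: ge0.
- split; [exact: (H0pair_poincare L0 hth)|exact: (H0pair_poincare L0 hS)
    |exact: (H0pair_poincare L0 hp0)|exact: (H0pair_poincare L0 hf0)|].
  have := sDge 2; rewrite sD /snap_s.
  exact: quad_alg.
- by split; exact: ge0.
- exact: cs.
- by rewrite /snap_x1 mulrC; exact: cs.
- by rewrite mulrC; exact: cs.
- by rewrite mulrC; exact: cs.
- by rewrite mulrC; exact: cs.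
- by rewrite mulrC; exact: cs.
- by rewrite /snap_x6 mulrC; exact: cs.
- exact: cs.
- rewrite sym1 in e6.
  exact: (static_balance e6 e7).
Qed.

(** This and [is_derive_sq_r] differ in the order of the factors; each matches the order in which a
    tested equation produces the product. *)
Lemma is_derive_sq_l X t dX : L2_derivative L X t dX ->
  is_derive t 1 (fun x => inner (X x) (X x)) (2 * inner dX (X t)).
Proof.
move=> dXt; apply: (is_derive_congr (is_derive_inner dXt dXt)).
have [C [e [e0 LdX hX]]] := dXt.
have LXt : L2 (X t) by rewrite -[t]addr0; apply: (hX 0 _).1; rewrite normr0.
by rewrite (semi_inner_sym siL LXt LdX) mulr_natl mulr2n.
Qed.

Lemma is_derive_sq_r X t dX : L2_derivative L X t dX ->
  is_derive t 1 (fun x => inner (X x) (X x)) (2 * inner (X t) dX).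
Proof.
move=> dXt; apply: (is_derive_congr (is_derive_sq_l dXt)); congr (_ * _).
have [C [e [e0 LdX hX]]] := dXt.
have LXt : L2 (X t) by rewrite -[t]addr0; apply: (hX 0 _).1; rewrite normr0.
exact: (semi_inner_sym siL LdX LXt).
Qed.

Hypothesis kappa_neq0 : kappa != 0.

Lemma mollified_energy_derive (t : R) : 0 <= t ->
  is_derive t 1 mollified_energy (- (2 * mollified_dissipation t)).
Proof.
move=> t0; have kt := shk t0 keta; have kt1 := shk t0 k1; have kt2 := shk t0 k2.
have [hf0 _] := mollify_phi L0 sol bnd kt; have [hf1 _] := mollify_phi L0 sol bnd kt1.
have [hf2 _] := mollify_phi L0 sol bnd kt2; have [hp0 _] := mollify_psi L0 sol bnd kt.
have [hp1 _] := mollify_psi L0 sol bnd kt1.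
have [hth _] := mollify_theta L0 sol bnd kt; have [hS _] := mollify_P L0 sol bnd kt.
have [hS1 _] := mollify_P L0 sol bnd kt1.
have [Lf0 Lf0' _] := hf0; have [Lf1 Lf1' _] := hf1; have [Lf2 Lf2' _] := hf2.
have [Lp0 Lp0' _] := hp0; have [Lp1 Lp1' _] := hp1.
have [Lth Lth' _] := hth; have [LS LS' _] := hS; have [LS1 _ _] := hS1.
have e1 := mollified_equation1 L0 sol eqs bnd kt hf1.
have e2 := mollified_equation2 L0 sol eqs bnd kt hp1.
(* With the kernel of the time derivative, the first equation becomes its own time derivative; it is
   tested with phi_tt. *)
have e3 := mollified_equation1 L0 sol eqs bnd kt1 hf2.
have e4 := mollified_equation3 L0 sol eqs bnd kt hth.
have e5 := mollified_equation4 L0 sol eqs bnd kt hS.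
rewrite (dkernel_tshift t keta) (dkernel_tshift t k1) in e1.
rewrite (dkernel_tshift t keta) (dkernel_tshift t k1) in e2.
rewrite (dkernel_tshift t k1) (dkernel_tshift t k2) in e3.
rewrite (dkernel_tshift t keta) in e4.
rewrite (dkernel_tshift t keta) in e5.
have s1 := H0pair_skew L0 hf2 hp1; rewrite (semi_inner_sym siL Lf2' Lp1) in s1.
have s2 := H0pair_skew L0 hp1 hth; rewrite (semi_inner_sym siL Lp1' Lth) in s2.
have s3 := H0pair_skew L0 hp1 hS; rewrite (semi_inner_sym siL Lp1' LS) in s3.
have [df0 df0'] := mollify_L2_derivative L0 cphi zphi keta t0.
have [df1 df1'] := mollify_L2_derivative L0 cphi zphi k1 t0.
have [df2 df2'] := mollify_L2_derivative L0 cphi zphi k2 t0.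
have [dp0 dp0'] := mollify_L2_derivative L0 cpsi zpsi keta t0.
have [dth dth'] := mollify_L2_derivative L0 cth zth keta t0.
have [dS dS'] := mollify_L2_derivative L0 cP zP keta t0.
have dq := is_derive_inner df0' dp0; rewrite (semi_inner_sym siL Lf1' Lp0) in dq.
have dm := is_derive_inner dth dS; rewrite (semi_inner_sym siL Lth LS1) in dm.
have ds : is_derive t 1 snap_s (2 * inner (m2 phi (tshift eta t)) (m2 phi (tshift (dk eta) t))
    + 2 * (inner (m1 psi (tshift eta t)) (m2 phi (tshift (dk eta) t))
      + inner (m2 phi (tshift eta t)) (m1 psi (tshift (dk eta) t)))
    + 2 * inner (m1 psi (tshift eta t)) (m1 psi (tshift (dk eta) t))).
  have h1 := is_derive_sq_r df0'; have h2 := is_derive_sq_r dp0.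
  have h3 : is_derive t 1 (fun x => 2 * inner (m2 phi (tshift eta x)) (m1 psi (tshift eta x)))
    (2 * (inner (m1 psi (tshift eta t)) (m2 phi (tshift (dk eta) t))
      + inner (m2 phi (tshift eta t)) (m1 psi (tshift (dk eta) t)))).
    exact: (@is_deriveZ _ _ _ _ 2 _ _ _ dq).
  have h4 := @is_deriveD _ _ _ _ _ _ _ _ _ h1 h3.
  exact: (@is_deriveD _ _ _ _ _ _ _ _ _ h4 h2).
exact: (is_derive_congr (is_derive_total rho1 rho2 kappa alpha tau0 r d
  (is_derive_sq_l df1) (is_derive_sq_l df2) (is_derive_sq_r dp0') ds (is_derive_sq_r df1')
  (is_derive_sq_l dth) (is_derive_sq_l dS) dm)
  (energy_balance kappa_neq0 e1 e2 e3 e4 e5 s1 s2 s3)).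
Qed.

Lemma mollified_cross_derive (t : R) : 0 <= t -> is_derive t 1 mollified_cross
  (- kappa * snap_f t - mu * snap_x6 t + rho1 * snap_a2 t - kappa * snap_x1 t).
Proof.
move=> t0; have kt := shk t0 keta; have kt1 := shk t0 k1; have kt2 := shk t0 k2.
have [hf1 _] := mollify_phi L0 sol bnd kt1.
have [hf2 _] := mollify_phi L0 sol bnd kt2; have [hp0 _] := mollify_psi L0 sol bnd kt.
have [hp1 _] := mollify_psi L0 sol bnd kt1.
have [Lf2 _ _] := hf2; have [_ Lp0' _] := hp0.
have e8 := mollified_equation1 L0 sol eqs bnd kt1 hf1.
rewrite (dkernel_tshift t k1) (dkernel_tshift t k2) in e8.
have s5 := H0pair_skew L0 hp1 hf1.
have [df1 _] := mollify_L2_derivative L0 cphi zphi k1 t0.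
have [df2 _] := mollify_L2_derivative L0 cphi zphi k2 t0.
have [_ dp0'] := mollify_L2_derivative L0 cpsi zpsi keta t0.
have d6 := is_derive_inner df2 df1; have d8 := is_derive_inner dp0' df1.
rewrite (semi_inner_sym siL Lp0' Lf2) in d8.
have h1 := @is_deriveZ _ _ _ _ rho1 _ _ _ d6; have h2 := @is_deriveZ _ _ _ _ kappa _ _ _ d8.
exact: (is_derive_congr (@is_deriveB _ _ _ _ _ _ _ _ _ h1 h2) (cross_balance _ _ e8 s5)).
Qed.

Lemma mollified_energy_decay N l Q : 0 < N -> 0 < l -> 0 < Q ->
  (forall a1 a2 b s f T S m Th Pi p z e0 x1 x2 x3 x4 x5 x6 x8,
   snapshot rho1 rho2 kappa alpha mu (4 * L ^+ 2) xi1 xi2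
     a1 a2 b s f T S m Th Pi p z e0 x1 x2 x3 x4 x5 x6 x8 ->
   let W := total rho1 rho2 kappa alpha tau0 r d a1 a2 b s f T S m in
   let F := rho1 * x6 - kappa * x8 in
   [/\ W <= N * W + F, N * W + F <= Q * W &
     N * (- (2 * dissipation rho2 kappa delta h mu a1 a2 Th Pi)) +
       (- kappa * f - mu * x6 + rho1 * a2 - kappa * x1) <= - l * (N * W + F)]) ->
  forall t, 0 <= t -> mollified_energy t <= Q * mollified_energy 0 * expR (- l * t).
Proof.
move=> N0 l0 Q0 hyp t t0.
pose lyap s := N * mollified_energy s + mollified_cross s.
pose dlyap s := N * (- (2 * mollified_dissipation s)) +
  (- kappa * snap_f s - mu * snap_x6 s + rho1 * snap_a2 s - kappa * snap_x1 s).
have main s : 0 <= s -> [/\ mollified_energy s <= lyap s,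
    lyap s <= Q * mollified_energy s & dlyap s <= - l * lyap s].
  by move=> /mollified_snapshot[e0 [x2 [x3 [x4 [x5 snap]]]]];
    exact: (hyp _ _ _ _ _ _ _ _ _ _ _ _ _ _ _ _ _ _ _ _ snap).
have dl (s : R) : 0 <= s -> is_derive s (1 : R) lyap (dlyap s).
  move=> s0; have h1 := @is_deriveZ _ _ _ _ N _ _ _ (mollified_energy_derive s0).
  exact: (@is_deriveD _ _ _ _ _ _ _ _ _ h1 (mollified_cross_derive s0)).
have decay : lyap t <= lyap 0 * expR (- l * t).
  by apply: (exp_decay dl) => // s /main[].
have [h1 _ _] := main t t0; have [_ h2 _] := main 0 (lexx 0).
apply: (le_trans h1); apply: (le_trans decay).
by apply: ler_wpM2r => //; exact: expR_ge0.
Qed.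

End Decay.

(** * Bounds and limits by pairing with test functions *)

Lemma le_sum6 (R : realType) (a b c d e f : R) :
  0 <= a -> 0 <= b -> 0 <= c -> 0 <= d -> 0 <= e -> 0 <= f ->
  let s := a + b + c + d + e + f in
  [/\ a <= s, b <= s & c <= s] /\ [/\ d <= s, e <= s & f <= s].
Proof. by move=> ? ? ? ? ? ? s; rewrite /s; split; split; lra. Qed.

(** The norms controlled by the energy are exactly those to be passed to the limit; |phi_x|^2 and
    |psi|^2 come from Poincaré and the bound on |phi_x + psi|^2. *)
Lemma total_coercive (R : realType) (rho1 rho2 kappa alpha tau0 r mu K d xi1 xi2 : R)
  (rho1_gt0 : 0 < rho1) (rho2_gt0 : 0 < rho2) (kappa_gt0 : 0 < kappa)
  (alpha_gt0 : 0 < alpha) (tau0_gt0 : 0 < tau0) (r_gt0 : 0 < r) (K_ge0 : 0 <= K)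
  (det_gt0 : d ^+ 2 < tau0 * r) :
  exists2 c, 0 <= c & forall a1 a2 b s f T S m Th Pi p z e0 x1 x2 x3 x4 x5 x6 x8,
  snapshot rho1 rho2 kappa alpha mu K xi1 xi2
    a1 a2 b s f T S m Th Pi p z e0 x1 x2 x3 x4 x5 x6 x8 ->
  let W := total rho1 rho2 kappa alpha tau0 r d a1 a2 b s f T S m in
  [/\ a1 <= c * W, a2 <= c * W, b <= c * W & f <= c * W] /\
  [/\ T <= c * W, S <= c * W, p <= c * W & z <= c * W].
Proof.
have K2 : 1 <= 2 * (1 + K) by lra.
have [sg sg0 hsg] := quad_coercive tau0_gt0 r_gt0 det_gt0.
have rr0 : 0 < rho1 * rho2 / kappa by rewrite divr_gt0// mulr_gt0.
pose c1 := rho1^-1 + alpha^-1 + kappa^-1 + (rho1 * rho2 / kappa)^-1 + rho2^-1 + sg^-1.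
have i1 : 0 <= rho1^-1 by rewrite invr_ge0 ltW.
have i2 : 0 <= alpha^-1 by rewrite invr_ge0 ltW.
have i3 : 0 <= kappa^-1 by rewrite invr_ge0 ltW.
have i4 : 0 <= (rho1 * rho2 / kappa)^-1 by rewrite invr_ge0 ltW.
have i5 : 0 <= rho2^-1 by rewrite invr_ge0 ltW.
have i6 : 0 <= sg^-1 by rewrite invr_ge0 ltW.
have [[c1a c1b c1c] [c1d c1e c1f]] := le_sum6 i1 i2 i3 i4 i5 i6.
rewrite -/c1 in c1a c1b c1c c1d c1e c1f.
have c10 : 0 <= c1 := le_trans i1 c1a.
(* [c1] serves the terms present in [total]; the factor comes from [p <= 2 s + 2 z] and
   [z <= K b]. *)
pose c := 2 * (1 + K) * c1.
have c0 : 0 <= c by rewrite !mulr_ge0// addr_ge0.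
exists c => // a1 a2 b s f T S m Th Pi p z e0 x1 x2 x3 x4 x5 x6 x8 [].
move=> [a1_ge0 a2_ge0 b_ge0 s_ge0 f_ge0] [T_ge0 S_ge0 p_ge0 z_ge0 _]
  [_ _ zb _ psz] _ mTS _ _ _ _ _ _ _ _ W.
have TS := hsg _ _ _ T_ge0 S_ge0 mTS.
have sTS : 0 <= sg * (T + S) by rewrite mulr_ge0 ?addr_ge0// ltW.
have [[w1 w2 w3] [w4 w5 w6]] := le_sum6 (mulr_ge0 (ltW rho1_gt0) a1_ge0)
  (mulr_ge0 (ltW alpha_gt0) b_ge0) (mulr_ge0 (ltW kappa_gt0) s_ge0)
  (mulr_ge0 (ltW rr0) a2_ge0) (mulr_ge0 (ltW rho2_gt0) f_ge0) (le_trans sTS TS).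
rewrite -!/(total _ _ _ _ _ _ _ _ _ _ _ _ _ _ _) -/W in w1 w2 w3 w4 w5 w6.
have {TS w6}w6 : sg * (T + S) <= W := le_trans TS w6.
have W0 : 0 <= W := le_trans sTS w6.
have part (k x : R) : 0 < k -> k^-1 <= c1 -> k * x <= W -> x <= c1 * W.
  move=> k0 kc; rewrite mulrC -ler_pdivlMr// [X in _ <= X]mulrC => /le_trans; apply.
  by rewrite ler_wpM2r.
have c1W : 0 <= c1 * W by rewrite mulr_ge0.
have up x : x <= c1 * W -> x <= c * W.
  move=> /le_trans; apply; rewrite /c -[2 * _ * _ * _]mulrA.
  exact: ler_peMl.
have hb : b <= c1 * W by exact: part w2.
have hs : s <= c1 * W by exact: part w3.
have hTS : T + S <= c1 * W by exact: part w6.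
have hz : z <= K * (c1 * W) := le_trans zb (ler_wpM2l K_ge0 hb).
have E : c * W = 2 * (c1 * W) + 2 * (K * (c1 * W)) by rewrite /c; ring.
have KW : 0 <= K * (c1 * W) by rewrite mulr_ge0.
split; split.
- by apply: up; exact: part w1.
- by apply: up; exact: part w4.
- exact: up.
- by apply: up; exact: part w5.
- by apply: up; apply: le_trans hTS; rewrite lerDl.
- by apply: up; apply: le_trans hTS; rewrite lerDr.
- rewrite E; apply: (le_trans psz).
  exact: lerD (ler_wpM2l (ler0n R 2) hs) (ler_wpM2l (ler0n R 2) hz).
- rewrite E; move: (c1 * W) (K * _) hz c1W KW => q1 q2 hz q10 q20.
  by apply: (le_trans hz); rewrite -[leLHS]add0r lerD ?mulr_ge0// ler_peMl// ler1n.
Qed.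

Section TestBounds.
Variables (R : realType) (L : R).
Hypothesis L0 : 0 < L.
Local Notation leb := (@lebesgue_measure R).
Local Notation I := `]0, L[%classic.
Local Notation J := (`]0, +oo[%classic : set R).
Local Notation test := (test_function I).
Local Notation kernel := (test_function J).
Local Notation inner := (inner L).
Local Notation sq := (sqnormL2 L).
Local Notation L2 := (L2 L).
Local Notation siL := (L2_semi_inner L).
Local Notation P_ := (time_pairing L).
Let testD1 := test_derive1 (@I_itv R L) (I_neq0 L0).
Implicit Types (v w g chi k : R -> R) (u : R -> R -> R).

Lemma H1_dx v : H1 L v -> is_wderiv L v (dx L v).
Proof. by case=> g hg; rewrite /dx; apply: xgetPex; exists g. Qed.

Lemma dx_sq_le v B : 0 <= B -> L2 v ->
  (forall chi, test chi -> inner v (derive1 chi) ^+ 2 <= B * sq chi) ->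
  L2 (dx L v) /\ sq (dx L v) <= B.
Proof.
move=> B0 Lv vB; have [Hv|nHv] := pselect (H1 L v).
  have [_ Ldv dvE] := H1_dx Hv; split => //.
  by apply: sqnorm_le_test => // chi tc; rewrite -sqrrN -dvE// vB.
(* Outside H^1 the value of [dx L v] is the default 0, for which both claims hold. *)
rewrite /dx; case: xgetP => [g _ hg|_]; first by case: nHv; exists g.
have L20 : L2 (fun=> 0) by apply: continuous_L2 => x; exact: cvg_cst.
by split; rewrite ?[sq _](a0l siL L20).
Qed.

(** The norm bound is only almost everywhere in time. Paired with a fixed test function it concerns
    a continuous function of time, so it holds at every [t > 0]. *)
Lemma Linfty_test_bound (X : (R -> R) -> Prop) u : (forall v, X v -> H1 L v) ->
  Linfty L X (sqnormH1 L) u -> continuousL2 L u -> exists2 M, 0 <= M &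
  forall t chi, 0 < t -> test chi ->
    inner (u t) chi ^+ 2 <= M * sq chi /\ inner (u t) (derive1 chi) ^+ 2 <= M * sq chi.
Proof.
move=> XH1 [_ [M hM]] cu; pose N := Num.max 0 M; exists N; first by rewrite le_max lexx.
have MN : M <= N by rewrite le_max lexx orbT.
have bound v w c : L2 v -> L2 w -> sq v <= c -> inner v w ^+ 2 <= c * sq w.
  move=> Lv Lw vc; apply: le_trans (cauchy_schwarz siL Lv Lw) _.
  by rewrite ler_wpM2r// sq_ge0.
have cont v : L2 v -> continuous_J (fun s => inner (u s) v ^+ 2).
  move=> Lv s s0; have c := pairing_continuous cu Lv s0.
  rewrite (_ : (fun _ => _) = (fun s => inner (u s) v) * (fun s => inner (u s) v)).
    by rewrite expr2; exact: cvgM.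
  by apply/funext => z; rewrite expr2.
move=> t chi t0 tc; have Lc := test_L2 tc; have Lc' := test_L2 (testD1 tc).
split; [apply: (ae_continuous_le (cont _ Lc) _ t0)|apply: (ae_continuous_le (cont _ Lc') _ t0)];
  apply: (@filterS _ _ (ae_filter_ringOfSetsType leb) _ _ _ hM) => s hs s0;
  have [Xs Ms] := hs s0; have [Lu Ldu duE] := H1_dx (XH1 _ Xs).
- apply: bound => //; apply: le_trans MN; apply: le_trans Ms.
  by rewrite /sqnormH1 lerDl sq_ge0.
- rewrite duE// sqrrN; apply: bound => //; apply: le_trans MN; apply: le_trans Ms.
  by rewrite /sqnormH1 lerDr sq_ge0.
Qed.

Lemma continuousL2_right u t : continuousL2 L u -> 0 <= t ->
  sq (u s - u t) @[s --> t^'+] --> 0.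
Proof.
move=> cu t0; apply: cvg_trans (cu.2 t t0); apply: cvg_app => A /= At.
by apply: (@filterS _ (nbhs t) _ _ _ _ At) => s sA ts; apply: sA; exact: le_trans (ltW ts).
Qed.

(** For functions that are continuous but not assumed bounded in time, the bound is available only
    near 0. *)
Lemma continuousL2_near0_bound u : continuousL2 L u -> exists2 M, 0 <= M &
  \forall t \near 0^'+, forall chi, test chi -> inner (u t) chi ^+ 2 <= M * sq chi.
Proof.
move=> cu; pose M := 2 * (sq (u 0) + 1); have Lu0 := cu.1 0 (lexx 0).
exists M; first by rewrite mulr_ge0// addr_ge0// sq_ge0.
have /cvgrPdist_lt/(_ 1 ltr01) h := continuousL2_right cu (lexx 0).
near=> t => chi tc.
have t0 : 0 < t by near: t; exact: nbhs_right_gt.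
have Lt := cu.1 t (ltW t0); have Lc := test_L2 tc.
have ht : sq (u t - u 0) < 1.
  have : `|0 - sq (u t - u 0)| < 1 by near: t.
  by rewrite sub0r normrN ger0_norm ?sq_ge0.
apply: le_trans (cauchy_schwarz siL Lt Lc) _; rewrite ler_wpM2r ?sq_ge0//.
have := sq_le_sqD siL Lu0 (siB siL Lt Lu0); rewrite addrC subrK => /le_trans; apply.
by rewrite ler_wpM2l// lerD2l; exact: ltW.
Unshelve. all: end_near. Qed.

Record unit_kernel (e : R) k : Prop := {
  unit_kernelP : kernel k;
  unit_kernel_ge0 : forall t, 0 <= k t;
  unit_kernel_supp : forall t, k t != 0 -> 0 < t < e;
  unit_kernel_int : \int[leb]_(t in J) k t = 1 }.

Lemma integral_tshift k t : kernel k -> 0 <= t ->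
  \int[leb]_(s in J) tshift k t s = \int[leb]_(s in J) k s.
Proof.
move=> kk t0; have [a [b [a0 ab k0]]] := kernel_support kk.
have at0 : 0 < a + t by rewrite ltr_wpDr.
rewrite (Rintegral_supp a0 k0) (@Rintegral_supp _ _ (a + t) (b + t) at0); last first.
  by move=> s; exact: tshift_out.
have D : derive1 (fun s : R => s - t) = cst 1.
  by apply/funext => s; rewrite derive1E derive_val subr0.
have := @integration_by_substitution_increasing R (fun s => s - t) k (a + t) (b + t).
rewrite !addrK D => sub; rewrite /Rintegral; congr fine; rewrite sub.
- by apply: eq_integral => s _; rewrite /= mulr1.
- by rewrite lerD2r ltW.
- by move=> x y _ _; rewrite ltrD2r.
- by move=> x _; exact: cvg_cst.
- exact: is_cvg_cst.
- exact: is_cvg_cst.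
- split; first by [].
  + by apply: cvgB; [exact: cvg_at_right_filter|exact: cvg_cst].
  + by apply: cvgB; [exact: cvg_at_left_filter|exact: cvg_cst].
- by apply: continuous_subspaceT; exact: (test_continuous kk).
Qed.

Lemma average_near (f k : R -> R) (e B c : R) t : continuous_J f -> unit_kernel e k -> 0 <= t ->
  (forall s, t < s < t + e -> (f s - c) ^+ 2 <= B) ->
  (\int[leb]_(s in J) (f s * tshift k t s) - c) ^+ 2 <= B.
Proof.
move=> cf [kk k0 ke k1] t0 fB; have kt := tshift_kernel_ge0 kk t0.
have i1 := integrable_kernel cf kt.
have cc : continuous_J (cst c : R -> R) by move=> s _; exact: cvg_cst.
have i2 := integrable_kernel cc kt.
have ik : leb.-integrable J (EFin \o tshift k t).
  have c1 : continuous_J (cst 1 : R -> R) by move=> s _; exact: cvg_cst.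
  have := integrable_kernel c1 kt; rewrite (_ : (fun s => _) = tshift k t)//.
  by apply/funext => s; rewrite mul1r.
have mJ := @measurable_J R.
have -> : \int[leb]_(s in J) (f s * tshift k t s) - c =
    \int[leb]_(s in J) ((f s - c) * tshift k t s).
  rewrite -[X in _ - X]mulr1 -k1 -(integral_tshift kk t0) -(RintegralZl c mJ ik).
  rewrite -(RintegralB mJ i1 i2); apply: eq_Rintegral => s _; by rewrite mulrBl.
apply: average_sq_le => //.
- by move=> s s0; apply: cvgB; [exact: cf|exact: cvg_cst].
- by move=> s; exact: k0.
- by rewrite integral_tshift.
- move=> s s0 /ke /andP[h1 h2]; apply: fB; rewrite -subr_gt0 h1/=.
  by rewrite -ltrBlDl.
Qed.

(** Kernels with support in a shorter interval are still admissible in the hypothesis, and their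
    averages come arbitrarily close to the value at [t] by right continuity. *)
Lemma pairing_limit u v (e B t : R) : continuousL2 L u -> L2 v -> 0 <= B -> 0 <= t ->
  0 < e -> (forall eta, unit_kernel e eta -> P_ u (tshift eta t) v ^+ 2 <= B) ->
  inner (u t) v ^+ 2 <= B.
Proof.
move=> cu Lv B0 t0 e0 uB; have Lut := cu.1 t t0.
suff : `|inner (u t) v| <= Num.sqrt B.
  by rewrite -ler_sqr ?nnegrE ?sqrtr_ge0// sqr_sqrtr// real_normK ?num_real.
apply/ler_addgt0Pr => q q0.
have d0 : 0 < q ^+ 2 / (sq v + 1) by rewrite divr_gt0 ?exprn_gt0// ltr_wpDl// sq_ge0.
have /cvgrPdist_lt/(_ _ d0)[e1 /= e10 he1] := continuousL2_right cu t0.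
pose e2 := Num.min e1 e.
have e20 : 0 < e2 by rewrite lt_min e10.
have [k [kk k0 ke k1]] := unit_bump_kernel e20.
have uk : unit_kernel e2 k by [].
have uk' : unit_kernel e k.
  split => // s /ke/andP[s0 se]; rewrite s0/=; apply: lt_le_trans se _.
  by rewrite ge_min lexx orbT.
have near_q s : t < s < t + e2 -> (inner (u s) v - inner (u t) v) ^+ 2 <= q ^+ 2.
  move=> /andP[ts st]; have s0 : 0 <= s by rewrite (le_trans t0) ?ltW.
  have Lus := cu.1 s s0; have Ld := siB siL Lus Lut.
  rewrite -(aBl siL Lus Lut Lv); apply: le_trans (cauchy_schwarz siL Ld Lv) _.
  have : `|0 - sq (u s - u t)| < q ^+ 2 / (sq v + 1).
    apply: he1 => //=; rewrite distrC gtr0_norm ?subr_gt0// ltrBlDl.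
    by apply: (lt_le_trans st); rewrite lerD2l ge_min lexx.
  rewrite sub0r normrN ger0_norm ?sq_ge0// ltr_pdivlMr ?ltr_wpDl ?sq_ge0//.
  rewrite -!/(sq _); have := sq_ge0 L v; have := sq_ge0 L (u s - u t).
  by move: (sq v) (sq _) => x y; nra.
have := average_near (pairing_continuous cu Lv) uk t0 near_q.
have := uB k uk'; rewrite -!/(P_ _ _ _); move: (P_ u _ v) (inner (u t) v) => A f AB Af.
have h1 : `|A| <= Num.sqrt B by rewrite -sqrtr_sqr ler_wsqrtr.
have h2 : `|A - f| <= q by rewrite -(ger0_norm (ltW q0)) -!sqrtr_sqr ler_wsqrtr.
rewrite (_ : f = A - (A - f)); last by rewrite opprB addrC subrK.
by apply: (le_trans (ler_normB _ _)); exact: lerD.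
Qed.

(* [w] is, up to sign, the distribution [chi |-> P_ u k (D chi)]; here [D] is
   the identity or the derivative. *)
Definition represents u k (D : (R -> R) -> R -> R) w :=
  L2 w /\ forall chi, test chi -> inner w chi ^+ 2 = P_ u k (D chi) ^+ 2.

(** From the solution to its mollification: a bound on pairings near 0 becomes a norm bound at time
    0, by averaging and duality. *)
Lemma represents_le u k D w (e M : R) : 0 <= M -> continuousL2 L u ->
  (forall chi, test chi -> test (D chi)) -> unit_kernel e k -> represents u k D w ->
  (forall s chi, 0 < s < e -> test chi -> inner (u s) (D chi) ^+ 2 <= M * sq chi) ->
  sq w <= M.
Proof.
move=> M0 cu tD [kk k0 ke k1] [Lw wE] uM; apply: (sqnorm_le_test L0 M0 Lw) => chi tc.
rewrite (wE _ tc); apply: average_sq_le => //.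
  exact: (pairing_continuous cu (test_L2 (tD _ tc))).
by move=> s _ /ke se; exact: uM.
Qed.

(** From the mollifications back to the solution, with the same constant. *)
Lemma represents_limit u D (e B t : R) : continuousL2 L u ->
  (forall chi, test chi -> test (D chi)) -> 0 <= B -> 0 <= t -> 0 < e ->
  (forall eta, unit_kernel e eta -> exists2 w, represents u (tshift eta t) D w & sq w <= B) ->
  forall chi, test chi -> inner (u t) (D chi) ^+ 2 <= B * sq chi.
Proof.
move=> cu tD B0 t0 e0 uB chi tc; have Lc := test_L2 tc.
apply: (pairing_limit cu (test_L2 (tD _ tc)) _ t0 e0); first by rewrite mulr_ge0// sq_ge0.
move=> eta /uB[w [Lw wE] wB]; rewrite -(wE _ tc).
by apply: (le_trans (cauchy_schwarz siL Lw Lc)); rewrite ler_wpM2r// sq_ge0.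
Qed.

End TestBounds.

(** Converse of [total_coercive]; the 4 with [kappa] comes from [s <= 2 (p + z)] and the bound [B]
    on both. *)
Lemma total_le (R : realType) (rho1 rho2 kappa alpha tau0 r d : R)
  (rho1_gt0 : 0 < rho1) (rho2_gt0 : 0 < rho2) (kappa_gt0 : 0 < kappa)
  (alpha_gt0 : 0 < alpha) (tau0_gt0 : 0 < tau0) (r_gt0 : 0 < r) :
  exists2 C, 0 <= C & forall a1 a2 b s f T S m p z B : R, 0 <= T -> 0 <= S ->
  s <= 2 * (p + z) -> m ^+ 2 <= T * S -> p <= B -> z <= B ->
  a1 <= B -> a2 <= B -> b <= B -> f <= B -> T <= B -> S <= B ->
  total rho1 rho2 kappa alpha tau0 r d a1 a2 b s f T S m <= C * B.
Proof.
have rr0 : 0 < rho1 * rho2 / kappa by rewrite divr_gt0// mulr_gt0.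
exists (rho1 + alpha + kappa * 4 + rho1 * rho2 / kappa + rho2 + (tau0 + r + 2 * `|d|)).
  by rewrite !addr_ge0 ?(ltW rr0) ?mulr_ge0 ?(ltW rho1_gt0) ?(ltW rho2_gt0)
    ?(ltW kappa_gt0) ?(ltW alpha_gt0) ?(ltW tau0_gt0) ?(ltW r_gt0).
move=> a1 a2 b s f T S m p z B T0 S0 sz mTS pB zB h1 h2 h3 h4 h5 h6.
have B0 : 0 <= B := le_trans T0 h5.
have sB : s <= 4 * B.
  by apply: (le_trans sz); rewrite (_ : 4 * B = 2 * (B + B)); [rewrite ler_wpM2l ?lerD|ring].
have mB : `|m| <= B.
  rewrite -ler_sqr ?nnegrE// real_normK ?num_real//; apply: (le_trans mTS).
  by rewrite expr2; exact: ler_pM.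
have dmB : 2 * d * m <= 2 * `|d| * B.
  rewrite -!mulrA ler_wpM2l//; apply: (le_trans (ler_norm _)).
  by rewrite normrM ler_wpM2l.
have M (k x y : R) : 0 < k -> x <= y -> k * x <= k * y by move=> k0; exact/ler_wpM2l/ltW.
refine (le_trans (lerD (lerD (lerD (lerD (lerD (M _ _ _ rho1_gt0 h1) (M _ _ _ alpha_gt0 h3))
  (M _ _ _ kappa_gt0 sB)) (M _ _ _ rr0 h2)) (M _ _ _ rho2_gt0 h4))
  (lerD (lerD (M _ _ _ tau0_gt0 h5) (M _ _ _ r_gt0 h6)) dmB)) _).
by rewrite le_eqVlt; apply/orP; left; apply/eqP; ring.
Qed.

(** * Uniform initial bounds and decay of the solution itself *)

Section EnergyDecay.
Variable R : realType.
Variables (rho1 rho2 kappa alpha delta h tau0 r mu L d xi1 xi2 : R).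
Hypothesis L0 : 0 < L.
Variables (phi phit phitt psi psit theta P : R -> R -> R).
Hypotheses (sol : solution_class L phi phit phitt psi psit theta P)
  (eqs : equations rho1 rho2 kappa alpha delta h tau0 r mu L d xi1 xi2
    phi phit phitt psi psit theta P)
  (bnd : boundary_conditions L phi psi theta P).
Local Notation leb := (@lebesgue_measure R).
Local Notation I := `]0, L[%classic.
Local Notation J := (`]0, +oo[%classic : set R).
Local Notation test := (test_function I).
Local Notation kernel := (test_function J).
Local Notation inner := (inner L).
Local Notation sq := (sqnormL2 L).
Local Notation L2 := (L2 L).
Local Notation siL := (L2_semi_inner L).
Local Notation P_ := (time_pairing L).
Local Notation m1 u k := (mollify L u k).1.
Local Notation m2 u k := (mollify L u k).2.
Local Notation dk := dkernel.
Local Notation represents := (represents L).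
Local Notation W eta := (mollified_energy rho1 rho2 kappa alpha tau0 r L d phi psi theta P eta).
Let testD1 := test_derive1 (@I_itv R L) (I_neq0 L0).
Implicit Types (v w g chi k eta : R -> R) (u : R -> R -> R).

Lemma square_sum_le v w : L2 v -> L2 w ->
  inner v v + 2 * inner v w + inner w w <= 2 * (inner v v + inner w w).
Proof.
move=> Lv Lw; have := sq_le_sqD siL Lv Lw; have := sqD siL 1 Lv Lw.
by rewrite scale1r mulr1 expr1n mul1r => ->.
Qed.

Lemma tshift0 k : tshift k 0 = k.
Proof. by apply/funext => s; rewrite /tshift subr0. Qed.

Opaque mollify dkernel Defs.inner time_pairing tshift.

Lemma represents_id u k : mollified L u k (m1 u k) (m2 u k) -> represents u k id (m1 u k).
Proof. by case=> [[Lm _ _] mE]; split=> // chi tc; rewrite mE. Qed.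

Lemma represents_derive1 u k : mollified L u k (m1 u k) (m2 u k) ->
  represents u k (fun chi => derive1 chi) (m2 u k).
Proof.
move=> mm; have [[_ Lm _] _] := mm; split=> // chi tc.
by rewrite (mollified_derive1 L0 mm tc) sqrrN.
Qed.

Lemma represents_congr u u' k k' D w : (forall chi, test chi -> test (D chi)) ->
  (forall chi, test chi -> P_ u' k' chi = P_ u k chi) ->
  represents u k D w -> represents u' k' D w.
Proof. by move=> tD E [Lw wE]; split=> // chi tc; rewrite wE// E//; exact: tD. Qed.

(** Dictionary between the functions of the solution, mollified with [eta], and the mollifications
    of phi with differentiated kernels that appear in the Lyapunov functional. *)
Lemma mollified_represents eta t : kernel eta -> 0 <= t ->
  [/\ represents phit (tshift eta t) id (m1 phi (tshift (dk eta) t)),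
    represents phitt (tshift eta t) id (m1 phi (tshift (dk (dk eta)) t)),
    represents phit (tshift eta t) (fun chi => derive1 chi) (m2 phi (tshift (dk eta) t)) &
    represents phi (tshift eta t) (fun chi => derive1 chi) (m2 phi (tshift eta t))] /\
  [/\ represents psi (tshift eta t) id (m1 psi (tshift eta t)),
    represents psi (tshift eta t) (fun chi => derive1 chi) (m2 psi (tshift eta t)),
    represents theta (tshift eta t) id (m1 theta (tshift eta t)) &
    represents P (tshift eta t) id (m1 P (tshift eta t))].
Proof.
move=> ke t0; have k1 := kernel_dkernel ke; have k2 := kernel_dkernel k1.
have kt := tshift_kernel_ge0 ke t0; have kt1 := tshift_kernel_ge0 k1 t0.
have kt2 := tshift_kernel_ge0 k2 t0.
have M0 := mollify_phi L0 sol bnd kt; have M1 := mollify_phi L0 sol bnd kt1.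
have M2 := mollify_phi L0 sol bnd kt2; have N0 := mollify_psi L0 sol bnd kt.
have Th := mollify_theta L0 sol bnd kt; have Pi := mollify_P L0 sol bnd kt.
have E1 chi : test chi -> P_ phit (tshift eta t) chi = P_ phi (tshift (dk eta) t) chi.
  by move=> tc; rewrite -(dkernel_tshift t ke); exact: (pairing_phit sol kt tc).
have E2 chi : test chi -> P_ phitt (tshift eta t) chi = P_ phi (tshift (dk (dk eta)) t) chi.
  move=> tc; rewrite -(dkernel_tshift t k1) -(dkernel_tshift t ke).
  exact: (pairing_phitt sol kt tc).
have tid chi : test chi -> test (id chi) by [].
split; split.
- exact: (represents_congr tid E1 (represents_id M1)).
- exact: (represents_congr tid E2 (represents_id M2)).
- exact: (represents_congr testD1 E1 (represents_derive1 M1)).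
- exact: represents_derive1.
- exact: represents_id.
- exact: represents_derive1.
- exact: represents_id.
- exact: represents_id.
Qed.

Let tid chi : test chi -> test (id chi). Proof. by []. Qed.
Let cphi := repr_phi sol. Let cphit := repr_phit sol. Let cphitt := class_phitt sol.
Let cpsi := repr_psi sol. Let cth := class_theta sol. Let cP := class_P sol.

Lemma solution_test_bound : exists2 M, 0 <= M & exists2 e, 0 < e &
  forall t chi, 0 < t < e -> test chi ->
  [/\ inner (phit t) chi ^+ 2 <= M * sq chi, inner (phitt t) chi ^+ 2 <= M * sq chi,
    inner (phit t) (derive1 chi) ^+ 2 <= M * sq chi &
    inner (phi t) (derive1 chi) ^+ 2 <= M * sq chi] /\
  [/\ inner (psi t) chi ^+ 2 <= M * sq chi, inner (psi t) (derive1 chi) ^+ 2 <= M * sq chi,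
    inner (theta t) chi ^+ 2 <= M * sq chi & inner (P t) chi ^+ 2 <= M * sq chi].
Proof.
have H10_H1 v : H10 L v -> H1 L v by case.
have [M1 M10 h1] := Linfty_test_bound L0 H10_H1 (class_phi sol) cphi.
have [M2 M20 h2] := Linfty_test_bound L0 H10_H1 (class_phit sol) cphit.
have [M3 M30 h3] := Linfty_test_bound L0 (fun v hv => hv) (class_psi sol) cpsi.
have [M4 M40 h4] := continuousL2_near0_bound cphitt.
have [M5 M50 h5] := continuousL2_near0_bound cth.
have [M6 M60 h6] := continuousL2_near0_bound cP.
have [[l1 l2 l3] [l4 l5 l6]] := le_sum6 M10 M20 M30 M40 M50 M60.
have [e /= e0 he] := filterI h4 (filterI h5 h6).
exists (M1 + M2 + M3 + M4 + M5 + M6); first by rewrite !addr_ge0.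
exists e => // t chi /andP[t0 te] tc.
move: (M1 + _ + _ + _ + _ + _) l1 l2 l3 l4 l5 l6 => M l1 l2 l3 l4 l5 l6.
have up N x : N <= M -> x <= N * sq chi -> x <= M * sq chi.
  by move=> NM /le_trans; apply; rewrite ler_wpM2r// sq_ge0.
have [|h4t [h5t h6t]] := he t _ t0; first by rewrite /= sub0r normrN gtr0_norm.
have [_ g1] := h1 t chi t0 tc; have [g2 g3] := h2 t chi t0 tc.
have [g4 g5] := h3 t chi t0 tc.
split; split.
- exact: up l2 g2.
- exact: up l4 (h4t _ tc).
- exact: up l2 g3.
- exact: up l1 g1.
- exact: up l3 g4.
- exact: up l3 g5.
- exact: up l5 (h5t _ tc).
- exact: up l6 (h6t _ tc).
Qed.

Lemma snap_s_le eta t : kernel eta -> 0 <= t ->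
  snap_s L phi psi eta t <= 2 * (snap_p L phi eta t + snap_z L psi eta t).
Proof.
move=> ke t0; have kt := tshift_kernel_ge0 ke t0.
have [[_ Lp' _] _] := mollify_phi L0 sol bnd kt; have [[Lp _ _] _] := mollify_psi L0 sol bnd kt.
exact: (square_sum_le Lp' Lp).
Qed.

Hypotheses (rho1_gt0 : 0 < rho1) (rho2_gt0 : 0 < rho2) (kappa_gt0 : 0 < kappa)
  (alpha_gt0 : 0 < alpha) (tau0_gt0 : 0 < tau0) (r_gt0 : 0 < r).

(** A kernel supported in []0, e[] averages the solution over those times only, where
    [solution_test_bound] holds with one constant for all kernels. *)
Lemma initial_energy_bound : exists2 C, 0 <= C & exists2 e, 0 < e &
  forall eta, unit_kernel e eta -> W eta 0 <= C.
Proof.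
have [C C0 hC] := total_le d rho1_gt0 rho2_gt0 kappa_gt0 alpha_gt0 tau0_gt0 r_gt0.
have [M M0 [e e0 hM]] := solution_test_bound.
exists (C * M); first by rewrite mulr_ge0.
exists e => // eta ue; have ke := unit_kernelP ue.
have [[r1 r2 r3 r4] [r5 r6 r7 r8]] := mollified_represents ke (lexx 0).
have ss := snap_s_le ke (lexx 0).
have [z0 [z1 [z2 [z3 [z4 [_ [T0 S0 _ _ _] _ _ mTS _ _ _ _ _ _ _ _]]]]]] :=
  mollified_snapshot L0 sol eqs bnd ke (lexx 0).
have bd u D w : continuousL2 L u -> (forall chi, test chi -> test (D chi)) ->
    represents u (tshift eta 0) D w ->
    (forall s chi, 0 < s < e -> test chi -> inner (u s) (D chi) ^+ 2 <= M * sq chi) ->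
    sq w <= M.
  by move=> cu tD; rewrite tshift0 => rep; exact: (represents_le L0 M0 cu tD ue rep).
apply: (hC _ _ _ _ _ _ _ _ _ _ _ T0 S0 ss mTS).
- by apply: (bd _ _ _ cphi testD1 r4) => s chi se tc; have [[]] := hM s chi se tc.
- by apply: (bd _ _ _ cpsi tid r5) => s chi se tc; have [_ []] := hM s chi se tc.
- by apply: (bd _ _ _ cphit tid r1) => s chi se tc; have [[]] := hM s chi se tc.
- by apply: (bd _ _ _ cphitt tid r2) => s chi se tc; have [[]] := hM s chi se tc.
- by apply: (bd _ _ _ cpsi testD1 r6) => s chi se tc; have [_ []] := hM s chi se tc.
- by apply: (bd _ _ _ cphit testD1 r3) => s chi se tc; have [[]] := hM s chi se tc.
- by apply: (bd _ _ _ cth tid r7) => s chi se tc; have [_ []] := hM s chi se tc.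
- by apply: (bd _ _ _ cP tid r8) => s chi se tc; have [_ []] := hM s chi se tc.
Qed.

Hypotheses (delta_gt0 : 0 < delta) (h_gt0 : 0 < h) (mu_gt0 : 0 < mu)
  (det_gt0 : d ^+ 2 < tau0 * r).

Lemma solution_decay : exists l C, [/\ 0 < l, 0 <= C & forall t, 0 <= t ->
  let B := C * expR (- l * t) in
  [/\ sq (phit t) <= B, sq (phitt t) <= B,
    L2 (dx L (phit t)) /\ sq (dx L (phit t)) <= B &
    L2 (dx L (phi t)) /\ sq (dx L (phi t)) <= B] /\
  [/\ sq (psi t) <= B, L2 (dx L (psi t)) /\ sq (dx L (psi t)) <= B,
    sq (theta t) <= B & sq (P t) <= B]].
Proof.
have K0 : 0 <= 4 * L ^+ 2 by rewrite mulr_ge0// sqr_ge0.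
have [N [l [Q [N0 l0 Q0 hyp]]]] := lyapunov_constants xi1 xi2 rho1_gt0 rho2_gt0 kappa_gt0
  alpha_gt0 delta_gt0 h_gt0 tau0_gt0 r_gt0 mu_gt0 K0 det_gt0.
have [c c0 hc] := total_coercive mu xi1 xi2 rho1_gt0 rho2_gt0 kappa_gt0 alpha_gt0
  tau0_gt0 r_gt0 K0 det_gt0.
have [C0 C00 [e e0 hC0]] := initial_energy_bound.
exists l, (c * (Q * C0)); split; [by []|by rewrite !mulr_ge0// ltW|].
move=> t t0 B; have B0 : 0 <= B by rewrite mulr_ge0 ?expR_ge0// !mulr_ge0// ltW.
have Wt eta : unit_kernel e eta -> c * W eta t <= B.
  move=> ue; rewrite /B -mulrA ler_wpM2l//.
  apply: le_trans (mollified_energy_decay L0 sol eqs bnd (unit_kernelP ue)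
    (lt0r_neq0 kappa_gt0) N0 l0 Q0 hyp t0) _.
  by rewrite ler_wpM2r ?expR_ge0// ler_wpM2l ?(ltW Q0)// hC0.
have app eta (ue : unit_kernel e eta) := mollified_represents (unit_kernelP ue) t0.
have sn eta : unit_kernel e eta ->
    [/\ snap_a1 L phi eta t <= B, snap_a2 L phi eta t <= B, snap_b L psi eta t <= B &
      snap_f L phi eta t <= B] /\
    [/\ snap_T L theta eta t <= B, snap_S L P eta t <= B, snap_p L phi eta t <= B &
      snap_z L psi eta t <= B].
  move=> ue; have [z0 [z1 [z2 [z3 [z4 /hc[[q1 q2 q3 q4] [q5 q6 q7 q8]]]]]]] :=
    mollified_snapshot L0 sol eqs bnd (unit_kernelP ue) t0.
  have w := Wt _ ue; exact: (conj (And4 (le_trans q1 w) (le_trans q2 w) (le_trans q3 w)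
    (le_trans q4 w)) (And4 (le_trans q5 w) (le_trans q6 w) (le_trans q7 w) (le_trans q8 w))).
have lim u D : continuousL2 L u -> (forall chi, test chi -> test (D chi)) ->
    (forall eta, unit_kernel e eta -> exists2 w, represents u (tshift eta t) D w & sq w <= B) ->
    forall chi, test chi -> inner (u t) (D chi) ^+ 2 <= B * sq chi.
  by move=> cu tD; exact: (represents_limit cu tD B0 t0 e0).
have L2u u : continuousL2 L u -> L2 (u t) by case=> + _; exact.
split; split.
- apply: (sqnorm_le_test L0 B0 (L2u _ cphit)); apply: (lim _ _ cphit tid) => eta ue.
  by have [[r1 _ _ _] _] := app _ ue; have [[s1 _ _ _] _] := sn _ ue;
    exists (m1 phi (tshift (dk eta) t)).
- apply: (sqnorm_le_test L0 B0 (L2u _ cphitt)); apply: (lim _ _ cphitt tid) => eta ue.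
  by have [[_ r2 _ _] _] := app _ ue; have [[_ s2 _ _] _] := sn _ ue;
    exists (m1 phi (tshift (dk (dk eta)) t)).
- apply: (dx_sq_le L0 B0 (L2u _ cphit)); apply: (lim _ _ cphit testD1) => eta ue.
  by have [[_ _ r3 _] _] := app _ ue; have [[_ _ _ s4] _] := sn _ ue;
    exists (m2 phi (tshift (dk eta) t)).
- apply: (dx_sq_le L0 B0 (L2u _ cphi)); apply: (lim _ _ cphi testD1) => eta ue.
  by have [[_ _ _ r4] _] := app _ ue; have [_ [_ _ s7 _]] := sn _ ue;
    exists (m2 phi (tshift eta t)).
- apply: (sqnorm_le_test L0 B0 (L2u _ cpsi)); apply: (lim _ _ cpsi tid) => eta ue.
  by have [_ [r5 _ _ _]] := app _ ue; have [_ [_ _ _ s8]] := sn _ ue;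
    exists (m1 psi (tshift eta t)).
- apply: (dx_sq_le L0 B0 (L2u _ cpsi)); apply: (lim _ _ cpsi testD1) => eta ue.
  by have [_ [_ r6 _ _]] := app _ ue; have [[_ _ s3 _] _] := sn _ ue;
    exists (m2 psi (tshift eta t)).
- apply: (sqnorm_le_test L0 B0 (L2u _ cth)); apply: (lim _ _ cth tid) => eta ue.
  by have [_ [_ _ r7 _]] := app _ ue; have [_ [s5 _ _ _]] := sn _ ue;
    exists (m1 theta (tshift eta t)).
- apply: (sqnorm_le_test L0 B0 (L2u _ cP)); apply: (lim _ _ cP tid) => eta ue.
  by have [_ [_ _ _ r8]] := app _ ue; have [_ [_ s6 _ _]] := sn _ ue;
    exists (m1 P (tshift eta t)).
Qed.

Lemma energyE t : 0 <= t ->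
  L2 (dx L (phit t)) -> L2 (dx L (phi t)) -> L2 (dx L (psi t)) ->
  energy rho1 rho2 kappa alpha tau0 r L d phi phit phitt psi theta P t =
  2^-1 * total rho1 rho2 kappa alpha tau0 r d (sq (phit t)) (sq (phitt t)) (sq (dx L (psi t)))
    (sq (dx L (phi t)) + 2 * inner (dx L (phi t)) (psi t) + sq (psi t)) (sq (dx L (phit t)))
    (sq (theta t)) (sq (P t)) (inner (theta t) (P t)).
Proof.
move=> t0 Lft Lf Lp'; have Lp := cpsi.1 t t0; have Lft1 := cphit.1 t t0.
have Lft2 := cphitt.1 t t0; have Lth := cth.1 t t0; have LP := cP.1 t t0.
have ii v w (Lv : L2 v) (Lw : L2 w) := inner_integrable Lv Lw.
pose s1 : seq (R * (R -> R)) := [:: (rho1, fun x => phit t x * phit t x);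
  (alpha, fun x => dx L (psi t) x * dx L (psi t) x);
  (kappa, fun x => dx L (phi t) x * dx L (phi t) x);
  (kappa * 2, fun x => dx L (phi t) x * psi t x);
  (kappa, fun x => psi t x * psi t x);
  (rho1 * rho2 / kappa, fun x => phitt t x * phitt t x);
  (rho2, fun x => dx L (phit t) x * dx L (phit t) x)].
have [_ E1] := @lincombP _ _ _ leb I (@measurable_I R L) s1
  (conj (ii _ _ Lft1 Lft1) (conj (ii _ _ Lp' Lp') (conj (ii _ _ Lf Lf) (conj (ii _ _ Lf Lp)
  (conj (ii _ _ Lp Lp) (conj (ii _ _ Lft2 Lft2) (conj (ii _ _ Lft Lft) Logic.I))))))).
pose s2 : seq (R * (R -> R)) := [:: (tau0, fun x => theta t x * theta t x);
  (r, fun x => P t x * P t x); (2 * d, fun x => theta t x * P t x)].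
have [_ E2] := @lincombP _ _ _ leb I (@measurable_I R L) s2
  (conj (ii _ _ Lth Lth) (conj (ii _ _ LP LP) (conj (ii _ _ Lth LP) Logic.I))).
rewrite /energy /total.
have -> : \int[leb]_(x in I) (rho1 * phit t x ^+ 2 + alpha * dx L (psi t) x ^+ 2
     + kappa * (dx L (phi t) x + psi t x) ^+ 2
     + rho1 * rho2 / kappa * phitt t x ^+ 2 + rho2 * dx L (phit t) x ^+ 2)
  = lincomb_integral leb I s1.
  rewrite -E1; apply: eq_Rintegral => x _; cbn [lincomb s1 fst snd].
  move: (phit t x) (dx L (psi t) x) (dx L (phi t) x) (psi t x) (phitt t x) (dx L (phit t) x).
  by move=> *; ring.
have -> : \int[leb]_(x in I) (tau0 * theta t x ^+ 2 + r * P t x ^+ 2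
     + 2 * d * theta t x * P t x) = lincomb_integral leb I s2.
  rewrite -E2; apply: eq_Rintegral => x _; cbn [lincomb s2 fst snd].
  by move: (theta t x) (P t x) => *; ring.
rewrite -mulrDr; congr (_ * _).
have alg (A B C D E F G a b c : R) : rho1 * A + (alpha * B + (kappa * C + (kappa * 2 * D +
  (kappa * E + (rho1 * rho2 / kappa * F + (rho2 * G + 0))))))
  + (tau0 * a + (r * b + (2 * d * c + 0)))
  = rho1 * A + alpha * B + kappa * (C + 2 * D + E) + rho1 * rho2 / kappa * F + rho2 * G
    + (tau0 * a + r * b + 2 * d * c) by ring.
exact: alg.
Qed.

End EnergyDecay.

Theorem theorem3p10 (R : realType)
  (rho1 rho2 kappa alpha delta h tau0 r mu L d xi1 xi2 : R)
  (rho1_gt0 : 0 < rho1) (rho2_gt0 : 0 < rho2) (kappa_gt0 : 0 < kappa)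
  (alpha_gt0 : 0 < alpha) (delta_gt0 : 0 < delta) (h_gt0 : 0 < h)
  (tau0_gt0 : 0 < tau0) (r_gt0 : 0 < r) (mu_gt0 : 0 < mu) (L_gt0 : 0 < L)
  (posdef : posdefmx (symmx2 tau0 d r))
  (phi phit phitt psi psit theta P : R -> R -> R)
  (phi0 phi1 phi2 : R -> R) (phi3 : (R -> R) -> R) (psi0 theta0 P0 : R -> R)
  (sol_class : solution_class L phi phit phitt psi psit theta P)
  (sol_eqs : equations rho1 rho2 kappa alpha delta h tau0 r mu L d xi1 xi2
               phi phit phitt psi psit theta P)
  (sol_init : initial_conditions L phi phit phitt psi theta P
                phi0 phi1 phi2 phi3 psi0 theta0 P0)
  (sol_bound : boundary_conditions L phi psi theta P) :
  exists lambda1 lambda2 : R, [/\ 0 < lambda1, 0 < lambda2 &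
    forall t : R, 0 <= t ->
      energy rho1 rho2 kappa alpha tau0 r L d phi phit phitt psi theta P t
        <= lambda2 * expR (- lambda1 * t)].
Proof.
have det_gt0 := symmx2_posdef posdef r_gt0.
have [l [C [l0 C0 decay]]] := solution_decay L_gt0 sol_class sol_eqs sol_bound rho1_gt0
  rho2_gt0 kappa_gt0 alpha_gt0 tau0_gt0 r_gt0 delta_gt0 h_gt0 mu_gt0 det_gt0.
have [A A0 hA] := total_le d rho1_gt0 rho2_gt0 kappa_gt0 alpha_gt0 tau0_gt0 r_gt0.
(* [A] and [C] are only known to be nonnegative; the 1 makes the constant positive. *)
exists l, (2^-1 * (A * C) + 1); split=> //.
  by rewrite ltr_wpDl// !mulr_ge0.
move=> t t0; have [[q1 q2 [Lq3 q3] [Lq4 q4]] [q5 [Lq6 q6] q7 q8]] := decay t t0.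
rewrite (energyE rho1 rho2 kappa alpha tau0 r d sol_class t0 Lq3 Lq4 Lq6).
apply: (@le_trans _ _ (2^-1 * (A * (C * expR (- l * t))))).
  rewrite ler_wpM2l//; apply: (hA _ _ _ _ _ _ _ _ _ _ _ (sq_ge0 _ _) (sq_ge0 _ _) _ _ q4 q5
    q1 q2 q6 q3 q7 q8).
    exact: (square_sum_le Lq4 ((repr_psi sol_class).1 t t0)).
  exact: (cauchy_schwarz (L2_semi_inner L) ((class_theta sol_class).1 t t0)
    ((class_P sol_class).1 t t0)).
by rewrite !mulrA ler_wpM2r ?expR_ge0// -!mulrA lerDl.
Qed.
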